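(* Let $\mathfrak g$ be of type $C_n$, let $i\in I=\{1,\dots,n\}$ and let $k\in\mathbb Z_{\ge 0}$ with $i-k\equiv 1 \pmod 2$. Then the $q$-character of the fundamental $U_q(\widehat{\mathfrak g})$-module $L(Y_{i,k})$ is $$\chi_q(L(Y_{i,k}))=\sum_{p\,\in\,\overline{\mathscr P}_{i,k}}\mathsf m(p),$$ where $\overline{\mathscr P}_{i,k}$ is the set of admissible paths and $\mathsf m$ is the monomial map, both defined in the context.
   Context: **Paths.** Let $n\ge 1$, $I=\{1,\dots,n\}$, $N=2n$, $\mathscr I=\{0,1,\dots,N\}$, $\mathscr I_\circ=\{1,\dots,N-1\}$, and $\mathcal X=\{(i,k)\in\mathscr I\times\mathbb Z : i-k\equiv 1 \bmod 2\}$. For $(i,k)\in\mathcal X$, let $\mathscr P_{i,k}$ be the set of sequences $p=((r,y_r))_{r\in\mathscr I}$ of points of $\mathcal X$ with $y_0=i+k$, $y_N=N-i+k$ and $y_{r+1}-y_r\in\{-1,1\}$ for $0\le r\le N-1$. Elements of $\mathscr P=\bigsqcup_{(i,k)\in\mathcal X}\mathscr P_{i,k}$ are called paths. The sets of upper and lower corners of $p$ are $C_{p,+}=\{(r,y_r): r\in\mathscr I_\circ,\ y_{r-1}=y_r+1=y_{r+1}\}$ and $C_{p,-}=\{(r,y_r): r\in\mathscr I_\circ,\ y_{r-1}=y_r-1=y_{r+1}\}$. The set of admissible paths is $\overline{\mathscr P}_{i,k}=\{((j,\ell_j))_{j\in\mathscr I}\in\mathscr P_{i,k} : \ell_j\le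 \ell_{N-j}\text{ for all } j\in I\}$. **Monomial map.** For $j\in\mathscr I_\circ$ put $\overline j=j$ if $j\le n$ and $\overline j=N-j$ if $j>n$. With $\delta(\text{statement})=1$ if the statement is true and $0$ otherwise, define $$\mathsf m(p)=\prod_{(j,\ell)\in C_{p,+}}Y_{\overline j,\ \ell+2\delta(j>n)}\ \prod_{(j,\ell)\in C_{p,-}}Y_{\overline j,\ \ell+2\delta(j\ge n)}^{-1},$$ a Laurent monomial in the variables $Y_{j,\ell}$ ($j\in I,\ \ell\in\mathbb Z$), where $Y_{j,\ell}:=Y_{j,q^\ell}$. **Type $C_n$ data.** The Cartan matrix $(a_{ij})_{i,j\in I}$ has $a_{ii}=2$, $a_{ij}=-1$ if $|i-j|=1$ and $(i,j)\neq(n-1,n)$, $a_{n-1,n}=-2$, and $a_{ij}=0$ otherwise ($\alpha_n$ is the long simple root). Put $d_i=1$ for $i<n$, $d_n=2$. Fix $q\in\mathbb C^\times$ not a root of unity and set $q_i=q^{d_i}$. Write $[m]_i=\frac{q_i^m-q_i^{-m}}{q_i-q_i^{-1}}$, and $\begin{bmatrix} m\\k\end{bmatrix}_i$ for the corresponding Gaussian binomial. **Quantum affine algebra.** $U_q(\widehat{\mathfrak g})$ (untwisted, without degree operator) is the $\mathbb C$-algebra with generators $x^\pm_{i,r}$ ($i\in I,r\in\mathbb Z$), $k_i^{\pm1}$ ($i\in I$), $h_{i,r}$ ($i\in I$, $r\in\mathbb Z\setminus\{0\}$), and central invertible $C^{\pm 1/2}$, subject to: the $k_i$ are invertible and commute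 with each other and with all $h_{j,r}$; $k_ix^\pm_{j,r}k_i^{-1}=q_i^{\pm a_{ij}}x^\pm_{j,r}$; $[h_{i,r},h_{j,s}]=\delta_{r,-s}\frac1r[ra_{ij}]_i\frac{C^r-C^{-r}}{q_j-q_j^{-1}}$; $[h_{i,r},x^\pm_{j,s}]=\pm\frac1r[ra_{ij}]_iC^{\mp|r|/2}x^\pm_{j,r+s}$; $x^\pm_{i,r+1}x^\pm_{j,s}-q_i^{\pm a_{ij}}x^\pm_{j,s}x^\pm_{i,r+1}=q_i^{\pm a_{ij}}x^\pm_{i,r}x^\pm_{j,s+1}-x^\pm_{j,s+1}x^\pm_{i,r}$; $[x^+_{i,r},x^-_{j,s}]=\delta_{ij}\frac{C^{(r-s)/2}\psi^+_{i,r+s}-C^{-(r-s)/2}\psi^-_{i,r+s}}{q_i-q_i^{-1}}$; and, for $i\ne j$, $m=1-a_{ij}$ and any integers $r_1,\dots,r_m,s$, $\sum_{w\in\mathfrak S_m}\sum_{k=0}^m(-1)^k\begin{bmatrix} m\\k\end{bmatrix}_i x^\pm_{i,r_{w(1)}}\cdots x^\pm_{i,r_{w(k)}}x^\pm_{j,s}x^\pm_{i,r_{w(k+1)}}\cdots x^\pm_{i,r_{w(m)}}=0$. Here $\sum_{r\ge0}\psi^\pm_{i,\pm r}z^{\pm r}=k_i^{\pm1}\exp\big(\pm(q_i-q_i^{-1})\sum_{s\ge1}h_{i,\pm s}z^{\pm s}\big)$, and $\psi^+_{i,r}=0$ for $r<0$, $\psi^-_{i,r}=0$ for $r>0$. **Modules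 and $q$-characters.** All modules are finite-dimensional of type 1: $C^{\pm1/2}$ acts as the identity and the $k_i$ act diagonalizably with eigenvalues integral powers of $q_i$ (so the module is a direct sum of weight spaces for the weight lattice). On such $V$ the operators $\psi^\pm_{i,\pm r}$ commute, and $V$ is the direct sum of its joint generalized eigenspaces $V_\Phi$, $\Phi=(\phi^\pm_{i,\pm r})_{i\in I,r\ge0}$ (the $\ell$-weights). For each $\ell$-weight with $V_\Phi\ne0$ and each $i$, both series $\sum_{r\ge0}\phi^\pm_{i,\pm r}z^{\pm r}$ are the expansions (at $z=0$ for $+$, at $z=\infty$ for $-$) of a rational function $q_i^{\deg Q_i-\deg R_i}\frac{Q_i(zq_i^{-1})R_i(zq_i)}{Q_i(zq_i)R_i(zq_i^{-1})}$ with $Q_i(z)=\prod_{a\in\mathbb C^\times}(1-az)^{r_{i,a}}$, $R_i(z)=\prod_{a\in\mathbb C^\times}(1-az)^{s_{i,a}}$, $r_{i,a},s_{i,a}\in\mathbb Z_{\ge0}$; put $m_\Phi=\prod_{i\in I,a\in\mathbb C^\times}Y_{i,a}^{r_{i,a}-s_{i,a}}$. The $q$-character of $V$ is $\chi_q(V)=\sum_\Phi\dim(V_\Phi)\,m_\Phi\in\mathbb Z[Y_{i,a}^{\pm1}]_{i\in I,a\in\mathbb C^\times}$. **Fundamental modules.** For a monomial $m=m_\Phi$ in the $Y_{i,a}$ with nonnegative exponents, $L(m)$ denotes the unique (up to isomorphism) finite-dimensional simple module generated by a nonzero vector $v$ with $x^+_{i,r}v=0$ for all $i\in I,r\in\mathbb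 Z$ and $\psi^\pm_{i,\pm r}v=\phi^\pm_{i,\pm r}v$ for all $i\in I$, $r\ge0$. The module $L(Y_{i,k})$, with $Y_{i,k}=Y_{i,q^k}$, is a fundamental module. *)

(* Defs.v *)
From HB Require Import structures.
From mathcomp Require Import all_boot all_order all_fingroup all_algebra.
From mathcomp Require Import all_classical reals.
From mathcomp Require Import complex.
From mathcomp Require Import finmap zify.
From mathcomp.multinomials Require Import monalg.

Set Implicit Arguments.
Unset Strict Implicit.
Unset Printing Implicit Defensive.

Import Order.TTheory GRing.Theory Num.Theory.

Local Open Scope classical_set_scope.
Local Open Scope ring_scope.

(* Conventions.
   - The Dynkin node i of {1, ..., n} is the ordinal of value i - 1 in 'I_n.
     Path positions are not shifted: they are the naturals 0, ..., 2 * n.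
   - A boolean sign b stands for + when b = true and - when b = false. *)

Definition signed (b : bool) (m : int) : int := if b then m else - m.

(* The multiplicative group of Laurent monomials is free abelian on the
   Y_{i,a}; it is written additively, a monomial being its exponent function.
   (Variables with a = 0 exist in this type but are never used.) *)
Definition lmon (C : fieldType) (n : nat) := {malg int[('I_n * C)%type]}.
HB.instance Definition _ (C : fieldType) (n : nat) :=
  GRing.Zmodule.on (lmon C n).

(* The additive group of Z[Y_{i,a}^{+-1}], free on the monomials: the basis
   element attached to m is << m >>, and << z *g m >> is z times it. *)
Definition laurent (C : fieldType) (n : nat) := {malg int[lmon C n]}.
HB.instance Definition _ (C : fieldType) (n : nat) :=
  GRing.Zmodule.on (laurent C n).

Definition Yvar (C : fieldType) (n : nat) (i : 'I_n) (a : C) : lmon C n :=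
  << (i, a) >>.

Definition inX (n i : nat) (k : int) : Prop :=
  (i <= 2 * n)%N /\ (i%:Z - k == 1 %[mod 2])%Z.

Section Paths.
Variable n : nat.

(* The path ((r, y_r))_{0 <= r <= 2 n} is stored as the tuple of the y_r. *)
Definition pathT := (2 * n).+1.-tuple int.
HB.instance Definition _ := Choice.on pathT.

Definition is_path (i : nat) (k : int) (y : pathT) : Prop :=
  [/\ forall r : nat, (r <= 2 * n)%N -> inX n r y`_r,
      y`_0 = i%:Z + k,
      y`_(2 * n) = (2 * n)%:Z - i%:Z + k
    & forall r : nat, (r < 2 * n)%N ->
        y`_r.+1 - y`_r = -1 \/ y`_r.+1 - y`_r = 1].

Definition admissible (i : nat) (k : int) : set pathT :=
  [set y : pathT | is_path i k y /\
     forall j : nat, (1 <= j <= n)%N -> y`_j <= y`_(2 * n - j)].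

Definition upper_corner (y : pathT) (r : nat) : bool :=
  [&& (0 < r < 2 * n)%N, y`_r.-1 == y`_r + 1 & y`_r.+1 == y`_r + 1].

Definition lower_corner (y : pathT) (r : nat) : bool :=
  [&& (0 < r < 2 * n)%N, y`_r.-1 == y`_r - 1 & y`_r.+1 == y`_r - 1].

Definition fold_pos (j : nat) : nat := if (j <= n)%N then j else (2 * n - j)%N.

Lemma fold_pos_subproof (j : 'I_(2 * n)) : ((fold_pos j).-1 < n)%N.
Proof.
by case: j => j ltj; rewrite /fold_pos /=; case: (leqP j n); lia.
Qed.

(* The node of label \overline j; irrelevant value at j = 0. *)
Definition bar (j : 'I_(2 * n)) : 'I_n := Ordinal (fold_pos_subproof j).

Variables (C : fieldType) (q : C).

Definition path_mon (y : pathT) : lmon C n :=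
  \sum_(j < 2 * n | upper_corner y j)
     Yvar (bar j) (q ^ (y`_j + 2 * (n < j)%N%:Z))
  - \sum_(j < 2 * n | lower_corner y j)
     Yvar (bar j) (q ^ (y`_j + 2 * (n <= j)%N%:Z)).

End Paths.

Arguments admissible n i k : clear implicits.

Definition cartan (n : nat) (i j : 'I_n) : int :=
  if i == j then 2
  else if (i.+1 == j)%N || (j.+1 == i)%N then
    if (i.+2 == n)%N && (j.+1 == n)%N then -2 else -1
  else 0.

Definition symd (n : nat) (i : 'I_n) : nat := if (i.+1 == n)%N then 2 else 1.

Section QNumbers.
Variables (C : fieldType) (q : C).

Definition qsub (n : nat) (i : 'I_n) : C := q ^+ symd i.

Definition qint (m : int) : C := (q ^ m - q ^ (- m)) / (q - q^-1).
Definition qfact (m : nat) : C := \prod_(1 <= t < m.+1) qint t%:Z.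
Definition qbinom (m k : nat) : C := qfact m / (qfact k * qfact (m - k)).
End QNumbers.

Definition endo (C : fieldType) (V : vectType C) : Type := 'End(V).
HB.instance Definition _ (C : fieldType) (V : vectType C) :=
  Vector.on (endo V).
HB.instance Definition _ (C : fieldType) (V : vectType C) :=
  GRing.Zmodule_isPzRing.Build (endo V)
    (@comp_lfunA _ _ _ _ _) (@comp_lfun1l _ _ _) (@comp_lfun1r _ _ _)
    (@comp_lfunDl _ _ _ _) (@comp_lfunDr _ _ _ _).

Section QuantumAffine.
Variables (C : fieldType) (q : C) (n : nat) (V : vectType C).

Local Notation q_ i := (qsub q i).
Local Notation qdiff i := (q_ i - (q_ i)^-1).

(* The action on V of the generators: Xop b i r is x^{b}_{i,r}, Kop b i is
   k_i^{b 1}, Hop i r is h_{i,r} (the value at r = 0 is never used) and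
   Cop b is C^{b 1/2}. *)
Record Uq_ops := UqOps {
  Xop : bool -> 'I_n -> int -> endo V;
  Kop : bool -> 'I_n -> endo V;
  Hop : 'I_n -> int -> endo V;
  Cop : bool -> endo V }.

(* Coefficient of z^r in (\sum_(s >= 1) a_s z^s)^k. *)
Fixpoint ser_pow (a : nat -> endo V) (k r : nat) : endo V :=
  if k is k'.+1 then \sum_(1 <= s < r.+1) a s * ser_pow a k' (r - s)
  else (r == 0)%:R.

(* Coefficient of z^r in exp (\sum_(s >= 1) a_s z^s); the powers k > r
   do not contribute. *)
Definition exp_coef (a : nat -> endo V) (r : nat) : endo V :=
  \sum_(k < r.+1) (k`!%:R : C)^-1 *: ser_pow a k r.

(* C^{m/2} *)
Definition Cpow (M : Uq_ops) (m : int) : endo V :=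
  Cop M (0 <= m) ^+ `|m|%N.

(* psi^{b}_{i,m} for every integer m *)
Definition psi (M : Uq_ops) (b : bool) (i : 'I_n) (m : int) : endo V :=
  if signed b m is Posz r then
    Kop M b i *
    exp_coef (fun s => ((-1) ^+ (~~ b) * qdiff i) *: Hop M i (signed b s%:Z)) r
  else 0.

Record Uq_rel (M : Uq_ops) : Prop := UqRel {
  rel_C : forall b, Cop M b * Cop M (~~ b) = 1;
  rel_CX : forall b b' i r, Cop M b * Xop M b' i r = Xop M b' i r * Cop M b;
  rel_CK : forall b b' i, Cop M b * Kop M b' i = Kop M b' i * Cop M b;
  rel_CH : forall b i r, r != 0 -> Cop M b * Hop M i r = Hop M i r * Cop M b;
  rel_K : forall b i, Kop M b i * Kop M (~~ b) i = 1;
  rel_KK : forall b b' i j, Kop M b i * Kop M b' j = Kop M b' j * Kop M b i;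
  rel_KH : forall b i j r, r != 0 ->
    Kop M b i * Hop M j r = Hop M j r * Kop M b i;
  rel_KX : forall b i j r,
    Kop M true i * Xop M b j r * Kop M false i =
    q_ i ^ signed b (cartan i j) *: Xop M b j r;
  rel_HH : forall i j r s, r != 0 -> s != 0 ->
    Hop M i r * Hop M j s - Hop M j s * Hop M i r =
    if r == - s then
      (r%:~R^-1 * qint (q_ i) (r * cartan i j) / qdiff j) *:
        (Cpow M (2 * r) - Cpow M (- (2 * r)))
    else 0;
  rel_HX : forall b i j r s, r != 0 ->
    Hop M i r * Xop M b j s - Xop M b j s * Hop M i r =
    ((-1) ^+ (~~ b) * (r%:~R^-1 * qint (q_ i) (r * cartan i j))) *:
      (Cpow M (- signed b `|r|) * Xop M b j (r + s));
  rel_XX : forall b i j r s,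
    let c := q_ i ^ signed b (cartan i j) in
    Xop M b i (r + 1) * Xop M b j s - c *: (Xop M b j s * Xop M b i (r + 1)) =
    c *: (Xop M b i r * Xop M b j (s + 1)) - Xop M b j (s + 1) * Xop M b i r;
  rel_XpXm : forall i j r s,
    Xop M true i r * Xop M false j s - Xop M false j s * Xop M true i r =
    if i == j then
      (qdiff i)^-1 *: (Cpow M (r - s) * psi M true i (r + s)
                       - Cpow M (- (r - s)) * psi M false i (r + s))
    else 0;
  rel_Serre : forall b i j, i != j ->
    let m := `|1 - cartan i j|%N in
    forall (r : 'I_m -> int) (s : int),
    \sum_(w : 'S_m) \sum_(k < m.+1)
      ((-1) ^+ k * qbinom (q_ i) m k) *:
        ((\prod_(t < m | (t < k)%N) Xop M b i (r (w t))) * Xop M b j s *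
         (\prod_(t < m | (k <= t)%N) Xop M b i (r (w t)))) = 0 }.

(* A module over the algebra presented by these generators and relations is
   a choice of operators satisfying the relations. *)
Record Uq_module := UqModule { Uq_act :> Uq_ops; Uq_actP : Uq_rel Uq_act }.

Definition type1 (M : Uq_module) : Prop :=
  (forall b, Cop M b = 1) /\
  (forall i, exists e : seq V, basis_of fullv e /\
     forall v, v \in e -> exists m : int, Kop M true i v = q_ i ^ m *: v).

Definition submodule (M : Uq_module) (U : {vspace V}) : Prop :=
  forall v, v \in U ->
  [/\ forall b i r, Xop M b i r v \in U,
      forall b i, Kop M b i v \in U,
      forall i r, r != 0 -> Hop M i r v \in U
    & forall b, Cop M b v \in U].

Definition simple_module (M : Uq_module) : Prop :=
  (fullv : {vspace V}) <> 0%VS /\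
  forall U : {vspace V}, submodule M U -> U = 0%VS \/ U = fullv.

(* Phi i b r is phi^{b}_{i, b r}. *)
Definition lweight := 'I_n -> bool -> nat -> C.
HB.instance Definition _ := Choice.on lweight.

Definition in_lspace (M : Uq_module) (Phi : lweight) (v : V) : Prop :=
  forall i b r, exists N : nat,
    iter N (fun w => psi M b i (signed b r%:Z) w - Phi i b r *: w) v = 0.

Definition rootpoly (A : seq C) : {poly C} := \prod_(a <- A) (1 - a *: 'X).

(* \sum_(r >= 0) f_r z^r is the expansion of num / den at z = 0. *)
Definition expands_at0 (num den : {poly C}) (f : nat -> C) : Prop :=
  forall t : nat, \sum_(s < t.+1) den`_s * f (t - s)%N = num`_t.

(* \sum_(r >= 0) f_r z^(-r) is the expansion of num / den at z = oo:
   coefficient of z^t in the product with den, for every integer t. *)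
Definition expands_atoo (num den : {poly C}) (f : nat -> C) : Prop :=
  forall t : int,
  \sum_(s < size den | t <= s%:Z) den`_s * f `|s%:Z - t|%N =
  if t is Posz t' then num`_t' else 0.

(* m is the monomial m_Phi; A i and B i list the a in C^* with multiplicities
   r_{i,a} and s_{i,a}. *)
Definition is_lmon (Phi : lweight) (m : lmon C n) : Prop :=
  exists A B : 'I_n -> seq C,
  [/\ forall i a, a \in A i ++ B i -> a != 0,
      forall i,
        let Q := rootpoly (A i) in let R := rootpoly (B i) in
        let c := q_ i ^ ((size Q).-1%:Z - (size R).-1%:Z) in
        let num := c *: ((Q \Po ((q_ i)^-1 *: 'X)) * (R \Po (q_ i *: 'X))) in
        let den := (Q \Po (q_ i *: 'X)) * (R \Po ((q_ i)^-1 *: 'X)) in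
        expands_at0 num den (Phi i true) /\ expands_atoo num den (Phi i false)
    & m = \sum_i (\sum_(a <- A i) Yvar i a - \sum_(a <- B i) Yvar i a)].

Definition lweight_mon (Phi : lweight) : lmon C n :=
  xget 0 [set m | is_lmon Phi m].

(* The subspace of vectors satisfying P, when they form a subspace. *)
Definition vspace_of (P : V -> Prop) : {vspace V} :=
  xget 0%VS [set U : {vspace V} | forall v, v \in U <-> P v].

Lemma vspace_ofP (P : V -> Prop) :
  P 0 -> (forall a u v, P u -> P v -> P (a *: u + v)) ->
  forall v, v \in vspace_of P <-> P v.
Proof.
move=> P0 PL; apply: (@xgetPex _ 0%VS
  [set U : {vspace V} | forall v, v \in U <-> P v]).
pose S (U : {vspace V}) := forall v, v \in U -> P v.
pose D d := `[< exists U : {vspace V}, S U /\ \dim U = d >].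
have exD : exists d, D d.
  exists 0%N; apply/asboolP; exists 0%VS; split; last exact: dimv0.
  by move=> v; rewrite memv0 => /eqP ->.
have leD d : D d -> (d <= \dim (fullv : {vspace V}))%N.
  by move=> /asboolP[U [_ <-]]; exact: dimvS (subvf U).
case: (ex_maxnP exD leD) => d /asboolP[U [SU dimU]] maxd.
exists U => v; split; first exact: SU.
move=> Pv; have SUv : S (<[v]> + U)%VS.
  move=> w /memv_addP[x /vlineP[a ->] [y yU ->]].
  by apply: PL => //; exact: SU.
have /maxd : D (\dim (<[v]> + U)%VS).
  by apply/asboolP; exists (<[v]> + U)%VS.
rewrite -dimU => le_dim.
have /eqP -> : U == (<[v]> + U)%VS.
  by rewrite eqEdim addvSr.
exact: (subvP (addvSl <[v]>%VS U)) (memv_line v).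
Qed.

Lemma in_lspace_linear (M : Uq_module) (Phi : lweight) :
  in_lspace M Phi 0 /\
  forall a u v, in_lspace M Phi u -> in_lspace M Phi v ->
    in_lspace M Phi (a *: u + v).
Proof.
pose g i b r w := psi M b i (signed b r%:Z) w - Phi i b r *: w.
have gL i b r : linear (g i b r).
  move=> a u v; rewrite /g linearP scalerBr scalerDr !scalerA opprD.
  by rewrite mulrC addrACA.
have itL i b r N a u v : iter N (g i b r) (a *: u + v) =
    a *: iter N (g i b r) u + iter N (g i b r) v.
  by elim: N => //= N ->; rewrite gL.
have it0 i b r N : iter N (g i b r) 0 = 0.
  by elim: N => //= N ->; rewrite /g linear0 scaler0 subrr.
split=> [i b r|a u v Pu Pv i b r]; first by exists 0%N.
have [N1 e1] := Pu i b r; have [N2 e2] := Pv i b r.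
exists (N1 + N2)%N; rewrite itL.
have -> : iter (N1 + N2) (g i b r) v = 0 by rewrite iterD [X in iter _ _ X]e2 it0.
by rewrite addr0 addnC iterD [X in iter _ _ X]e1 it0 scaler0.
Qed.

(* V_Phi *)
Definition lspace (M : Uq_module) (Phi : lweight) : {vspace V} :=
  vspace_of (in_lspace M Phi).

Lemma mem_lspace (M : Uq_module) (Phi : lweight) (v : V) :
  v \in lspace M Phi <-> in_lspace M Phi v.
Proof. by have [P0 PL] := in_lspace_linear M Phi; exact: vspace_ofP. Qed.

Definition qchar (M : Uq_module) : laurent C n :=
  \sum_(Phi \in [set: lweight])
    << (\dim (lspace M Phi))%:Z *g lweight_mon Phi >>.

(* M is (isomorphic to) the simple module L(m). *)
Definition is_L (M : Uq_module) (m : lmon C n) : Prop :=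
  [/\ type1 M, simple_module M &
  exists (Phi : lweight) (v : V),
  [/\ is_lmon Phi m /\ v != 0,
      forall i r, Xop M true i r v = 0,
      forall i b r, psi M b i (signed b r%:Z) v = Phi i b r *: v
    & forall U : {vspace V}, submodule M U -> v \in U -> U = fullv]].

End QuantumAffine.

Arguments qchar {C q n V} M.
Arguments is_L {C q n V} M m.

(* Main.v *)
(* The simple module is realised on the paths. An elementary move changes one
   corner of an admissible path p, y_r -> y_r + 2 at an upper corner r, with the
   result admissible again; it multiplies the monomial of p by the inverse of
   the affine root variable A_{bar r, a} where a is the pole at r. Operators
   Dn j m and Up j m sum over these moves the values of a function on paths, with
   weight a^m times an explicit coefficient. Squares of moves at different
   nodes or positions commute with their coefficients, and partial fractions for
   psi_j(z) handle the round trips, so that [Up, Dn] reproduces the relation for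
   [x^+, x^-].

   In a simple module with highest l-weight Y_{i,k}, vectors phi p are built by
   induction on the depth of p below the top path: the two moves available at
   one node have different poles, so x^-_{j,1} - t x^-_{j,0} isolates one of
   them. That x^-_{j,m} acts on phi p by Dn follows because the difference is
   killed by all x^+ and has weight below the highest one, hence generates a
   proper submodule. The span of the phi p is then a submodule, and they are
   independent since suitable products of x^+ bring any one of them back to the
   highest weight vector while killing the others of no greater depth. So they
   form a basis of Cartan eigenvectors with l-weights given by the path
   monomials. *)

Require Import Defs.
From HB Require Import structures.
From mathcomp Require Import all_boot all_order all_fingroup all_algebra.
From mathcomp Require Import all_classical reals.
From mathcomp Require Import complex.
From mathcomp Require Import finmap.
From mathcomp.multinomials Require Import monalg.
From mathcomp Require Import zify ring.

Set Implicit Arguments.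
Unset Strict Implicit.
Unset Printing Implicit Defensive.

Import Order.TTheory GRing.Theory Num.Theory.

Local Open Scope classical_set_scope.
Local Open Scope ring_scope.

(** * Scalar series and rational functions *)

(** Since [M] is given rather than constructed, the path model is compared with it through the
    commutator of x^+ and x^-. The obstacle is that a node j < n owns two positions, r and 2n - r:
    psi_j can have two poles, and the coefficient of a move at r depends on the corner at 2n - r.
    Admissibility makes this consistent. It keeps the two poles distinct, and at a corner whose move
    would leave the admissible set the mirror factor vanishes at the pole, so that the residue there
    is 0. This residue must be the product of the coefficients of a move and of its inverse. It is
    given to the move down for r > n and to the move up for r < n, which leaves a genuine identity
    for squares only when the move down is at r > n and the move up at s < n. Weights are compared
    by a single product of powers of the k_i, with exponents taken from 2 rho so that every x^-
    lowers its eigenvalue exponent. *)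

Section ExponentialSeries.
Variable C : numFieldType.
Implicit Types (a c : nat -> C) (P Q : {poly C}) (F : int -> C).

(** Scalar form of the recursion in [ser_pow]: on a joint eigenvector the operator series acts
    through it. *)
Fixpoint spow a (k r : nat) : C :=
  if k is k'.+1 then \sum_(1 <= s < r.+1) a s * spow a k' (r - s)
  else (r == 0)%:R.

Definition expc a (r : nat) : C := \sum_(k < r.+1) (k`!%:R)^-1 * spow a k r.

(** Truncation at degree [N] makes the product and derivative rules of [{poly C}] available. *)
Lemma spow_coef a N k r : (r <= N)%N ->
  spow a k r = ((\poly_(s < N.+1) (if s == 0 then 0 else a s)) ^+ k)`_r.
Proof.
elim: k r => [|k IH] r leN; first by rewrite expr0 coef1.
rewrite exprS coefM /= big_ord_recl coef_poly /= mul0r add0r.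
rewrite big_add1 /= big_mkord; apply: eq_bigr => s _.
rewrite coef_poly /= IH; last by lia.
by rewrite /bump leq0n add1n ifT //; have := ltn_ord s; lia.
Qed.

Lemma spow_small a k r : (r < k)%N -> spow a k r = 0.
Proof.
elim: k r => // k IH r ltrk /=; rewrite big_nat_cond big1 // => s hs.
by rewrite IH ?mulr0 //; lia.
Qed.

(** Coefficient of z (A^(k+1))' = (k+1) (z A') A^k. *)
Lemma spow_deriv a k r :
  r%:R * spow a k.+1 r =
  k.+1%:R * \sum_(1 <= s < r.+1) s%:R * a s * spow a k (r - s).
Proof.
case: r => [|r]; first by rewrite mul0r big_geq ?mulr0.
set A := \poly_(s < r.+2) (if s == 0 then 0 else a s).
have -> : r.+1%:R * spow a k.+1 r.+1 = ((A ^+ k.+1)^`())`_r.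
  by rewrite coef_deriv -(spow_coef _ _ (leqnn r.+1)) mulr_natl.
rewrite deriv_exp /= coefMn -[LHS]mulr_natl coefM big_add1 /= big_mkord.
congr (_ * _); apply: eq_bigr => s _.
rewrite coef_deriv coef_poly /= ifT; last by have := ltn_ord s; lia.
by rewrite (@spow_coef a r.+1) ?mulr_natl //; lia.
Qed.

Lemma expc_widen a N r : (r <= N)%N ->
  expc a r = \sum_(k < N.+1) (k`!%:R)^-1 * spow a k r.
Proof.
move=> leN; rewrite /expc -!(big_mkord xpredT (fun k => (k`!%:R)^-1 * spow a k r)).
rewrite [RHS](big_cat_nat _ (n := r.+1)) //= [X in _ + X]big_nat_cond.
by rewrite [X in _ + X]big1 ?addr0 // => k hk; rewrite spow_small ?mulr0 //; lia.
Qed.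

Lemma expc0 a : expc a 0 = 1.
Proof. by rewrite /expc big_ord1 /= invr1 mulr1. Qed.

(** Logarithmic derivative: E = exp A satisfies z E' = (z A') E. With E(0) = 1 this determines E,
    and later identities of exponentials are checked on it. *)
Lemma expc_rec a r :
  r%:R * expc a r = \sum_(1 <= s < r.+1) s%:R * a s * expc a (r - s).
Proof.
rewrite /expc big_ord_recl /= mulrDr mulr_sumr.
have -> : r%:R * ((0`!%:R)^-1 * (r == 0)%:R) = 0 :> C.
  by case: r => [|r]; rewrite ?mul0r //= !mulr0.
rewrite add0r.
rewrite (eq_bigr (fun k : 'I_r => (k`!%:R)^-1 *
    \sum_(1 <= s < r.+1) s%:R * a s * spow a k (r - s))) => [|k _]; last first.
  rewrite /bump leq0n add1n mulrCA spow_deriv factS natrM invfM.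
  rewrite [k.+1%:R^-1 * _]mulrC -mulrA [X in _ * X]mulrA.
  by rewrite mulVf ?pnatr_eq0 // mul1r.
under eq_bigr => k _ do rewrite mulr_sumr.
rewrite exchange_big /=; apply: eq_big_nat => s hs.
case: r hs => [|r] hs; first by lia.
rewrite -/(expc a (r.+1 - s)) (@expc_widen a r); last by lia.
by rewrite mulr_sumr; apply: eq_bigr => k _; rewrite mulrCA.
Qed.

Lemma expc_uniq a f : f 0%N = 1 ->
  (forall r, r%:R * f r = \sum_(1 <= s < r.+1) s%:R * a s * f (r - s)%N) ->
  f =1 expc a.
Proof.
move=> f0 frec; elim/ltn_ind => -[|r] IH; first by rewrite f0 expc0.
have nz : r.+1%:R != 0 :> C by rewrite pnatr_eq0.
apply: (mulfI nz); rewrite frec expc_rec; apply: eq_big_nat => s hs.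
by rewrite IH //; lia.
Qed.

Lemma eq_expc a (b : nat -> C) r : (forall s, (0 < s)%N -> a s = b s) -> expc a r = expc b r.
Proof.
move=> eqab; have [f0 frec] := (expc0 a, expc_rec a).
apply: (expc_uniq f0) => t; rewrite frec; apply: eq_big_nat => s hs.
by rewrite eqab //; lia.
Qed.

Lemma expc_const0 r : expc (fun=> 0) r = (r == 0)%:R.
Proof.
symmetry; apply: (@expc_uniq (fun=> 0) (fun t => (t == 0)%:R)) => // t.
rewrite big1 => [|s _]; last by rewrite mulr0 mul0r.
by case: t => [|t]; rewrite ?mul0r ?mulr0.
Qed.

Lemma expc_inj a (b : nat -> C) : expc a =1 expc b -> forall s, (0 < s)%N -> a s = b s.
Proof.
move=> eqE; elim/ltn_ind => -[//|r] IH _.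
have := expc_rec a r.+1; rewrite eqE expc_rec big_nat_recr //=.
rewrite [X in _ = X -> _]big_nat_recr //= subnn !expc0 !mulr1.
have -> : \sum_(1 <= i < r.+1) i%:R * a i * expc a (r.+1 - i) =
          \sum_(1 <= i < r.+1) i%:R * b i * expc b (r.+1 - i).
  by apply: eq_big_nat => s hs; rewrite IH ?eqE //; lia.
by move=> /addrI /mulfI -> //; rewrite pnatr_eq0.
Qed.

(** Multiplying exp A by 1 - g z adds log (1 - g z) = - sum g^s z^s / s to the exponent. *)
Lemma expc_geom a g t :
  expc a t.+1 - g * expc a t = expc (fun s => a s - g ^+ s / s%:R) t.+1.
Proof.
pose f u := if u is u'.+1 then expc a u - g * expc a u' else 1.
rewrite -[LHS]/(f t.+1); apply: expc_uniq => // {t} -[|t].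
  by rewrite mul0r big_geq.
(* The terms that g^s / s produces in the recursion are differences of consecutive values of [T]. *)
pose e u := expc a u; pose T s := g ^+ s * e (t.+1 - s)%N.
have fE s : (1 <= s <= t.+1)%N -> (s <= t)%N ->
    f (t.+1 - s)%N = e (t.+1 - s)%N - g * e (t - s)%N.
  by move=> hs les; rewrite subSn.
rewrite big_nat_recr //= subnn /= mulr1.
have -> : \sum_(1 <= s < t.+1) s%:R * (a s - g ^+ s / s%:R) * f (t.+1 - s)%N =
    \sum_(1 <= s < t.+1) s%:R * a s * e (t.+1 - s)%N
    - g * (\sum_(1 <= s < t.+1) s%:R * a s * e (t - s)%N)
    + \sum_(1 <= s < t.+1) (T s.+1 - T s).
  rewrite mulr_sumr -sumrB -big_split /=; apply: eq_big_nat => s hs.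
  rewrite fE; [|lia|lia].
  have nz : s%:R != 0 :> C by rewrite pnatr_eq0; lia.
  rewrite /T subSS exprS; set es := e (t.+1 - s)%N; set es' := e (t - s)%N.
  by field.
rewrite telescope_sumr // /T subnn subSS subn0 expr1.
have := expc_rec a t.+1; rewrite big_nat_recr //= subnn expc0 mulr1 => rec1.
have := expc_rec a t => rec0.
rewrite -rec0 /e expc0.
have nz : t.+1%:R != 0 :> C by rewrite pnatr_eq0.
rewrite mulrBr rec1 mulrBr; set S := \sum_(_ <= _ < _) _.
rewrite [t.+1%:R * (g ^+ _ / _)]mulrCA divff // !mulr1 -[in LHS]natr1.
by ring.
Qed.

Definition ext (f : nat -> C) (t : int) : C := if t is Posz r then f r else 0.

(** For [b] false the series is in z^-1. Indexing both kinds by all integers gives common statements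
    for the expansions at 0 and at infinity. *)
Definition expZ (b : bool) a (t : int) : C := ext (expc a) (signed b t).

Lemma expZ_geomp a g t : expZ true a t - g * expZ true a (t - 1) =
  expZ true (fun s => a s - g ^+ s / s%:R) t.
Proof.
rewrite /expZ /=; case: t => [[|t]|t].
- by rewrite /= mulr0 subr0 !expc0.
- have -> : t.+1%:Z - 1 = t%:Z by lia.
  exact: expc_geom.
- have -> : Negz t - 1 = Negz t.+1 by lia.
  by rewrite /= mulr0 subr0.
Qed.

(** At infinity 1 - g z = - g z (1 - g^-1 z^-1), whence the factor [- g] and the shifted index. *)
Lemma expZ_geomm a g t : g != 0 -> expZ false a t - g * expZ false a (t - 1) =
  - g * expZ false (fun s => a s - g ^- s / s%:R) (t - 1).
Proof.
move=> g0; rewrite /expZ /= opprB.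
have [->|] := eqVneq t 1; first by rewrite /= !expc0 add0r mulNr.
case: (lerP t 0) => [le0 _|gt0 ne1].
  have [u ->] : exists u : nat, t = - u%:Z by exists `|t|%N; lia.
  rewrite opprK (_ : 1 + u%:Z = u.+1%:Z); last by lia.
  transitivity (- g * expc (fun s => a s - g^-1 ^+ s / s%:R) u.+1); last first.
    by congr (_ * _); apply: eq_expc => s _; rewrite exprVn.
  by rewrite /= -expc_geom mulrBr mulrA [- g / g]mulNr mulfV // mulN1r mulNr opprK addrC.
have [u ->] : exists u : nat, t = u.+2%:Z by exists (`|t|%N.-2); lia.
rewrite (_ : 1 - _ = Negz u); last by lia.
by rewrite (_ : - u.+2%:Z = Negz u.+1) /= ?mulr0 ?subrr //; lia.
Qed.

(** Coefficient of z^t in P(z) times the two-sided series with coefficients [F]. *)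
Definition act P F (t : int) : C := \sum_(s < size P) P`_s * F (t - s%:Z).

Lemma act_widen P F t N : (size P <= N)%N ->
  act P F t = \sum_(s < N) P`_s * F (t - s%:Z).
Proof.
move=> leN; rewrite /act -!(big_mkord xpredT (fun s : nat => P`_s * F (t - s%:Z))).
rewrite [RHS](big_cat_nat _ (n := size P)) //= [X in _ + X]big_nat_cond.
by rewrite [X in _ + X]big1 ?addr0 // => s hs; rewrite nth_default ?mul0r //; lia.
Qed.

Lemma act_linfactor P F (c d : C) t :
  act ((c%:P - d *: 'X) * P) F t = c * act P F t - d * act P F (t - 1).
Proof.
have sz : (size ((c%:P - d *: 'X) * P)%R <= (size P).+1)%N.
  apply: leq_trans (size_polyMleq _ _) _.
  have : (size (c%:P - d *: 'X)%R <= 2)%N.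
    apply: leq_trans (size_polyD _ _) _; rewrite size_polyN geq_max.
    rewrite (leq_trans (size_polyC_leq1 _)) //=.
    by rewrite (leq_trans (size_scale_leq _ _)) // size_polyX.
  by lia.
rewrite (act_widen _ _ sz) (@act_widen P _ t (size P).+1) // /act.
under eq_bigr => s _.
  rewrite mulrBl coefB coefCM -scalerAl coefZ coefXM mulrBl -mulrA; over.
rewrite sumrB -mulr_sumr; congr (_ - _).
rewrite big_ord_recl /= mulr0 mul0r add0r mulr_sumr.
apply: eq_bigr => s _; rewrite /= mulrA; congr (_ * F _).
by rewrite /bump /=; lia.
Qed.

Lemma act_lin P F G (c d : C) t :
  act P (fun u => c * F u + d * G u) t = c * act P F t + d * act P G t.
Proof.
rewrite /act !mulr_sumr -big_split /=; apply: eq_bigr => s _.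
by rewrite mulrDr !mulrA ![P`_s * _]mulrC.
Qed.

Lemma act_scale P F (c : C) t : act P (fun u => c * F u) t = c * act P F t.
Proof. by rewrite /act mulr_sumr; apply: eq_bigr => s _; rewrite mulrCA. Qed.

Lemma act_shift P F t : act P (fun u => F (u - 1)) t = act P F (t - 1).
Proof. by apply: eq_bigr => s _; congr (_ * F _); lia. Qed.

Lemma eq_act P F G t : F =1 G -> act P F t = act P G t.
Proof. by move=> eqFG; apply: eq_bigr => s _; rewrite eqFG. Qed.

Lemma act1 F t : act 1 F t = F t.
Proof. by rewrite /act size_poly1 big_ord1 coef1 mul1r subr0. Qed.

(* A pair (e, A) stands for the factor (e - e^-1 A z) / (1 - A z). *)
Definition pden (L : seq (C * C)) : {poly C} := \prod_(x <- L) (1 - x.2 *: 'X).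
Definition pnum (L : seq (C * C)) : {poly C} :=
  \prod_(x <- L) (x.1%:P - (x.1^-1 * x.2) *: 'X).
(** Logarithm of the product up to its constant term [plead]: a factor equals e (1 - A e^-2 z) / (1
    - A z), with constant term e at 0 and e^-1 at infinity. *)
Definition plog (b : bool) (L : seq (C * C)) (s : nat) : C :=
  \sum_(x <- L)
    ((x.2 ^ signed b s%:Z) - (x.2 / x.1 ^+ 2) ^ signed b s%:Z) / s%:R.
Definition plead (b : bool) (L : seq (C * C)) : C :=
  \prod_(x <- L) x.1 ^ signed b 1.

Lemma expZ_factor b c (e A : C) t : e != 0 -> A != 0 ->
  let c' s := c s + (A ^ signed b s%:Z - (A / e ^+ 2) ^ signed b s%:Z) / s%:R in
  e ^ signed b 1 * (expZ b c' t - A * expZ b c' (t - 1)) =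
  e * expZ b c t - e^-1 * A * expZ b c (t - 1).
Proof.
move=> e0 A0 /=; have B0 : A / e ^+ 2 != 0 by rewrite mulf_neq0 ?invr_eq0 ?expf_neq0.
transitivity (e * (expZ b c t - (A / e ^+ 2) * expZ b c (t - 1))); last first.
  by field.
case: b => /=.
  rewrite !expZ_geomp expr1z; congr (_ * _); congr (ext _ _).
  by apply: funext => r; apply: eq_expc => s _; rewrite -!exprnP; ring.
rewrite !expZ_geomm // exprN1.
have -> : forall X : C, e * (- (A / e ^+ 2) * X) = e^-1 * (- A * X).
  by move=> X; field.
congr (_ * (_ * ext _ _)); apply: funext => r; apply: eq_expc => s _.
by rewrite -!exprnN; ring.
Qed.

(** The arbitrary exponent [c] lets the induction absorb one factor at a time. *)
Lemma act_pden b c L t : (forall x, x \in L -> x.1 != 0 /\ x.2 != 0) ->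
  plead b L * act (pden L) (expZ b (fun s => c s + plog b L s)) t =
  act (pnum L) (expZ b c) t.
Proof.
elim: L c t => [|[e A] L IH] c t nz.
  rewrite /plead /pden /pnum !big_nil mul1r !act1; congr (ext _ _).
  by apply: funext => r; apply: eq_expc => s _; rewrite /plog big_nil addr0.
have [e0 A0] : e != 0 /\ A != 0 by apply: (nz (e, A)); rewrite inE eqxx.
have {}IH := IH _ _ (fun x xL => nz x (mem_behead (s := _ :: _) xL)).
rewrite /plead /pden /pnum !big_cons /=.
rewrite -[\prod_(x <- L) x.1 ^ _]/(plead b L) -[\prod_(j <- L) (1 - _)]/(pden L).
rewrite -[\prod_(j <- L) (_ - _)]/(pnum L).
set c' := fun s => c s + (A ^ signed b s%:Z - (A / e ^+ 2) ^ signed b s%:Z) / s%:R.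
have -> : (fun s => c s + plog b ((e, A) :: L) s) = (fun s => c' s + plog b L s).
  by apply: funext => s; rewrite /plog big_cons /= /c' addrA.
rewrite (_ : 1 - A *: 'X = 1%:P - A *: 'X) ?polyC1 //.
rewrite -[in LHS]polyC1 !act_linfactor mul1r.
rewrite -mulrA mulrBr mulrCA !IH.
transitivity (act (pnum L) (fun u => e ^ signed b 1 * expZ b c' u +
   (- (e ^ signed b 1 * A)) * expZ b c' (u - 1)) t).
  by rewrite act_lin act_shift; ring.
transitivity (act (pnum L) (fun u => e * expZ b c u +
   (- (e^-1 * A)) * expZ b c (u - 1)) t); last first.
  by rewrite act_lin act_shift; ring.
apply: eq_act => u; have := expZ_factor b c u e0 A0.
by rewrite /= -/c' mulrBr mulNr mulrA => ->; rewrite mulNr.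
Qed.

Lemma act_delta P b t : act P (expZ b (fun=> 0)) t = ext (fun r => P`_r) t.
Proof.
have D u : expZ b (fun=> 0) u = (u == 0)%:R.
  by rewrite /expZ; case: b; case: u => [[|u]|u] //=; rewrite expc_const0.
rewrite (eq_act _ _ D); case: t => r /=; last first.
  rewrite /act big1 // => s _.
  by rewrite (_ : _ == 0 = false) ?mulr0 //; apply/negP; lia.
rewrite (@act_widen _ _ _ (size P + r.+1)) ?leq_addr //.
have ltr : (r < size P + r.+1)%N by lia.
rewrite (bigD1 (Ordinal ltr)) //= subrr eqxx mulr1 big1 ?addr0 // => s ne.
rewrite (_ : _ == 0 = false) ?mulr0 //; apply/negP => /eqP h.
by case/negP: ne; apply/eqP/val_inj => /=; lia.
Qed.

Lemma act_pden0 b L t : (forall x, x \in L -> x.1 != 0 /\ x.2 != 0) ->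
  act (pden L) (fun u => plead b L * expZ b (plog b L) u) t =
  ext (fun r => (pnum L)`_r) t.
Proof.
move=> nz; rewrite act_scale -(act_delta _ b) -(act_pden b _ t nz).
by congr (_ * act _ (expZ _ _) _); apply: funext => s; rewrite add0r.
Qed.

End ExponentialSeries.

(** * Expansions at 0 and at infinity, and partial fractions *)

Section Expansions.
Variable C : numFieldType.
Implicit Types (P num den : {poly C}) (f : nat -> C) (L : seq (C * C)).

Lemma expands_at0P num den f : expands_at0 num den f <->
  forall t, act den (fun u => ext f (signed true u)) t = ext (fun r => num`_r) t.
Proof.
have E (t : nat) : act den (fun u => ext f u) t%:Z =
    \sum_(s < t.+1) den`_s * f (t - s)%N.
  rewrite (@act_widen _ _ _ _ (size den + t.+1)) ?leq_addr //.
  rewrite -(big_mkord xpredT (fun s : nat => den`_s * ext f (t%:Z - s%:Z))).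
  rewrite (big_cat_nat _ (n := t.+1)) ?leq_addl //= [X in _ + X]big_nat_cond.
  rewrite [X in _ + X]big1 ?addr0 => [|s hs].
    rewrite big_mkord; apply: eq_bigr => s _.
    by rewrite subzn //; have := ltn_ord s; lia.
  have [u ->] : exists u : nat, t%:Z - s%:Z = Negz u by exists (s - t.+1)%N; lia.
  by rewrite /= mulr0.
split=> [H [t|t]|H t]; rewrite /=; first by rewrite E H.
  rewrite /act big1 // => s _.
  have [u ->] : exists u : nat, Negz t - s%:Z = Negz u by exists (s + t)%N; lia.
  by rewrite /= mulr0.
by rewrite -E H.
Qed.

Lemma expands_atooP num den f : expands_atoo num den f <->
  forall t, act den (fun u => ext f (signed false u)) t = ext (fun r => num`_r) t.
Proof.
suff E t : act den (fun u => ext f (signed false u)) t =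
    \sum_(s < size den | t <= s%:Z) den`_s * f `|s%:Z - t|%N.
  by split=> H t; [rewrite E H|rewrite -E H].
rewrite big_mkcond; apply: eq_bigr => s _ /=; rewrite opprB.
case: lerP => h; last first.
  have [u ->] : exists u : nat, s%:Z - t = Negz u.
    move: (nat_of_ord s) h => k h; exists (absz (t - k%:Z - 1)%R); lia.
  by rewrite /= mulr0.
have [u eu] : exists u : nat, s%:Z - t = u%:Z by move: (nat_of_ord s) h => k h; exists (absz (k%:Z - t)%R); lia.
by rewrite eu.
Qed.

Definition expands (b : bool) : {poly C} -> {poly C} -> (nat -> C) -> Prop :=
  if b then @expands_at0 C else @expands_atoo C.

Lemma expandsP b num den f : expands b num den f <->
  forall t, act den (fun u => ext f (signed b u)) t = ext (fun r => num`_r) t.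
Proof. by case: b; [exact: expands_at0P|exact: expands_atooP]. Qed.

(** Boundedness on one side is what makes multiplication by [pden] injective: 1 - A z kills the
    two-sided series of all A^t. *)
Lemma act_pden_eq0 b L F (N : int) : (forall x, x \in L -> x.2 != 0) ->
  (forall t, signed b t < N -> F t = 0) ->
  (forall t, act (pden L) F t = 0) -> forall t, F t = 0.
Proof.
elim: L F N => [|[e A] L IH] F N nz bF H t.
  by have := H t; rewrite /pden big_nil act1.
have A0 : A != 0 by apply: (nz (e, A)); rewrite inE eqxx.
pose G u := F u - A * F (u - 1).
have {}H u : act (pden L) G u = 0.
  have := H u; rewrite /pden big_cons /= -[\prod_(j <- L) _]/(pden L).
  rewrite (_ : 1 - A *: 'X = 1%:P - A *: 'X) ?polyC1 // -[in LHS]polyC1.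
  rewrite act_linfactor mul1r => <-.
  transitivity (act (pden L) (fun v => 1 * F v + (- A) * F (v - 1)) u).
    by apply: eq_act => v; rewrite /G mul1r mulNr.
  by rewrite act_lin act_shift mul1r mulNr.
have G0 u : G u = 0.
  apply: (IH G (N - 1)) => // [x xL|v hv].
    by apply: nz; rewrite inE xL orbT.
  by rewrite /G !bF ?mulr0 ?subr0 //; case: b hv {bF IH} => /=; lia.
(* This recursion carries the vanishing away from the bounded side, upwards for [b] true and
   downwards for [b] false. *)
have FE u : F u = A * F (u - 1) by apply/eqP; rewrite -subr_eq0; apply/eqP/G0.
have FE' u : F u = A^-1 * F (u + 1) by rewrite [F (u + 1)]FE addrK mulKf.
suff Fk k u : signed b u < N + k%:Z -> F u = 0.
  by apply: (Fk (absz (signed b t - N + 1)%R)); lia.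
elim: k u => [|k IHk] u hu; first by apply: bF; rewrite addr0 in hu.
case: b {bF IH} IHk hu => IHk /= hu; [rewrite FE|rewrite FE'];
  by rewrite IHk ?mulr0 //=; lia.
Qed.

(* The coefficient of z^t in the expansion at 0 minus that at infinity. *)
Definition pjump (L : seq (C * C)) (t : int) : C :=
  plead true L * expZ true (plog true L) t -
  plead false L * expZ false (plog false L) t.

Lemma act_pjump L t : (forall x, x \in L -> x.1 != 0 /\ x.2 != 0) ->
  act (pden L) (pjump L) t = 0.
Proof.
move=> nz; transitivity (act (pden L) (fun u =>
    1 * (plead true L * expZ true (plog true L) u) +
    (-1) * (plead false L * expZ false (plog false L) u)) t).
  by apply: eq_act => u; rewrite mul1r mulN1r.
by rewrite act_lin !act_pden0 // mul1r mulN1r subrr.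
Qed.

Lemma geometric_int (A : C) F : A != 0 ->
  (forall t, F t = A * F (t - 1)) -> forall t : int, F t = A ^ t * F 0.
Proof.
move=> A0 FE; have FE' t : F t = A^-1 * F (t + 1).
  by rewrite [F (t + 1)]FE addrK mulKf.
case; elim=> [|t IH].
- by rewrite expr0z mul1r.
- rewrite FE (_ : t.+1%:Z - 1 = t%:Z) ?IH; last by lia.
  by rewrite mulrA -!exprnP exprS.
- by rewrite FE' (_ : Negz 0 + 1 = 0) // NegzE exprN1.
- rewrite FE' (_ : Negz t.+1 + 1 = Negz t) ?IH; last by lia.
  by rewrite mulrA !NegzE -!exprnN (exprS A t.+1) invfM.
Qed.

Lemma expc1 (a : nat -> C) : expc a 1 = a 1%N.
Proof. by have := expc_rec a 1; rewrite big_nat1 subnn expc0 mul1r mulr1 mul1r. Qed.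

Lemma pjump0 t : pjump [::] t = 0.
Proof. by have := @act_pjump [::] t; rewrite /pden big_nil act1; apply. Qed.

Lemma pjump1 (e A : C) t : e != 0 -> A != 0 ->
  pjump [:: (e, A)] t = (e - e^-1) * A ^ t.
Proof.
move=> e0 A0; rewrite mulrC [LHS](geometric_int A0) => [|u].
  by rewrite /pjump /expZ /= !expc0 /plead !big_seq1 /= expr1z exprN1 !mulr1.
have nz x : x \in [:: (e, A)] -> x.1 != 0 /\ x.2 != 0 by rewrite inE => /eqP ->.
have := act_pjump u nz; rewrite /pden big_seq1 /=.
rewrite -[1 - _]mulr1 -[in LHS]polyC1 act_linfactor !polyC1 !act1 mul1r.
by move/eqP; rewrite subr_eq0 => /eqP.
Qed.

(** Partial fractions for two simple poles. Both sides satisfy the linear recurrence with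
    characteristic roots A and B, so agreement at t = 0 and t = 1 suffices. *)
Lemma pjump2 (e A d B : C) t : e != 0 -> A != 0 -> d != 0 -> B != 0 -> A != B ->
  pjump [:: (e, A); (d, B)] t =
  (e - e^-1) * ((d * A - d^-1 * B) / (A - B)) * A ^ t +
  (d - d^-1) * ((e * B - e^-1 * A) / (B - A)) * B ^ t.
Proof.
move=> e0 A0 d0 B0 AB; have AB' : A - B != 0 by rewrite subr_eq0.
have BA' : B - A != 0 by rewrite subr_eq0 eq_sym.
set a := _ * (_ / (A - B)); set b := _ * (_ / (B - A)).
pose L := [:: (e, A); (d, B)].
pose H u := pjump L u - (a * A ^ u + b * B ^ u).
have nz x : x \in L -> x.1 != 0 /\ x.2 != 0.
  by rewrite !inE => /orP[] /eqP ->.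
pose G u := H u - A * H (u - 1).
have expS' (x : C) u : x != 0 -> x ^ u = x * x ^ (u - 1).
  by move=> x0; rewrite -[in LHS](subrK 1 u) expfzDr // expr1z mulrC.
have HJ u : pjump L u - A * pjump L (u - 1) =
    B * (pjump L (u - 1) - A * pjump L (u - 1 - 1)).
  have := act_pjump u nz; rewrite /pden big_cons big_seq1 /=.
  rewrite mulrC -[1 - A *: 'X]mulr1 -[in LHS]polyC1 !act_linfactor !polyC1 !act1.
  by rewrite !mul1r => /eqP; rewrite subr_eq0 => /eqP.
have GE u : G u = B * G (u - 1).
  rewrite /G /H; have := HJ u; set j0 := pjump L u; set j1 := pjump L (u - 1).
  set j2 := pjump L _ => E.
  have -> : j0 = A * j1 + B * (j1 - A * j2) by rewrite -E addrC subrK.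
  rewrite (expS' A u) // (expS' A (u - 1)) // (expS' B u) // (expS' B (u - 1)) //.
  by ring.
have H0 : H 0 = 0.
  rewrite /H /pjump /expZ /= !expc0 /plead !big_cons !big_nil /= !expr1z !exprN1.
  rewrite !expr0z /a /b; field.
  by rewrite e0 d0 AB' BA'.
have G1 : G 1 = 0.
  rewrite /G subrr H0 mulr0 subr0 /H /pjump /expZ /= expc1.
  rewrite /plead /plog !big_cons !big_nil /= !expr1z !exprN1 /a /b.
  by field; rewrite e0 d0 AB' BA'.
have G0 u : G u = 0.
  rewrite (geometric_int B0 GE); have := GE 1; rewrite G1 subrr => /esym/eqP.
  by rewrite mulf_eq0 (negPf B0) => /eqP ->; rewrite mulr0.
have HE u : H u = A * H (u - 1) by apply/eqP; rewrite -subr_eq0; apply/eqP/G0.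
by apply/eqP; rewrite -subr_eq0; apply/eqP; rewrite -[LHS]/(H t) (geometric_int A0 HE) H0 mulr0.
Qed.

End Expansions.

(** * Loop weights and Laurent monomials *)

Section LMonomials.
Variables (C : numFieldType) (q : C) (n : nat).
Hypotheses (q0 : q != 0) (hq : forall m : nat, (0 < m)%N -> q ^+ m != 1).
Implicit Types (m : lmon C n) (i j : 'I_n) (A B : 'I_n -> seq C).

Lemma expq_eq1 s : (q ^ s == 1) = (s == 0).
Proof.
apply/idP/idP => [|/eqP ->]; last by rewrite expr0z.
case: s => [[|s]|s] //=; first by rewrite -exprnP; have := hq (ltn0Sn s) => /negPf ->.
by rewrite NegzE -exprnN -exprVn -[1](expr1n _ s.+1) exprVn expr1n invr_eq1;
  have := hq (ltn0Sn s) => /negPf ->.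
Qed.

Lemma expq_inj : injective (fun s : int => q ^ s).
Proof.
move=> s t /= e; apply/eqP; rewrite -subr_eq0 -expq_eq1 expfzDr // e.
by rewrite -expfzDr // subrr expr0z.
Qed.

Lemma qsubE i s : qsub q i ^ s = q ^ ((symd i)%:Z * s).
Proof. by rewrite /qsub exprnP -exprz_exp. Qed.

Lemma symd_gt0 i : (0 < symd i)%N.
Proof. by rewrite /symd; case: ifP. Qed.

Lemma qsub_neq0 i : qsub q i != 0.
Proof. exact: expf_neq0. Qed.

Lemma qsub_subV_neq0 i s : s != 0 -> qsub q i ^ s - qsub q i ^ (- s) != 0.
Proof.
move=> s0; rewrite subr_eq0 !qsubE; apply/eqP => /expq_inj.
by have := symd_gt0 i; nia.
Qed.

Lemma qdiff_neq0 i : qsub q i - (qsub q i)^-1 != 0.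
Proof. by have := @qsub_subV_neq0 i 1 isT; rewrite expr1z exprN1. Qed.

Definition lmap (S : nzRingType) (h : 'I_n * C -> S) m : S := mmap intr h m.

Lemma lmapB (S : nzRingType) (h : 'I_n * C -> S) m1 m2 :
  lmap h (m1 - m2) = lmap h m1 - lmap h m2.
Proof. exact: (mmap_is_additive (f := intr) (h := h)). Qed.

Lemma lmap0 (S : nzRingType) (h : 'I_n * C -> S) : lmap h 0 = 0.
Proof. by rewrite -(subrr 0) lmapB subrr. Qed.

Lemma lmapD (S : nzRingType) (h : 'I_n * C -> S) m1 m2 :
  lmap h (m1 + m2) = lmap h m1 + lmap h m2.
Proof. by rewrite -[in LHS](opprK m2) lmapB -(sub0r m2) lmapB lmap0 sub0r opprK. Qed.

Lemma lmap_sum (S : nzRingType) (h : 'I_n * C -> S) (I : Type) (r : seq I)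
    (P : pred I) (F : I -> lmon C n) :
  lmap h (\sum_(x <- r | P x) F x) = \sum_(x <- r | P x) lmap h (F x).
Proof. exact: (big_morph _ (lmapD h) (lmap0 h)). Qed.

Lemma lmapY (S : nzRingType) (h : 'I_n * C -> S) i a : lmap h (Yvar i a) = h (i, a).
Proof. by rewrite /lmap /Yvar (mmapU (f := intr)) /= mul1r. Qed.

(** Power sum of the spectral parameters at node i, weighted by exponents; [lheig] is the resulting
    eigenvalue of h_{i,s}. *)
Definition lpow i s m : C := lmap (fun x => (x.1 == i)%:R * x.2 ^ s) m.
Definition ldeg i m : int := lmap (fun x => (x.1 == i)%:R : int) m.
Definition lheig i s m : C := s%:~R^-1 * qint (qsub q i) s * lpow i s m.

Definition lser m i (b : bool) (s : nat) : C :=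
  (-1) ^+ (~~ b) * (qsub q i - (qsub q i)^-1) * lheig i (signed b s%:Z) m.

(** Built from the eigenvalues of k_i and h_{i,s}, which the relations of the module control;
    [is_lmonP] reconciles this with the rational functions. *)
Definition lweight_of m : lweight C n := fun i b r =>
  qsub q i ^ signed b (ldeg i m) * expc (lser m i b) r.

Lemma lserE m i b s : (0 < s)%N -> let t := signed b s%:Z in
  lser m i b s =
  (qsub q i ^ t - qsub q i ^ (- t)) / s%:R * lpow i t m.
Proof.
move=> s0 /=; rewrite /lser /lheig /qint.
have nz : s%:R != 0 :> C by rewrite pnatr_eq0; lia.
set x := qsub q i; set d := x - x^-1.
have d0 : d != 0 := qdiff_neq0 i.
set y := _ - _; set z := lpow _ _ _.
case: b y z => y z /=; rewrite ?mulrNz ?pmulrn; field; by rewrite ?nz ?d0.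
Qed.

Definition lmon_of A B : lmon C n :=
  \sum_i (\sum_(a <- A i) Yvar i a - \sum_(a <- B i) Yvar i a).

Lemma lmap_lmon_of (S : nzRingType) (h : 'I_n * C -> S) A B :
  lmap h (lmon_of A B) =
  \sum_i (\sum_(a <- A i) h (i, a) - \sum_(a <- B i) h (i, a)).
Proof.
rewrite lmap_sum; apply: eq_bigr => i _; rewrite lmapB !lmap_sum.
by congr (_ - _); apply: eq_bigr => a _; rewrite lmapY.
Qed.

Lemma sum_pickord (S : zmodType) i (F : 'I_n -> S) :
  (forall j, j != i -> F j = 0) -> \sum_j F j = F i.
Proof. by move=> F0; rewrite (bigD1 i) //= big1 ?addr0. Qed.

Lemma lpow_lmon_of i s A B : lpow i s (lmon_of A B) =
  \sum_(a <- A i) a ^ s - \sum_(a <- B i) a ^ s.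
Proof.
rewrite /lpow lmap_lmon_of (@sum_pickord _ i) /= => [|j ne].
  by congr (_ - _); apply: eq_bigr => a _; rewrite eqxx mul1r.
by rewrite !big1 ?subrr // => a _; rewrite (negPf ne) mul0r.
Qed.

Lemma ldeg_lmon_of i A B :
  ldeg i (lmon_of A B) = (size (A i))%:Z - (size (B i))%:Z.
Proof.
rewrite /ldeg lmap_lmon_of (@sum_pickord _ i) /= => [|j ne].
  by rewrite eqxx !big_const_seq !count_predT !iter_addr_0 !natz.
by rewrite !big1 ?subrr // => a _; rewrite (negPf ne).
Qed.

(** Y_{i,a} contributes q_i (1 - a q_i^-1 z) / (1 - a q_i z) to psi_i; Y_{i,b}^-1 contributes the
    same expression with b for a and q_i inverted. *)
Definition lfactors i (As Bs : seq C) : seq (C * C) :=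
  [seq (qsub q i, a * qsub q i) | a <- As] ++
  [seq ((qsub q i)^-1, b / qsub q i) | b <- Bs].

Lemma lfactors_neq0 i As Bs : (forall a, a \in As ++ Bs -> a != 0) ->
  forall x, x \in lfactors i As Bs -> x.1 != 0 /\ x.2 != 0.
Proof.
move=> nz x; rewrite mem_cat => /orP[] /mapP[a aA ->] /=.
  by rewrite mulf_neq0 ?qsub_neq0 ?nz // mem_cat aA.
by rewrite mulf_neq0 ?invr_eq0 ?qsub_neq0 ?nz // mem_cat aA orbT.
Qed.

Lemma plead_lfactors b i As Bs : plead b (lfactors i As Bs) =
  qsub q i ^ signed b ((size As)%:Z - (size Bs)%:Z).
Proof.
rewrite /plead big_cat !big_map /= !big_const_seq !count_predT.
have it (x : C) k : iter k ( *%R x) 1 = x ^+ k.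
  by elim: k => //= k ->; rewrite exprS.
rewrite !it; have x0 := qsub_neq0 i; case: b => /=.
  by rewrite !expr1z exprVn expfzDr // -exprnP -exprnN.
by rewrite !exprN1 !exprVn invrK opprB expfzDr // -exprnP -exprnN mulrC.
Qed.

Lemma plog_lfactors b i A B s : (0 < s)%N ->
  plog b (lfactors i (A i) (B i)) s = lser (lmon_of A B) i b s.
Proof.
move=> s0; rewrite lserE // lpow_lmon_of /plog big_cat !big_map /=.
set t := signed b s%:Z; have x0 := qsub_neq0 i; set x := qsub q i.
have ex a : a * x / x ^+ 2 = a / x by rewrite /x; field.
have ex' a : a / x / x^-1 ^+ 2 = a * x by rewrite /x; field; rewrite x0.
rewrite mulrBr !mulr_sumr -sumrN; congr (_ + _); apply: eq_bigr => a _.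
  by rewrite ex !expfzMl exprz_inv; ring.
by rewrite ex' !expfzMl exprz_inv; ring.
Qed.

Lemma rootpoly_comp (As : seq C) c :
  rootpoly As \Po (c *: 'X) = \prod_(a <- As) (1 - (a * c) *: 'X).
Proof.
rewrite /rootpoly rmorph_prod; apply: eq_bigr => a _.
by rewrite /= comp_polyB comp_polyZ comp_polyX scalerA rmorph1.
Qed.

Lemma size_rootpoly (As : seq C) : (forall a, a \in As -> a != 0) ->
  size (rootpoly As) = (size As).+1.
Proof.
elim: As => [|a As IH] nz; first by rewrite /rootpoly big_nil size_poly1.
have a0 : a != 0 by apply: nz; rewrite inE eqxx.
rewrite /rootpoly big_cons -[\prod_(_ <- _) _]/(rootpoly As).
have s2 : size (1 - a *: 'X : {poly C}) = 2.
  by rewrite addrC size_polyDl size_polyN size_scale ?size_polyX // size_poly1.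
have IH' := IH (fun x xA => nz x (mem_behead (s := _ :: _) xA)).
rewrite size_mul -?size_poly_eq0 ?s2 ?IH' //.
Qed.

Lemma pden_lfactors i As Bs : pden (lfactors i As Bs) =
  (rootpoly As \Po (qsub q i *: 'X)) * (rootpoly Bs \Po ((qsub q i)^-1 *: 'X)).
Proof. by rewrite /pden big_cat !big_map !rootpoly_comp. Qed.

Lemma pnum_lfactors i As Bs : pnum (lfactors i As Bs) =
  qsub q i ^ ((size As)%:Z - (size Bs)%:Z) *:
  ((rootpoly As \Po ((qsub q i)^-1 *: 'X)) * (rootpoly Bs \Po (qsub q i *: 'X))).
Proof.
rewrite -(plead_lfactors true) /plead /pnum !big_cat !big_map !rootpoly_comp /=.
have sc (I : Type) (r : seq I) (F : I -> C) (G : I -> {poly C}) :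
    \prod_(x <- r) (F x *: G x) = (\prod_(x <- r) F x) *: \prod_(x <- r) G x.
  elim/big_rec3: _ => [|x u p v _ ->]; first by rewrite scale1r.
  by rewrite -scalerAl -scalerAr scalerA.
have x0 := qsub_neq0 i.
rewrite -[RHS]scalerA scalerAr scalerAl -!sc; congr (_ * _); apply: eq_bigr => a _.
  rewrite expr1z scalerBr scalerA -alg_polyC; congr (_ - _ *: _).
  by field.
rewrite expr1z scalerBr scalerA -alg_polyC invrK; congr (_ - _ *: _).
by field.
Qed.

Lemma lweight_of_expands b i A B : (forall a, a \in A i ++ B i -> a != 0) ->
  expands b (pnum (lfactors i (A i) (B i))) (pden (lfactors i (A i) (B i)))
    (lweight_of (lmon_of A B) i b).
Proof.
move=> nz; apply/expandsP => t.
rewrite -(act_pden0 b _ (lfactors_neq0 nz)); apply: eq_act => u.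
rewrite plead_lfactors -ldeg_lmon_of /expZ /lweight_of.
case: (signed b u) => r /=; last by rewrite mulr0.
by congr (_ * _); apply: eq_expc => s s0; rewrite plog_lfactors.
Qed.

Lemma expands_uniq b (L : seq (C * C)) f g : (forall x, x \in L -> x.2 != 0) ->
  expands b (pnum L) (pden L) f -> expands b (pnum L) (pden L) g -> f =1 g.
Proof.
move=> nz /expandsP Hf /expandsP Hg r.
pose F u := ext f (signed b u) - ext g (signed b u).
have F0 : forall t, F t = 0.
  apply: (@act_pden_eq0 _ b L F 0 nz) => [t|t].
    by rewrite /F; case: (signed b t) => // k _; rewrite subrr.
  transitivity (act (pden L) (fun u => 1 * ext f (signed b u) +
      (-1) * ext g (signed b u)) t).
    by apply: eq_act => u; rewrite /F mul1r mulN1r.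
  by rewrite act_lin Hf Hg mul1r mulN1r subrr.
apply/eqP; rewrite -subr_eq0; apply/eqP.
by have := F0 (signed b r%:Z); rewrite /F; case: b {Hf Hg F F0}; rewrite /= ?opprK.
Qed.

Lemma is_lmonP (Phi : lweight C n) m : is_lmon q Phi m <->
  Phi = lweight_of m /\
  exists A B, (forall i a, a \in A i ++ B i -> a != 0) /\ m = lmon_of A B.
Proof.
have S A B i : (forall a, a \in A i ++ B i -> a != 0) ->
    (size (rootpoly (A i))).-1%:Z - (size (rootpoly (B i))).-1%:Z =
    (size (A i))%:Z - (size (B i))%:Z.
  by move=> nz; rewrite !size_rootpoly // => a aA; apply: nz;
    rewrite mem_cat aA ?orbT.
split=> [[A [B [nz H mE]]]|[-> [A [B [nz ->]]]]].
  split; last by exists A, B.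
  apply: funext => i; apply: funext => b; apply: funext => r.
  have := H i; cbv zeta; rewrite (S A B i (nz i)).
  rewrite -pnum_lfactors -pden_lfactors => -[H1 H2].
  have nz' x : x \in lfactors i (A i) (B i) -> x.2 != 0.
    by move=> /(lfactors_neq0 (nz i))[].
  rewrite mE; apply: (expands_uniq (b := b) nz'); first by case: b.
  exact/lweight_of_expands/nz.
exists A, B; split=> // i; cbv zeta; rewrite (S A B i (nz i)).
rewrite -pnum_lfactors -pden_lfactors.
by split; [apply: (@lweight_of_expands true)|apply: (@lweight_of_expands false)]; exact: nz.
Qed.

(** Equal l-weights have equal power sums of every positive order. These separate nonzero parameters
    but miss a = 0, hence the two support hypotheses. *)
Lemma lweight_of_inj m m' :
  (forall x : 'I_n * C, x.2 = 0 -> m@_x = 0) ->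
  (forall x : 'I_n * C, x.2 = 0 -> m'@_x = 0) ->
  lweight_of m = lweight_of m' -> m = m'.
Proof.
move=> nz nz' E; have pE i s : (0 < s)%N -> lpow i s%:Z m = lpow i s%:Z m'.
  move=> s0; have K (b : bool) r : lweight_of m i b r = lweight_of m' i b r by rewrite E.
  have K0 := K true 0%N; rewrite /lweight_of !expc0 !mulr1 in K0.
  have eqe : expc (lser m i true) =1 expc (lser m' i true).
    move=> r; have := K true r; rewrite /lweight_of K0 => /mulfI -> //.
    by rewrite expfz_neq0 // qsub_neq0.
  have := expc_inj eqe s0; rewrite !lserE //= => /mulfI -> //.
  rewrite mulf_neq0 ?invr_eq0 ?pnatr_eq0 -?lt0n //.
  by apply: qsub_subV_neq0; lia.
apply/eqP; rewrite -subr_eq0; apply/eqP; set d := m - m'.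
have dnz (x : 'I_n * C) : x.2 = 0 -> d@_x = 0.
  by move=> x0; rewrite [LHS]mcoeffB nz ?nz' ?subrr.
have dp i s : (0 < s)%N -> lpow i s%:Z d = 0.
  by move=> s0; rewrite /lpow lmapB -!/(lpow _ _ _) pE // subrr.
have dP i (P : {poly C}) :
    \sum_(x <- msupp d) (d@_x)%:~R * ((x.1 == i)%:R * (x.2 * P.[x.2])) = 0 :> C.
  rewrite (eq_bigr (fun x => \sum_(k < size P) P`_k *
      ((d@_x)%:~R * ((x.1 == i)%:R * x.2 ^ k.+1%:Z)))) => [|x _]; last first.
    rewrite horner_coef !mulr_sumr; apply: eq_bigr => k _.
    by rewrite -exprnP exprS; ring.
  rewrite exchange_big big1 //= => k _; rewrite -mulr_sumr.
  by have := dp i k.+1 isT; rewrite /lpow /lmap /mmap => ->; rewrite mulr0.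
apply/malgP => -[i a]; rewrite mcoeff0; apply/eqP/negPn/negP => ne.
have a0 : a != 0 by apply: contraNneq ne => a0; rewrite dnz.
(* Interpolation: P vanishes at every other parameter of the support, so a P(a) isolates the
   coefficient at [(i, a)]. *)
pose P : {poly C} := \prod_(x <- msupp d | x.2 != a) ('X - x.2%:P).
have := dP i P; rewrite (big_fsetD1 (i, a)) -?mcoeff_neq0 //= eqxx mul1r.
rewrite big1_fset ?addr0 => [/eqP|[j b] /=]; last first.
  rewrite in_fsetD1 => /andP[ne' bd _]; case: (eqVneq j i) => [ji|]; last by rewrite mul0r mulr0.
  rewrite ji in ne' bd *.
  have nab : b != a by apply: contraNneq ne' => ->.
  rewrite (_ : P.[b] = 0) ?mulr0 //; apply/eqP.
  rewrite /P horner_prod prodf_seq_eq0; apply/hasP; exists (i, b); rewrite //=.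
  by rewrite nab hornerXsubC subrr eqxx.
rewrite !mulf_eq0 intr_eq0 (negPf ne) (negPf a0) /= /P horner_prod prodf_seq_eq0.
by move=> /hasP[x _ /andP[nxa]]; rewrite hornerXsubC subr_eq0 eq_sym (negPf nxa).
Qed.

(** [lweight_mon] chooses by [xget]; the choice is unique by [lweight_of_inj]. *)
Lemma lweight_monK A B : (forall i a, a \in A i ++ B i -> a != 0) ->
  lweight_mon q (lweight_of (lmon_of A B)) = lmon_of A B.
Proof.
move=> nz; rewrite /lweight_mon.
have z A' B' : (forall i a, a \in A' i ++ B' i -> a != 0) ->
    forall x : 'I_n * C, x.2 = 0 -> (lmon_of A' B')@_x = 0.
  move=> nz' [i a] /= a0; rewrite [LHS]raddf_sum big1 // => j _.
  rewrite [LHS]mcoeffB ![(\sum_(_ <- _) _)@__]raddf_sum !big1_seq ?subrr // => b /= bA;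
    rewrite [LHS]mcoeffU; have b0 : b != 0 by apply: (nz' j); rewrite mem_cat bA ?orbT.
    by rewrite xpair_eqE a0 (negPf b0) andbF.
  by rewrite xpair_eqE a0 (negPf b0) andbF.
apply: xget_unique => [|m' /is_lmonP[E [A' [B' [nz' mE]]]]].
  by apply/is_lmonP; split=> //; exists A, B.
by apply/esym/lweight_of_inj => //; rewrite ?mE; exact: z.
Qed.

(** Coefficient of z^t in psi_i^+ - psi_i^-, the combination that occurs in [x^+, x^-]. *)
Definition lpsi m i (t : int) : C :=
  ext (lweight_of m i true) (signed true t) -
  ext (lweight_of m i false) (signed false t).

Lemma lpsiE A B i t : lpsi (lmon_of A B) i t = pjump (lfactors i (A i) (B i)) t.
Proof.
have E b : ext (lweight_of (lmon_of A B) i b) (signed b t) =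
    plead b (lfactors i (A i) (B i)) *
    expZ b (plog b (lfactors i (A i) (B i))) t.
  rewrite plead_lfactors -ldeg_lmon_of /expZ /lweight_of.
  case: (signed b t) => r /=; last by rewrite mulr0.
  by congr (_ * _); apply: eq_expc => s s0; rewrite plog_lfactors.
by rewrite /lpsi !E.
Qed.

End LMonomials.

(** * Elementary moves on admissible paths *)

Section PathMoves.
Variable n : nat.
Local Notation N := (2 * n)%N.
Implicit Types (p : pathT n) (r s : nat).

Definition pshift p r (d : int) : pathT n :=
  [tuple of mkseq (fun s => p`_s + d * (s == r)%:Z) N.+1].

Lemma pshiftE p r d s : (r <= N)%N -> (pshift p r d)`_s = p`_s + d * (s == r)%:Z.
Proof.
move=> ler; case: (ltnP s N.+1) => hs; first by rewrite nth_mkseq.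
have e0 : p`_s = 0 by rewrite nth_default ?size_tuple.
rewrite e0 nth_default ?size_mkseq //.
by rewrite (_ : s == r = false) ?mulr0 //; apply/eqP; lia.
Qed.

Lemma path_eqP p p' : (forall s, p`_s = p'`_s) -> p = p'.
Proof.
by move=> E; apply/val_inj/(@eq_from_nth _ 0); rewrite ?size_tuple // => s _; exact: E.
Qed.

Lemma pshiftK p r d d' : (r <= N)%N -> d' = - d -> pshift (pshift p r d) r d' = p.
Proof. by move=> ler ->; apply: path_eqP => s; rewrite !pshiftE //; lia. Qed.

Lemma pshiftC p r d s d' : (r <= N)%N -> (s <= N)%N ->
  pshift (pshift p r d) s d' = pshift (pshift p s d') r d.
Proof. by move=> ler les; apply: path_eqP => t; rewrite !pshiftE //; ring. Qed.

Lemma upper_lt p r : upper_corner p r -> (0 < r < N)%N.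
Proof. by case/and3P. Qed.

Lemma lower_lt p r : lower_corner p r -> (0 < r < N)%N.
Proof. by case/and3P. Qed.

Lemma upper_lower p r : upper_corner p r -> lower_corner p r = false.
Proof.
by case/and3P=> _ /eqP e1 _; apply/negP; case/and3P=> _ /eqP e2 _; lia.
Qed.

(** At distance 2 or more, a move at one position leaves the corner at the other untouched. *)
Definition far r s := (r.+1 < s)%N || (s.+1 < r)%N.

Lemma farC r s : far r s = far s r. Proof. by rewrite /far orbC. Qed.

Lemma nth_far p r d s t : (r <= N)%N -> far r s -> (0 < s)%N ->
  (s.-1 <= t <= s.+1)%N -> (pshift p r d)`_t = p`_t.
Proof.
move=> ler fr s0 ht; rewrite pshiftE // (_ : t == r = false) ?mulr0 ?addr0 //.
by apply/eqP; move: fr; rewrite /far; lia.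
Qed.

Lemma upper_far p r d s : (r <= N)%N -> far r s ->
  upper_corner (pshift p r d) s = upper_corner p s.
Proof.
move=> ler fr; rewrite /upper_corner; have [->//|s0] := posnP s.
by rewrite !(nth_far _ _ ler fr s0) //; lia.
Qed.

Lemma lower_far p r d s : (r <= N)%N -> far r s ->
  lower_corner (pshift p r d) s = lower_corner p s.
Proof.
move=> ler fr; rewrite /lower_corner; have [->//|s0] := posnP s.
by rewrite !(nth_far _ _ ler fr s0) //; lia.
Qed.

(* At a corner r of p, q ^ pexp p r is the pole of the factor of psi(z) due to r. *)
Definition pexp p r : int := p`_r.-1 + (n <= r)%N%:Z + (n < r)%N%:Z.

Lemma pexp_shift p r d s : (r <= N)%N -> r != s.-1 -> pexp (pshift p r d) s = pexp p s.
Proof. by move=> ler ne; rewrite /pexp pshiftE //; lia. Qed.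

Lemma pexp_far p r d s : (r <= N)%N -> far r s -> pexp (pshift p r d) s = pexp p s.
Proof. by move=> ler fr; apply: pexp_shift => //; move: fr; rewrite /far; lia. Qed.

(** [vdn] is for raising [y_r], which lowers the weight; [vup] is for the inverse. Raising can break
    admissibility only left of n and lowering only right of n, so the inequality is imposed only
    there. *)
Definition vdn p r := upper_corner p r && ((n <= r)%N || (p`_r + 2 <= p`_(N - r))).
Definition vup p r := lower_corner p r && ((r <= n)%N || (p`_(N - r) <= p`_r - 2)).

Lemma vdn_le p r : vdn p r -> (r <= N)%N.
Proof. by case/andP=> /upper_lt; lia. Qed.

Lemma vup_le p r : vup p r -> (r <= N)%N.
Proof. by case/andP=> /lower_lt; lia. Qed.

Lemma near_far r s : r != s -> ~~ far r s -> s = r.+1 \/ r = s.+1.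
Proof. by rewrite /far; lia. Qed.

(** After the move [y_r] is a local maximum, so no neighbour of r is a lower corner. *)
Lemma square_far_dn p r s : r != s -> vdn p r -> vup (pshift p r 2) s -> far r s.
Proof.
move=> ne /andP[/and3P[hr /eqP e1 /eqP e2] _] /andP[/and3P[hs /eqP e3 /eqP e4] _].
have ler : (r <= N)%N by lia.
rewrite !pshiftE // in e3 e4; apply/negPn/negP => /(near_far ne)[es|es].
  by move: e3; rewrite es succnK; lia.
by move: e1 e4; rewrite es succnK; lia.
Qed.

Lemma square_far_up p r s : r != s -> vup p r -> vdn (pshift p r (-2)) s -> far r s.
Proof.
move=> ne /andP[/and3P[hr /eqP e1 /eqP e2] _] /andP[/and3P[hs /eqP e3 /eqP e4] _].
have ler : (r <= N)%N by lia.
rewrite !pshiftE // in e3 e4; apply/negPn/negP => /(near_far ne)[es|es].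
  by move: e3; rewrite es succnK; lia.
by move: e1 e4; rewrite es succnK; lia.
Qed.

(** Far moves interact only through admissibility at mirror positions; there, for r < n, both orders
    amount to y_r + 4 <= y_s. *)
Lemma square_valid p r s : r != s ->
  vdn p r && vup (pshift p r 2) s = vup p s && vdn (pshift p s (-2)) r.
Proof.
move=> ne; have ne' : s != r by rewrite eq_sym.
suff H : far r s -> vdn p r && vup (pshift p r 2) s = vup p s && vdn (pshift p s (-2)) r.
  apply/idP/idP => /andP[h1 h2]; first by rewrite -H ?h1 // (square_far_dn ne h1).
  by rewrite H ?h1 // farC (square_far_up ne' h1).
move=> fr; have fr' : far s r by rewrite farC.
have [hr|nu] := boolP (upper_corner p r); last first.
  rewrite {1}/vdn (negPf nu) /=; apply/esym/negP => /andP[/andP[/lower_lt hs _]].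
  by rewrite /vdn upper_far // ?(negPf nu) //; lia.
have [hs|nl] := boolP (lower_corner p s); last first.
  rewrite {2}/vup (negPf nl) /=; apply/negP => /andP[_].
  by rewrite /vup lower_far ?(negPf nl) //; have := upper_lt hr; lia.
have lr := upper_lt hr; have ls := lower_lt hs.
rewrite /vdn /vup upper_far ?lower_far ?hr ?hs //=; [|lia|lia].
rewrite !pshiftE; [|lia|lia|lia|lia].
have [rs|nrs] := eqVneq (r + s)%N N; last first.
  rewrite (_ : (N - s == r)%N = false); last by apply/eqP; lia.
  rewrite (_ : (N - r == s)%N = false); last by apply/eqP; lia.
  rewrite (negPf ne) (negPf ne') !mulr0 !addr0.
  by rewrite andbC.
have -> : (N - s = r)%N by lia.
have -> : (N - r = s)%N by lia.
by rewrite !eqxx (negPf ne) (negPf ne'); lia.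
Qed.

Section Admissible.
Variables (i : 'I_n) (k : int).
Local Notation adm := (admissible n i.+1 k).

Lemma adm_step p r : adm p -> (r < N)%N ->
  p`_r.+1 = p`_r + 1 \/ p`_r.+1 = p`_r - 1.
Proof. by move=> [[_ _ _ st] _] ltr; have [] := st _ ltr; lia. Qed.

Lemma adm_le p r s : adm p -> (r <= n)%N -> (r + s = N)%N -> p`_r <= p`_s.
Proof.
move=> [[_ y0 yN _] le] ler rs; have -> : s = (N - r)%N by lia.
case: (posnP r) => [->|r0]; last by apply: le; lia.
by rewrite subn0 y0 yN; have := ltn_ord i; lia.
Qed.

Lemma adm_shift p r d : adm p -> (0 < r < N)%N ->
  (d = 2 /\ vdn p r) \/ (d = -2 /\ vup p r) -> adm (pshift p r d).
Proof.
move=> admp hr hd; have [[px y0 yN st] le] := admp; have ler : (r <= N)%N by lia.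
split; first split.
- move=> s hs; rewrite pshiftE //; have [hs' px'] := px s hs; split=> //.
  by case: hd => -[-> _]; move: px'; case: (s == r) => /=; lia.
- by rewrite pshiftE //; lia.
- by rewrite pshiftE // yN; lia.
- move=> s hs; rewrite !pshiftE //; have := st s hs.
  have [sr|ne] := eqVneq s r.
    subst s; case: hd => -[-> /andP[/and3P[_ /eqP e1 /eqP e2] _]]; rewrite e2; lia.
  have [sr|ne'] := eqVneq s.+1 r; last by lia.
  subst r; case: hd => -[-> /andP[/and3P[_ /eqP e1 /eqP e2] _]] /=; move: e1 => /=; lia.
- move=> s hs; rewrite !pshiftE //; have := le s hs.
  have := @adm_le p s (N - s) admp.
  have [sr|ne] := eqVneq s r.
    subst s; have [rr|ne] := eqVneq (N - r)%N r; first by rewrite rr; lia.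
    case: hd => -[-> /andP[c]]; last by lia.
    have : (r < n)%N by lia.
    by lia.
  have [sr|ne'] := eqVneq (N - s)%N r; last by lia.
  case: hd => -[-> /andP[c h]]; first by lia.
  by move: h; rewrite (_ : N - r = s)%N ?sr; lia.
Qed.

Lemma adm_dn p r : adm p -> vdn p r -> adm (pshift p r 2).
Proof.
by move=> ap h; apply: adm_shift => //; [case/andP: h => /upper_lt|left].
Qed.

Lemma adm_up p r : adm p -> vup p r -> adm (pshift p r (-2)).
Proof.
by move=> ap h; apply: adm_shift => //; [case/andP: h => /lower_lt|right].
Qed.

Lemma vup_dn p r : adm p -> vdn p r -> vup (pshift p r 2) r.
Proof.
move=> ap h; have := @adm_le p (N - r) r ap; have ler := vdn_le h; case/andP: h => /and3P[hr /eqP e1 /eqP e2] h le.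
apply/andP; split; first by apply/and3P; split; rewrite ?pshiftE //; lia.
by move: h le; rewrite !pshiftE //; have [rn|ne] := eqVneq (N - r)%N r; lia.
Qed.

Lemma vdn_up p r : adm p -> vup p r -> vdn (pshift p r (-2)) r.
Proof.
move=> ap h; have := @adm_le p r (N - r) ap; have ler := vup_le h; case/andP: h => /and3P[hr /eqP e1 /eqP e2] h le.
apply/andP; split; first by apply/and3P; split; rewrite ?pshiftE //; lia.
by move: h le; rewrite !pshiftE //; have [rn|ne] := eqVneq (N - r)%N r; lia.
Qed.

(** A blocked lower corner lies right of n and by parity has y_r = y_(N-r). Admissibility then makes
    N - r a lower corner too, and left of n lowering is free. *)
Lemma lower_vup p r : adm p -> lower_corner p r -> vup p r \/ vup p (N - r).
Proof.
move=> ap c; have [ler|ltr] := leqP r n; first by left; rewrite /vup c ler.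
rewrite /vup c leqNgt ltr /=.
have [|gt] := lerP (p`_(N - r)) (p`_r - 2); first by left.
right; have /and3P[hr /eqP e1 /eqP e2] := c.
have h0 := @adm_le p (N - r) r ap; have h1 := @adm_le p (N - r).-1 r.+1 ap.
have h2 := @adm_le p (N - r).+1 r.-1 ap.
have s1 := @adm_step p (N - r) ap; have s2 := @adm_step p (N - r).-1 ap.
have E : (N - r).-1.+1 = (N - r)%N by lia.
rewrite E in s2; apply/andP; split; last by lia.
have [[px _ _ _] _] := ap; have p1 := px (N - r)%N; have p2 := px r.
have {}p1 : ((N - r)%N%:Z - p`_(N - r) == 1 %[mod 2])%Z by case: p1 => //; lia.
have {}p2 : (r%:Z - p`_r == 1 %[mod 2])%Z by case: p2 => //; lia.
have e0 : p`_(N - r) = p`_r by lia.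
apply/and3P; split; [by lia| |];apply/eqP; by lia.
Qed.

(** For r < n < s the exponents are y_r + 1 and y_s + 3, while y_r <= y_s. *)
Lemma vdn_pole_neq p r s : adm p -> (r + s = N)%N -> r != n ->
  vdn p r -> vdn p s -> pexp p r != pexp p s.
Proof.
move=> ap rs rn /andP[/and3P[hr /eqP e1 _] h] /andP[/and3P[hs /eqP e2 _] h'].
have := @adm_le p r s ap; have := @adm_le p s r ap; rewrite /pexp e1 e2.
by lia.
Qed.

(** V-shaped, with minimum [k] at position i.+1: the pointwise least admissible path. *)
Definition top_path : pathT n :=
  [tuple of mkseq (fun s => (absz (i.+1%:Z - s%:Z))%:Z + k) N.+1].

Lemma top_pathE s : (s <= N)%N -> top_path`_s = (absz (i.+1%:Z - s%:Z))%:Z + k.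
Proof. by move=> les; rewrite nth_mkseq. Qed.

(** Turning down after an upward step would create a lower corner. *)
Lemma adm_up_steps p r s : adm p -> (forall t, lower_corner p t = false) ->
  (r < N)%N -> p`_r.+1 = p`_r + 1 -> (r + s <= N)%N -> p`_(r + s) = p`_r + s%:Z.
Proof.
move=> ap nl hr e hs.
suff [] : p`_(r + s) = p`_r + s%:Z /\
  ((r + s < N)%N -> p`_(r + s).+1 = p`_(r + s) + 1) by [].
elim: s hs => [|s IH] hs; first by rewrite addn0 addr0.
have [e1 /(_ ltac:(lia)) e2] := IH ltac:(lia).
rewrite addnS; split=> [|h]; first by rewrite e2 e1; lia.
have [//|e3] := adm_step ap h; have := nl (r + s).+1.
move/negP; case; apply/and3P; rewrite succnK; split; [lia|apply/eqP|apply/eqP]; lia.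
Qed.

Lemma adm_down_steps p r s : adm p -> (forall t, lower_corner p t = false) ->
  (r < N)%N -> p`_r.+1 = p`_r - 1 -> (s <= r.+1)%N -> p`_(r.+1 - s) = p`_r.+1 + s%:Z.
Proof.
move=> ap nl hr e hs.
suff [] : p`_(r.+1 - s) = p`_r.+1 + s%:Z /\
  ((s <= r)%N -> p`_(r.+1 - s) = p`_(r - s) - 1) by [].
elim: s hs => [|s IH] hs; first by rewrite !subn0 addr0.
have [e1 /(_ ltac:(lia)) e2] := IH ltac:(lia).
rewrite subSS; split=> [|h]; first by lia.
have e4 : (r - s.+1).+1 = (r - s)%N by lia.
have [|] := @adm_step p (r - s.+1) ap ltac:(lia); rewrite e4 => e3; last by lia.
have /negP[] := nl (r - s)%N.
have e5 : (r - s).-1 = (r - s.+1)%N by lia.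
have e6 : (r - s).+1 = (r.+1 - s)%N by lia.
by apply/and3P; rewrite e5 e6; split; [lia|apply/eqP|apply/eqP]; lia.
Qed.

Lemma adm_lb p s : adm p -> (s <= N)%N -> top_path`_s <= p`_s.
Proof.
move=> ap les; rewrite top_pathE //; have [[_ y0 yN _] _] := ap.
have h1 t : (t <= N)%N -> p`_0 - t%:Z <= p`_t.
  elim: t => [|t IH] ht; first by lia.
  by have := IH ltac:(lia); have [] := @adm_step p t ap ltac:(lia); lia.
have h2 t : (t <= N)%N -> p`_N - t%:Z <= p`_(N - t).
  elim: t => [|t IH] ht; first by rewrite subn0; lia.
  have e : (N - t.+1).+1 = (N - t)%N by lia.
  by have := IH ltac:(lia); have [] := @adm_step p (N - t.+1) ap ltac:(lia); rewrite e; lia.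
have := h1 s les; have := h2 (N - s)%N ltac:(lia).
have -> : (N - (N - s) = s)%N by lia.
by lia.
Qed.

Lemma adm_top p : adm p -> (forall t, lower_corner p t = false) -> p = top_path.
Proof.
move=> ap nl; apply: path_eqP => s; have [les|gts] := leqP s N; last first.
  by rewrite !nth_default ?size_tuple.
have [[_ y0 yN _] _] := ap; have li := ltn_ord i.
(* An upward step before i.+1 would go on to the end and overshoot [y_N]. *)
have down t : (t <= i.+1)%N -> p`_t = i.+1%:Z + k - t%:Z.
  elim: t => [|t IH] ht; first by rewrite y0 subr0.
  have [e|] := @adm_step p t ap ltac:(lia); last by have := IH ltac:(lia); lia.
  have := @adm_up_steps p t (N - t) ap nl ltac:(lia) e ltac:(lia).
  by rewrite subnKC ?yN; have := IH ltac:(lia); lia.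
(* A downward step from here on would be preceded by downward steps only, against the bound
   [adm_lb]. *)
have up t : (i.+1 + t <= N)%N -> p`_(i.+1 + t) = k + t%:Z.
  elim: t => [|t IH] ht; first by rewrite addn0 down //; lia.
  have := IH ltac:(lia); rewrite addnS.
  have [|e] := @adm_step p (i.+1 + t) ap ltac:(lia); first by lia.
  have := @adm_down_steps p (i.+1 + t) (i.+1 + t).+1 ap nl ltac:(lia) e ltac:(lia).
  have := @adm_lb p (i.+1 + t).+1 ap ltac:(lia); rewrite top_pathE; last by lia.
  by rewrite subnn y0; lia.
rewrite top_pathE //; have [le|lt] := leqP s i.+1; first by rewrite down //; lia.
by have := up (s - i.+1)%N ltac:(lia); rewrite subnKC; lia.
Qed.

Lemma top_upper r : upper_corner top_path r = (r == i.+1).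
Proof.
have li := ltn_ord i; apply/idP/eqP => [/and3P[hr]|->].
  by rewrite !top_pathE; lia.
by apply/and3P; split; rewrite ?top_pathE; lia.
Qed.

Lemma top_lower r : lower_corner top_path r = false.
Proof. by apply/negP => /and3P[hr]; rewrite !top_pathE; lia. Qed.

Lemma adm_ex_vup p : adm p -> p <> top_path -> exists2 r, (r < N)%N & vup p r.
Proof.
move=> ap ne; have [[r c]|nex] := pselect (exists r, lower_corner p r).
  by have hr := lower_lt c; have [h|h] := lower_vup ap c; eexists; try exact: h; lia.
case: ne; apply: adm_top => // t; apply/negP => c; apply: nex; by exists t.
Qed.

(** Each move changes this sum by 2, so its half counts the moves from the top path. *)
Definition pdepth_sum p : int := \sum_(s < N.+1) (p`_s - top_path`_s).
Definition pdepth p : nat := (absz (pdepth_sum p))./2.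

Lemma pdepth_sum_shift p r d : (r <= N)%N ->
  pdepth_sum (pshift p r d) = pdepth_sum p + d.
Proof.
move=> ler; rewrite /pdepth_sum.
have ltr : (r < N.+1)%N by [].
rewrite (bigD1 (Ordinal ltr)) //= [in RHS](bigD1 (Ordinal ltr)) //=.
rewrite pshiftE // eqxx; under eq_bigr => s ne.
  rewrite pshiftE // (_ : (s == r :> nat) = false); last first.
    by apply: contraNF ne => /eqP e; apply/eqP/val_inj.
  rewrite mulr0 addr0; over.
by rewrite /=; lia.
Qed.

Lemma pdepth_sum_ge0 p : adm p -> 0 <= pdepth_sum p.
Proof. by move=> ap; apply: sumr_ge0 => s _; rewrite subr_ge0 adm_lb //; have := ltn_ord s. Qed.

Lemma pdepth_top : pdepth top_path = 0%N.
Proof. by rewrite /pdepth /pdepth_sum big1 // => s _; rewrite subrr. Qed.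

Lemma pdepth_up p r : adm p -> vup p r -> pdepth p = (pdepth (pshift p r (-2))).+1.
Proof.
move=> ap h; have := pdepth_sum_ge0 (adm_up ap h); rewrite /pdepth.
by rewrite pdepth_sum_shift ?(vup_le h) //; lia.
Qed.

Lemma pdepth_dn p r : adm p -> vdn p r -> pdepth (pshift p r 2) = (pdepth p).+1.
Proof.
move=> ap h; rewrite (pdepth_up (adm_dn ap h) (vup_dn ap h)).
by rewrite pshiftK // (vdn_le h).
Qed.

Lemma pdepth0 p : adm p -> pdepth p = 0%N -> p = top_path.
Proof.
move=> ap d0; have [//|ne] := pselect (p = top_path).
by have [r _ /(pdepth_up ap)] := adm_ex_vup ap ne; rewrite d0.
Qed.

Lemma adm_top_path : (i.+1%:Z - k == 1 %[mod 2])%Z -> adm top_path.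
Proof.
move=> hik; have li := ltn_ord i; split; first split.
- by move=> r hr; rewrite top_pathE //; split=> //; lia.
- by rewrite top_pathE //; lia.
- by rewrite top_pathE //; lia.
- by move=> r hr; rewrite !top_pathE //; lia.
- by move=> r hr; rewrite !top_pathE //; lia.
Qed.

(** A path is determined by its starting value and the signs of its N steps. *)
Lemma adm_finite : finite_set adm.
Proof.
pose F (b : {ffun 'I_N -> bool}) : pathT n :=
  [tuple of mkseq (fun s => i.+1%:Z + k +
    \sum_(t < N | (t < s)%N) (if b t then 1 else -1)) N.+1].
apply: (@sub_finite_set _ _ (F @` setT)); last first.
  by apply: finite_image; exact: finite_finset.
move=> p ap; exists [ffun t : 'I_N => p`_t.+1 == p`_t + 1] => //.
have [[_ y0 _ _] _] := ap.
apply: path_eqP => s; have [les|gts] := leqP s N; last first.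
  by rewrite !nth_default ?size_tuple.
rewrite nth_mkseq // -y0 {y0}; elim: s les => [|s IH] hs.
  by rewrite big_pred0_eq ?addr0 // big_pred0 ?addr0.
rewrite (bigD1 (Ordinal hs)) //= ffunE /=.
rewrite (eq_bigl (fun t : 'I_N => (t < s)%N)) => [|t]; last first.
  rewrite ltnS andbC ltn_neqAle; congr (_ && _).
rewrite addrCA IH ?(ltnW hs) //.
have [e|e] := adm_step ap hs; first by rewrite e eqxx; lia.
rewrite e (_ : (p`_s - 1 == p`_s + 1) = false); first by lia.
by apply/negbTE/eqP; lia.
Qed.

(* Gives all coordinates the same syntactic form, which lia needs. *)
Definition height p s : int := nth 0 p s.

Lemma heightE p s : p`_s = height p s. Proof. by []. Qed.

(** A neighbour of a local maximum is a local minimum or lies on a slope; after lowering [y_s] it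
    lies on a slope or is a local maximum, respectively. *)
Lemma nbr_lower p s t : adm p -> lower_corner p s -> s = t.+1 \/ t = s.+1 ->
  (0 < t < N)%N -> let p' := pshift p s (-2) in
  [/\ upper_corner p t, upper_corner p' t = false, lower_corner p' t = false
    & p`_t.-1 = p`_s] \/
  [/\ upper_corner p t = false, lower_corner p t = false, lower_corner p' t,
      upper_corner p' t = false & p'`_t.-1 = p`_s - 2].
Proof.
move=> ap /and3P[hs /eqP e1 /eqP e2] st ht /=; have les : (s <= N)%N by lia.
have := @adm_step p t ap ltac:(lia); have := @adm_step p t.-1 ap ltac:(lia).
have et : t.-1.+1 = t by lia.
rewrite et /upper_corner /lower_corner !pshiftE // ht /=.
rewrite !heightE in e1 e2 *.
case: st => st h1 h2.
  rewrite st succnK in e1.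
  have n1 : (t == s) = false by lia.
  have n2 : (t.-1 == s) = false by lia.
  rewrite -st in e1; rewrite -st eqxx n1 n2 in h2 *; case: h1 => h1; [right|left]; split; lia.
rewrite -st in e2; have n1 : (t == s) = false by lia.
have n2 : (t.+1 == s) = false by lia.
have e0 : t.-1 = s by lia.
rewrite e0 eqxx n1 n2 in h1 *; case: h2 => h2; [left|right]; split; lia.
Qed.

Lemma nbr_upper p r u : adm p -> upper_corner p r -> r = u.+1 \/ u = r.+1 ->
  (0 < u < N)%N -> let p' := pshift p r 2 in
  [/\ lower_corner p u, upper_corner p u = false,
      upper_corner p' u = false, lower_corner p' u = false & p`_u.-1 = p`_r] \/
  [/\ upper_corner p u = false, lower_corner p u = false, upper_corner p' u
    & p'`_u.-1 = p`_r + 2].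
Proof.
move=> ap /and3P[hs /eqP e1 /eqP e2] st ht /=; have les : (r <= N)%N by lia.
have := @adm_step p u ap ltac:(lia); have := @adm_step p u.-1 ap ltac:(lia).
have et : u.-1.+1 = u by lia.
rewrite et /upper_corner /lower_corner !pshiftE // ht /=.
rewrite !heightE in e1 e2 *.
case: st => st h1 h2.
  rewrite st succnK in e1.
  have n1 : (u == r) = false by lia.
  have n2 : (u.-1 == r) = false by lia.
  rewrite -st in e1; rewrite -st eqxx n1 n2 in h2 *; case: h1 => h1; [left|right]; split; lia.
rewrite -st in e2; have n1 : (u == r) = false by lia.
have n2 : (u.+1 == r) = false by lia.
have e0 : u.-1 = r by lia.
rewrite e0 eqxx n1 n2 in h1 *; case: h2 => h2; [right|left]; split; lia.
Qed.

End Admissible.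

End PathMoves.

(** * Matrix coefficients of the path model *)

Section PathCoefficients.
Variables (C : numFieldType) (q : C) (n : nat).
Local Notation N := (2 * n)%N.
Hypotheses (q0 : q != 0) (hq : forall m : nat, (0 < m)%N -> q ^+ m != 1).
Implicit Types (p : pathT n) (r s : nat).

(** Value at z = A^-1 of the factor (q - q^-1 B z) / (1 - B z) of an upper corner, where B / A =
    q^d; [glo] is the same for a lower corner, with q inverted. At d = 0 both are 0 by the
    convention for division. *)
Definition gup (d : int) : C := (q - q^-1 * q ^ d) / (1 - q ^ d).
Definition glo (d : int) : C := (q^-1 - q * q ^ d) / (1 - q ^ d).

(* The value at the pole of the corner r of the factor of psi(z) due to the
   position 2 * n - r, which belongs to the same node. *)
Definition cfac p r : C :=
  let s := (N - r)%N in let d := pexp p s - pexp p r in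
  if upper_corner p s then gup d else if lower_corner p s then glo d else 1.

(** A move and its inverse must have coefficients with product [cdiag]. With this splitting
    [square_coef] reduces to locality except for r > n and s < n. Position n is its own mirror, so
    it carries no factor. *)
Definition cdn p r : C := if (r <= n)%N then 1 else cfac p r.
Definition cup p r : C := if (r < n)%N then cfac p r else 1.
Definition cdiag p r : C := if r == n then 1 else cfac p r.

Lemma oneBq_neq0 (d : int) : d != 0 -> 1 - q ^ d != 0.
Proof. by move=> d0; rewrite subr_eq0 eq_sym expq_eq1. Qed.

(** For squares at mirror positions, where each move changes the type of the corner that the other
    one sees. *)
Lemma glo_gup (d : int) : glo d * glo (- d) = gup d * gup (- d).
Proof.
rewrite /glo /gup -invr_expz.
have X0 : q ^ d != 0 by rewrite expfz_neq0.
have [->|ne] := eqVneq (q ^ d) 1; first by rewrite invr1 subrr invr0 !mulr0.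
have d1 : 1 - q ^ d != 0 by rewrite subr_eq0 eq_sym.
have d2 : q ^ d - 1 != 0 by rewrite subr_eq0.
by field; rewrite q0 X0 d1 d2.
Qed.

Lemma expqD2 (d : int) : q ^ (d - 2) = q ^ d / q ^+ 2.
Proof. by rewrite expfzDr // exprnN. Qed.

Lemma gup_gloN (d : int) : gup d = glo (- d).
Proof.
rewrite /gup /glo -invr_expz; have X0 : q ^ d != 0 by rewrite expfz_neq0.
have [->|ne] := eqVneq (q ^ d) 1; first by rewrite invr1 subrr invr0 !mulr0.
have d1 : 1 - q ^ d != 0 by rewrite subr_eq0 eq_sym.
have d2 : q ^ d - 1 != 0 by rewrite subr_eq0.
by field; rewrite q0 X0 d1 d2.
Qed.

Lemma gup_neq0 (d : int) : d != 0 -> d != 2 -> gup d != 0.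
Proof.
move=> d0 d2; rewrite mulf_neq0 ?invr_eq0 ?oneBq_neq0 // subr_eq0.
apply: contraNneq d2 => e; have : q ^ (d - 2) == 1.
  by rewrite expqD2 -(inj_eq (mulfI q0)); apply/eqP; rewrite [RHS]mulr1 [RHS]e; field.
by rewrite expq_eq1 // => ?; apply/eqP; lia.
Qed.

Lemma glo_neq0 (d : int) : d != 0 -> d != -2 -> glo d != 0.
Proof. by move=> d0 d2; rewrite -[d]opprK -gup_gloN gup_neq0 //; lia. Qed.

Lemma gup_glo (d : int) : d != 0 -> d != 2 -> gup d * glo (d - 2) = 1.
Proof.
move=> d0 d2; have n1 := oneBq_neq0 d0.
have n2 : 1 - q ^ (d - 2) != 0 by apply: oneBq_neq0; lia.
rewrite /gup /glo expqD2 in n2 *.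
have n3 : q ^+ 2 - q ^ d != 0.
  by move: n2; apply: contraNneq => /eqP; rewrite subr_eq0 => /eqP <-;
    rewrite divff ?subrr // expf_neq0.
by field; rewrite q0 n1 n3.
Qed.

Lemma cfac_far p r d s : (r <= N)%N -> far r (N - s) -> far r s ->
  cfac (pshift p r d) s = cfac p s.
Proof. by move=> ler f1 f2; rewrite /cfac upper_far // lower_far // !pexp_far. Qed.

Section Adm.
Variables (i : 'I_n) (k : int).
Local Notation adm := (admissible n i.+1 k).

(** Admissibility gives d <= -2 if the mirror is an upper corner and d <= -4 if it is a lower one,
    away from the zeros and poles of [gup] and [glo]. *)
Lemma cdn_neq0 p r : adm p -> vdn p r -> cdn p r != 0.
Proof.
move=> ap /andP[c _]; rewrite /cdn; case: leqP => [_|ltr]; first exact: oner_neq0.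
have /and3P[hr /eqP e1 /eqP e2] := c.
have le := @adm_le _ _ _ _ (N - r) r ap ltac:(lia) ltac:(lia).
have e3 : (n < r)%N = true by [].
have e4 : (n <= r)%N = true by lia.
have e5 : (n < N - r)%N = false by lia.
have e6 : (n <= N - r)%N = false by lia.
rewrite /cfac; case: ifP => [/and3P[_ /eqP e _]|_].
  by rewrite /pexp e e1 e3 e4 e5 e6; apply: gup_neq0; lia.
case: ifP => [/and3P[_ /eqP e _]|_]; last exact: oner_neq0.
by rewrite /pexp e e1 e3 e4 e5 e6; apply: glo_neq0; lia.
Qed.

(** Here d >= 4 for an upper and d >= 2 for a lower mirror corner. *)
Lemma cup_neq0 p r : adm p -> vup p r -> cup p r != 0.
Proof.
move=> ap /andP[c _]; rewrite /cup; case: ltnP => [ltr|_]; last exact: oner_neq0.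
have /and3P[hr /eqP e1 /eqP e2] := c.
have le := @adm_le _ _ _ _ r (N - r) ap ltac:(lia) ltac:(lia).
have e3 : (n < r)%N = false by lia.
have e4 : (n <= r)%N = false by lia.
have e5 : (n < N - r)%N = true by lia.
have e6 : (n <= N - r)%N = true by lia.
rewrite /cfac; case: ifP => [/and3P[_ /eqP e _]|_].
  by rewrite /pexp e e1 e3 e4 e5 e6; apply: gup_neq0; lia.
case: ifP => [/and3P[_ /eqP e _]|_]; last exact: oner_neq0.
by rewrite /pexp e e1 e3 e4 e5 e6; apply: glo_neq0; lia.
Qed.

Lemma cfac_self p r d : (0 < r < N)%N -> r != n -> cfac (pshift p r d) r = cfac p r.
Proof.
move=> hr ne; have f : far r (N - r) by rewrite /far; lia.
have ler : (r <= N)%N by lia.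
by rewrite /cfac upper_far // lower_far // pexp_far // pexp_shift //; lia.
Qed.

Lemma cdiagE p r : (0 < r < N)%N ->
  cdn p r * cup (pshift p r 2) r = cdiag p r /\
  cup p r * cdn (pshift p r (-2)) r = cdiag p r.
Proof.
move=> hr; rewrite /cdn /cup /cdiag; case: ltngtP => [lt|gt|eq].
- by rewrite mul1r mulr1 cfac_self //; lia.
- by rewrite mul1r mulr1 cfac_self //; lia.
- by rewrite !mulr1.
Qed.

(** For r > n and s < n there are three cases: r + s = N, settled by [glo_gup]; N - s far from r,
    where no factor changes; and N - s next to r, where each move creates or destroys the mirror
    corner of the other. *)
Lemma square_coef p r s : adm p -> r != s -> vdn p r -> vup (pshift p r 2) s ->
  cdn p r * cup (pshift p r 2) s = cup p s * cdn (pshift p s (-2)) r.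
Proof.
move=> ap ne h1 h2; have fr := square_far_dn ne h1 h2.
have fr' : far s r by rewrite farC.
have := square_valid p ne; rewrite h1 h2 /= => /esym/andP[h3 h4].
have ler := vdn_le h1; have les := vup_le h3.
have /andP[ur _] := h1; have /andP[ls _] := h3.
have /andP[us _] := h2; have /andP[lr _] := h4.
have hr := upper_lt ur; have hs := lower_lt ls.
rewrite /cdn /cup; case: (leqP r n) => [rn|nr].
  rewrite mul1r mulr1; case: ltnP => // sn.
  by rewrite cfac_far //; move: fr; rewrite /far; clear -rn sn hr hs; lia.
case: ltnP => [sn|ns]; last first.
  by rewrite mulr1 mul1r cfac_far //; move: fr; rewrite /far; clear -nr ns hr hs; lia.
have [rs|nrs] := eqVneq (r + s)%N N.
  have er : (N - r = s)%N by clear -rs; lia.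
  have es : (N - s = r)%N by clear -rs; lia.
  have P1 := upper_lower ur; have P2 : upper_corner p s = false.
    by apply/negP => /upper_lower; rewrite ls.
  have U : upper_corner (pshift p s (-2)) s.
    by have /andP[] := vdn_up ap h3.
  have L : lower_corner (pshift p r 2) r by have /andP[] := vup_dn ap h1.
  have U' : upper_corner (pshift p r 2) r = false.
    by apply/negP => /upper_lower; rewrite L.
  rewrite /cfac er es P2 ls U' L ur U.
  rewrite (pexp_far _ _ ler fr) (pexp_far _ _ les fr').
  rewrite !(@pexp_shift _ _ r _ r) // ?(@pexp_shift _ _ s _ s) //; [|by clear -hs; lia|by clear -hr; lia].
  by rewrite -[pexp p r - pexp p s]opprB glo_gup mulrC.
have [f1|nf] := boolP (far r (N - s)).
  have f2 : far s (N - r) by move: f1; rewrite /far; clear -hr hs; lia.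
  by rewrite !cfac_far // mulrC.
have ap1 := adm_dn ap h1; have ap2 := adm_up ap h3.
set p1 := pshift p r 2; set p2 := pshift p s (-2).
have nbr : (s = (N - r).+1 \/ N - r = s.+1)%N by move: nf nrs; rewrite /far; clear -hr hs; lia.
have nbr' : (r = (N - s).+1 \/ N - s = r.+1)%N.
  by clear -nbr hr hs; lia.
have /and3P[_ /eqP ur1 /eqP ur2] := ur; have /and3P[_ /eqP ls1 _] := ls.
have le := @adm_le _ _ _ p s (N - s) ap (ltnW sn) (subnKC les).
have ecs : p`_(N - s) = p`_r + 1.
  by case: nbr' => e; [rewrite -ur1 e succnK|rewrite e].
(* The exponent difference seen from r when N - r is an upper corner; admissibility gives d <=
   -2. *)
set d := p`_s - p`_r - 3.
have [d0 d2] : d != 0 /\ d != 2.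
  by rewrite /d; move: le; rewrite ecs !heightE; clear; lia.
have pr : pexp p r = p`_r + 3.
  by rewrite /pexp ur1 nr (ltnW nr) !heightE; clear; lia.
have ps : pexp p s = p`_s - 1.
  have [ns1 ns2] : (n < s)%N = false /\ (n <= s)%N = false by clear -sn; lia.
  by rewrite /pexp ls1 ns1 ns2 !heightE; clear; lia.
have pr2 : pexp p2 r = pexp p r by rewrite pexp_far.
have ps1 : pexp p1 s = pexp p s by rewrite pexp_far.
have [f1 f2] : (n < N - r)%N = false /\ (n <= N - r)%N = false by clear -nr hr; lia.
have [f3 f4] : (n < N - s)%N = true /\ (n <= N - s)%N = true by clear -sn; lia.
have A : (cfac p r = gup d /\ cfac p2 r = 1) \/ (cfac p r = 1 /\ cfac p2 r = glo (d - 2)).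
  have [[a1 a2 a3 a4]|[a1 a2 a3 a4 a5]] := nbr_lower ap ls nbr ltac:(clear -nr hr; lia); [left|right];
    rewrite /cfac -/p2 a1 a2 a3 ?a4; split=> //.
    by rewrite pr /pexp a4 f1 f2; congr gup; rewrite /d !heightE; clear; lia.
  by rewrite pr2 pr /pexp a5 f1 f2; congr glo; rewrite /d !heightE; clear; lia.
have B : (cfac p s = glo (- d) /\ cfac p1 s = 1) \/
         (cfac p s = 1 /\ cfac p1 s = gup (2 - d)).
  have [[a1 a2 a3 a4 a5]|[a1 a2 a3 a4]] := nbr_upper ap ur nbr' ltac:(clear -sn hs; lia); [left|right];
    rewrite /cfac -/p1 a1 a2 a3 ?a4; split=> //.
    by rewrite ps /pexp a5 f3 f4; congr glo; rewrite /d !heightE; clear; lia.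
  by rewrite ps1 ps /pexp a4 f3 f4; congr gup; rewrite /d !heightE; clear; lia.
clearbody d; have g1 := gup_gloN d; have g3 := gup_glo d0 d2.
have g2 : gup (2 - d) = glo (d - 2) by rewrite gup_gloN opprB.
(* All four combinations follow from gup d = glo (- d) and gup d * glo (d - 2) = 1. *)
by case: A => -[-> ->]; case: B => -[-> ->]; rewrite ?g2 -?g1 ?mul1r ?mulr1.
Qed.

End Adm.

End PathCoefficients.

Ltac decide_nat := repeat (match goal with
  | |- context [@eq_op _ ?a ?b] =>
    first [rewrite (_ : (a == b) = true); last by lia
          |rewrite (_ : (a == b) = false); last by lia]
  | |- context [leq ?a ?b] =>
    first [rewrite (_ : leq a b = true); last by lia
          |rewrite (_ : leq a b = false); last by lia]
  end; rewrite /=).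

(** * Positions of a path that belong to a given node *)

Section Positions.
Variable n : nat.
Local Notation N := (2 * n)%N.
Implicit Types (r s : nat) (i : 'I_n).

Definition poss i : seq nat := if i.+1 == n then [:: n] else [:: i.+1; N - i.+1]%N.

Lemma mem_poss i r : (0 < r < N)%N -> (r \in poss i) = ((fold_pos n r).-1 == i).
Proof.
move=> hr; have li := ltn_ord i; rewrite /poss /fold_pos.
case: (eqVneq i.+1 n) => h; rewrite !inE; case: (leqP r n) => h'; apply/idP/idP; lia.
Qed.

Lemma poss_range i r : r \in poss i -> (0 < r < N)%N.
Proof.
have li := ltn_ord i; rewrite /poss; case: (eqVneq i.+1 n) => h; rewrite !inE.
  by move=> /eqP ->; lia.
by case/orP => /eqP ->; lia.
Qed.

Lemma poss_uniq i : uniq (poss i).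
Proof.
have li := ltn_ord i; rewrite /poss; case: (eqVneq i.+1 n) => h //=.
by rewrite inE andbT; apply/eqP; lia.
Qed.

Lemma bar_poss (r : 'I_N) : (0 < r)%N -> (r : nat) \in poss (bar r).
Proof. by move=> r0; rewrite mem_poss ?eqxx // r0 ltn_ord. Qed.

(** [bar] sends position 0 to the first node by truncation, hence the hypothesis on [G 0]. *)
Lemma sum_poss (Z : nmodType) (G : nat -> Z) i : G 0%N = 0 ->
  \sum_(r < N | bar r == i) G r = \sum_(r <- poss i) G r.
Proof.
move=> G0; rewrite big_mkcond.
rewrite (eq_bigr (fun r : 'I_N => if (r : nat) \in poss i then G r else 0)).
  rewrite -(big_mkord xpredT (fun r : nat => if r \in poss i then G r else 0)).
  rewrite -big_mkcond -big_filter; apply: perm_big; apply: uniq_perm.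
  - by rewrite filter_uniq // iota_uniq.
  - exact: poss_uniq.
  move=> r; rewrite mem_filter mem_index_iota; apply: andb_idr => /poss_range.
  by lia.
move=> r _; have [r0|r0] := posnP r; first by rewrite r0 G0; do 2 case: ifP.
by rewrite mem_poss ?r0 ?ltn_ord // -val_eqE.
Qed.

End Positions.

(** * Effect of a move on the path monomial *)

Section Increment.
Variable n : nat.
Local Notation N := (2 * n)%N.
Implicit Types (p : pathT n) (r s : nat) (i j : 'I_n).
Variables (Z : zmodType) (h : int -> Z).

(* The contribution of position r to an additive function of path_mon q p whose
   value on Y_{i, q^e} is h e. *)
Definition local_term p r : Z :=
  (if upper_corner p r then h (p`_r + 2 * (n < r)%N%:Z) else 0) -
  (if lower_corner p r then h (p`_r + 2 * (n <= r)%N%:Z) else 0).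

Lemma local_far p r s : (r <= N)%N -> far r s ->
  local_term (pshift p r 2) s = local_term p s.
Proof.
move=> ler fr; rewrite /local_term upper_far // lower_far //.
have [->|s0] := posnP s; first by rewrite /upper_corner /lower_corner.
by rewrite (nth_far _ _ ler fr s0) //; lia.
Qed.

Variables (i0 : 'I_n) (k : int).
Local Notation adm := (admissible n i0.+1 k).

Lemma local_same p r : adm p -> vdn p r ->
  let d := if r == n then 2 else 1 in
  local_term (pshift p r 2) r - local_term p r =
  - h (pexp p r + d) - h (pexp p r - d).
Proof.
move=> ap hv; have ler := vdn_le hv.
have /andP[L _] := vup_dn ap hv; have /andP[U _] := hv.
have L' := upper_lower U.
have U' : upper_corner (pshift p r 2) r = false.
  by apply/negP => /upper_lower; rewrite L.
rewrite /= /local_term U L L' U' subr0 sub0r pshiftE // eqxx.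
have /and3P[_ /eqP e1 _] := U.
congr (- h _ - h _); rewrite /pexp e1; case: ltngtP => _; rewrite !heightE; lia.
Qed.

(** The neighbour loses a lower corner or gains an upper one, with the same contribution. At r = n
    both neighbours belong to one node and contribute at q^-1 and q times the pole. *)
Lemma local_adj p r s : adm p -> vdn p r -> s = r.+1 \/ r = s.+1 ->
  (0 < s < N)%N ->
  let d := if r == n then if (s < n)%N then -1 else 1 else 0 in
  local_term (pshift p r 2) s - local_term p s = h (pexp p r + d).
Proof.
move=> ap hv rs hs /=; have ler := vdn_le hv.
have /andP[U le] := hv; have /and3P[_ /eqP e1 /eqP e2] := U.
have es : p`_s = p`_r + 1.
  by case: rs => e; [rewrite e e2|rewrite -e1 e succnK].
have les := @adm_le _ _ _ p s.-1 s.+1 ap.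
have rs' : r = s.+1 \/ s = r.+1 by case: rs; [right|left].
rewrite /local_term.
have [[a1 a2 a3 a4 a5]|[a1 a2 a3 a4]] := nbr_upper ap U rs' hs.
  rewrite a1 a2 a3 a4 subr0 !sub0r opprK es /pexp e1; congr h.
  (* In this case the shift by 2 at position n would not match the pole at r; the inequality in
     [vdn] excludes it. *)
  have nc : ~ (s = n /\ n = r.+1).
    move=> [sn nr]; have /and3P[_ _ /eqP e3] := a1.
    move: le e3 e2; rewrite (_ : N - r = s.+1)%N; last by clear -sn nr; lia.
    by rewrite es !heightE; clear -nr; lia.
  move: rs nc; rewrite !heightE; clear; case: (ltngtP r n); case: (ltngtP s n); lia.
have a3' := upper_lower a3.
rewrite a1 a2 a3 a3' !subr0 pshiftE // (_ : (s == r) = false); last first.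
  by clear -rs; lia.
rewrite es /pexp e1 mulr0 addr0; congr h.
(* Excluded by y_(n-1) <= y_(n+1), since a new upper corner at n forces y_(n-1) = y_n + 1. *)
have nc : ~ (s = n /\ r = n.+1).
  move=> [sn nr]; have /and3P[_ /eqP e3 _] := a3.
  have les' : p`_s.-1 <= p`_r.
    have -> : r = s.+1 by clear -sn nr; lia.
    by apply: les; clear -sn hs; lia.
  have e4 : (s.-1 == r) = false by clear -sn nr; lia.
  have e5 : (s == r) = false by clear -sn nr; lia.
  move: e3 les'; rewrite !pshiftE // e4 e5 es !heightE; clear; lia.
move: rs nc; rewrite !heightE; clear; case: (ltngtP r n); case: (ltngtP s n); lia.
Qed.

(** Additive form of multiplication by the inverse of A_{j,a}, with a the pole at r. The arbitrary
    [h] serves both power sums and degrees. *)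
Lemma local_increment p i j r : adm p -> vdn p r -> r \in poss j ->
  \sum_(s <- poss i) (local_term (pshift p r 2) s - local_term p s) =
  if i == j then - h (pexp p r + (symd j)%:Z) - h (pexp p r - (symd j)%:Z)
  else if cartan i j == -1 then h (pexp p r)
  else if cartan i j == -2 then h (pexp p r - 1) + h (pexp p r + 1)
  else 0.
Proof.
move=> ap hv rj; have ler := vdn_le hv; have li := ltn_ord i; have lj := ltn_ord j.
set d : int := if r == n then 2 else 1.
pose v s := if s == r then - h (pexp p r + d) - h (pexp p r - d)
  else if (s == r.+1) || (r == s.+1)
    then h (pexp p r + (if r == n then if (s < n)%N then -1 else 1 else 0))
  else 0.
have vE s : (0 < s < N)%N -> local_term (pshift p r 2) s - local_term p s = v s.
  move=> hs; rewrite /v; have [->|ne] := eqVneq s r; first exact: local_same.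
  case: ifP => [c|c].
    apply: local_adj => //; by case/orP: c => /eqP ->; [left|right].
  rewrite local_far ?subrr //; move: c ne; rewrite /far; clear; lia.
rewrite (eq_big_seq v) => [|s /poss_range /vE //].
have -> : (i == j) = (i == j :> nat) by rewrite -val_eqE.
have -> : (symd j)%:Z = d.
  by rewrite /symd /d; move: rj; rewrite /poss; case: eqP => e;
    rewrite !inE; [move=> /eqP ->; rewrite eqxx|case/orP => /eqP ->; case: eqP => //; lia].
rewrite /cartan -val_eqE /=; move: rj; rewrite /poss /v /d {vE v d} => rj.
clear ap hv ler.
have [jn|jn] := boolP (j.+1 == n); rewrite ?jn ?(negPf jn) ?inE in rj.
  move: rj => /eqP rn; rewrite rn {rn}; have [iN|iN] := eqVneq i.+1 n.
    by rewrite big_seq1; decide_nat.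
  rewrite big_cons big_seq1; have [i2|i2] := eqVneq i.+2 n; decide_nat => //.
  by rewrite addr0.
have [iN|iN] := eqVneq i.+1 n.
  rewrite big_seq1; case/orP: rj => /eqP ->;
    by have [j2|j2] := eqVneq j.+2 n; decide_nat; rewrite ?addr0.
rewrite big_cons big_seq1; have [e|ne] := eqVneq (i : nat) (j : nat).
  rewrite e; case/orP: rj => /eqP ->; decide_nat; by rewrite ?andbF ?addr0 ?add0r.
have [c1|c1] := eqVneq i.+1 (j : nat).
  case/orP: rj => /eqP ->; decide_nat; by rewrite ?andbF ?addr0 ?add0r.
have [c2|c2] := eqVneq j.+1 (i : nat).
  case/orP: rj => /eqP ->; decide_nat; by rewrite ?andbF ?addr0 ?add0r.
case/orP: rj => /eqP ->; decide_nat; by rewrite ?andbF ?addr0 ?add0r.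
Qed.

End Increment.

(** * Path monomials sorted by node *)

Section PathMonomials.
Variables (C : numFieldType) (q : C) (n : nat).
Local Notation N := (2 * n)%N.
Hypotheses (q0 : q != 0) (hq : forall m : nat, (0 < m)%N -> q ^+ m != 1).
Implicit Types (p : pathT n) (r s : nat) (i j : 'I_n).

Definition pupper p i : seq C :=
  [seq q ^ (p`_r + 2 * (n < r)%N%:Z) | r <- poss i & upper_corner p r].
Definition plower p i : seq C :=
  [seq q ^ (p`_r + 2 * (n <= r)%N%:Z) | r <- poss i & lower_corner p r].

Lemma sum_corners (c : pred nat) (F : nat -> C) : ~~ c 0%N ->
  \sum_(r < N | c r) Yvar (bar r) (F r) =
  \sum_i \sum_(a <- [seq F r | r <- poss i & c r]) Yvar i a.
Proof.
move=> c0; rewrite (partition_big (@bar n) xpredT) //=; apply: eq_bigr => i _.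
rewrite big_map big_filter [RHS]big_mkcond.
rewrite -(sum_poss (G := fun r => if c r then Yvar i (F r) else 0)) ?(negPf c0) //.
rewrite -big_mkcondr; apply: eq_big => [r|r /andP[_ /eqP ->] //].
by rewrite andbC.
Qed.

Lemma path_monE p : path_mon q p = lmon_of (pupper p) (plower p).
Proof.
rewrite /path_mon /lmon_of sumrB; congr (_ - _).
  exact: (@sum_corners (upper_corner p) (fun r => q ^ (p`_r + 2 * (n < r)%N%:Z))).
exact: (@sum_corners (lower_corner p) (fun r => q ^ (p`_r + 2 * (n <= r)%N%:Z))).
Qed.

Lemma pupper_lower_neq0 p i (a : C) : a \in pupper p i ++ plower p i -> a != 0.
Proof. by rewrite mem_cat => /orP[] /mapP[r _ ->]; rewrite expfz_neq0. Qed.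

Lemma path_mon_top i (k : int) :
  path_mon q (top_path i k) = Yvar i (q ^ k).
Proof.
have li := ltn_ord i; have lt : (i.+1 < N)%N by lia.
rewrite /path_mon [X in _ - X]big1 => [|r]; last by rewrite top_lower.
rewrite subr0 (big_pred1 (Ordinal lt)) => [|r]; last by rewrite top_upper.
congr Yvar; first by apply: val_inj; rewrite /= /fold_pos ifT.
rewrite -[LHS]/(q ^ ((top_path i k)`_i.+1 + 2 * (n < i.+1)%N%:Z)) top_pathE; last by lia.
rewrite subrr.
by rewrite (_ : (n < i.+1)%N = false) ?mulr0 ?addr0 ?add0r //; lia.
Qed.

End PathMonomials.

(** * Residues of psi and operators on functions of paths *)

Section PathOperators.
Variables (C : numFieldType) (q : C) (n : nat).
Local Notation N := (2 * n)%N.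
Hypotheses (q0 : q != 0) (hq : forall m : nat, (0 < m)%N -> q ^+ m != 1).
Variables (i0 : 'I_n) (k : int).
Local Notation adm := (admissible n i0.+1 k).
Implicit Types (p : pathT n) (r s : nat) (i j : 'I_n).

Definition pole p r : C := q ^ pexp p r.

Lemma pole_neq0 p r : pole p r != 0.
Proof. exact: expfz_neq0. Qed.

Lemma poss_symd i r : r \in poss i -> symd i = if r == n then 2%N else 1%N.
Proof.
rewrite /poss /symd; case: eqP => e; rewrite !inE; first by move=> /eqP ->; rewrite eqxx.
by have li := ltn_ord i; case/orP => /eqP ->; case: eqP => //; lia.
Qed.

Lemma pole_upper p i r : r \in poss i -> upper_corner p r ->
  q ^ (p`_r + 2 * (n < r)%N%:Z) * qsub q i = pole p r.
Proof.
move=> ri /and3P[_ /eqP e _]; rewrite /qsub exprnP -expfzDr // /pole /pexp e.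
rewrite (poss_symd ri); congr (q ^ _).
by rewrite !heightE; case: ltngtP => _ /=; lia.
Qed.

Lemma pole_lower p i r : r \in poss i -> lower_corner p r ->
  q ^ (p`_r + 2 * (n <= r)%N%:Z) / qsub q i = pole p r.
Proof.
move=> ri /and3P[_ /eqP e _]; rewrite /qsub exprnP invr_expz -expfzDr // /pole /pexp e.
rewrite (poss_symd ri); congr (q ^ _).
by rewrite !heightE; case: ltngtP => _ /=; lia.
Qed.

Lemma path_factors p i : lfactors q i (pupper q p i) (plower q p i) =
  [seq (qsub q i, pole p r) | r <- poss i & upper_corner p r] ++
  [seq ((qsub q i)^-1, pole p r) | r <- poss i & lower_corner p r].
Proof.
rewrite /lfactors /pupper /plower -!map_comp; congr (_ ++ _);
  apply/eq_in_map => r; rewrite mem_filter => /andP[c ri] /=.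
  by rewrite pole_upper.
by rewrite pole_lower.
Qed.

Definition csign p r : C := (upper_corner p r)%:R - (lower_corner p r)%:R.

(** By admissibility mirror corners never share a pole, so [pjump2] applies to psi. *)
Lemma corner_pole_neq p r s : adm p -> (r < n)%N -> (r + s = N)%N ->
  upper_corner p r || lower_corner p r -> upper_corner p s || lower_corner p s ->
  pole p r != pole p s.
Proof.
move=> ap rn rs cr cs; rewrite /pole (inj_eq (expq_inj q0 hq)).
have [r1 r2] : (n < r)%N = false /\ (n <= r)%N = false by clear -rn; lia.
have [s1 s2] : (n < s)%N = true /\ (n <= s)%N = true by clear -rn rs; lia.
have le := @adm_le _ _ _ p r s ap (ltnW rn) rs.
have hs : (0 < s)%N by clear -rn rs; lia.
have le' := @adm_le _ _ _ p r.+1 s.-1 ap rn ltac:(clear -hs rs; lia).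
rewrite /pexp r1 r2 s1 s2.
case/orP: cr => /and3P[_ /eqP a1 /eqP a2]; case/orP: cs => /and3P[_ /eqP b1 /eqP b2];
  move: le le'; rewrite a1 a2 b1 !heightE; clear; lia.
Qed.

Lemma gup_pole p r s : gup q (pexp p s - pexp p r) =
  (q * pole p r - q^-1 * pole p s) / (pole p r - pole p s).
Proof.
rewrite /gup expfzDr // -invr_expz -!/(pole _ _).
have r0 := pole_neq0 p r; have [->|ne] := eqVneq (pole p r) (pole p s).
  by rewrite divff ?pole_neq0 // !subrr !invr0 !mulr0.
have d1 : pole p r - pole p s != 0 by rewrite subr_eq0.
by field; rewrite q0 r0 d1.
Qed.

Lemma glo_pole p r s : glo q (pexp p s - pexp p r) =
  (q^-1 * pole p r - q * pole p s) / (pole p r - pole p s).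
Proof.
rewrite /glo expfzDr // -invr_expz -!/(pole _ _).
have r0 := pole_neq0 p r; have [->|ne] := eqVneq (pole p r) (pole p s).
  by rewrite divff ?pole_neq0 // !subrr !invr0 !mulr0.
have d1 : pole p r - pole p s != 0 by rewrite subr_eq0.
by field; rewrite q0 r0 d1.
Qed.

(* Partial fractions: the residue of psi_i(z) at the pole of the corner r is
   csign p r * cdiag q p r. *)
Lemma lpsi_path p i t : adm p ->
  lpsi q (path_mon q p) i t = (qsub q i - (qsub q i)^-1) *
    \sum_(r <- poss i) csign p r * cdiag q p r * pole p r ^ t.
Proof.
move=> ap; rewrite path_monE // lpsiE // path_factors.
have x0 := qsub_neq0 q0 i; have x1 : (qsub q i)^-1 != 0 by rewrite invr_eq0.
have P0 := pole_neq0 p.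
have [iN|iN] := eqVneq i.+1 n.
  have -> : poss i = [:: n] by rewrite /poss iN eqxx.
  rewrite big_seq1 /csign /cdiag eqxx /=.
  have [U|nU] := boolP (upper_corner p n).
    by rewrite (upper_lower U) /= pjump1 //; ring.
  have [L|nL] := boolP (lower_corner p n); rewrite /= ?pjump1 ?pjump0 // ?invrK; ring.
have li := ltn_ord i; set r := i.+1; set s := (N - r)%N.
have rn : (r < n)%N by rewrite /r; lia.
have rs : (r + s = N)%N by rewrite /s; lia.
have er : (N - s = r)%N by rewrite /s; lia.
have [rn' sn'] : (r == n) = false /\ (s == n) = false by rewrite /s; lia.
have -> : poss i = [:: r; s] by rewrite /poss (negPf iN).
have -> : qsub q i = q by rewrite /qsub (@poss_symd i r) ?rn' ?expr1 // /poss (negPf iN) inE eqxx.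
have q1 : q^-1 != 0 by rewrite invr_eq0.
have ne := corner_pole_neq ap rn rs.
have ne' := ne; rewrite eq_sym in ne'.
rewrite big_cons big_seq1 /csign /cdiag rn' sn' /cfac er -/s /=.
move: ne ne' (@upper_lower _ p r) (@upper_lower _ p s).
case: (upper_corner p r); case: (lower_corner p r);
  case: (upper_corner p s); case: (lower_corner p s) => /= ne ne' ulr uls;
  try (by discriminate (ulr isT)); try (by discriminate (uls isT));
  rewrite ?pjump0 ?pjump1 ?invrK //;
  first [ring | rewrite pjump2 ?(ne isT isT) ?(ne' isT isT) // ?gup_pole ?glo_pole ?invrK; ring].
Qed.

(** By parity y_(N-r) = y_r, and the mirror is an upper corner as well. The exponent difference is
    2, where [gup] vanishes: its zero cancels the pole of the blocked corner. *)
Lemma blocked_dn p r : adm p -> upper_corner p r -> ~~ vdn p r -> cdiag q p r = 0.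
Proof.
move=> ap U; rewrite /vdn U /= negb_or -ltnNge -ltNge => /andP[rn le].
have hr := upper_lt U; have /and3P[_ /eqP u1 /eqP u2] := U.
have [[px _ _ _] _] := ap.
have p1 : ((N - r)%N%:Z - p`_(N - r) == 1 %[mod 2])%Z by apply: (px _ _).2; lia.
have p2 : (r%:Z - p`_r == 1 %[mod 2])%Z by apply: (px _ _).2; lia.
have l1 := @adm_le _ _ _ p r (N - r) ap ltac:(lia) ltac:(lia).
have e0 : p`_(N - r) = p`_r.
  by move: p1 p2 l1 le; rewrite !heightE; clear -hr; lia.
have l2 := @adm_le _ _ _ p r.-1 (N - r).+1 ap ltac:(lia) ltac:(lia).
have l3 := @adm_le _ _ _ p r.+1 (N - r).-1 ap ltac:(lia) ltac:(lia).
have s1 := @adm_step _ _ _ p (N - r) ap ltac:(lia).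
have s2 := @adm_step _ _ _ p (N - r).-1 ap ltac:(lia).
have U' : upper_corner p (N - r).
  rewrite prednK in s2; last by lia.
  apply/and3P; split; first by lia.
    by apply/eqP; move: l3 s2; rewrite u2 e0 !heightE; clear; lia.
  by apply/eqP; move: l2 s1; rewrite u1 e0 !heightE; clear; lia.
rewrite /cdiag /cfac U' (_ : r == n = false); last by lia.
have /and3P[_ /eqP u3 _] := U'.
have -> : pexp p (N - r) - pexp p r = 2.
  have [a1 a2] : (n <= r)%N = false /\ (n < r)%N = false by lia.
  have [a3 a4] : (n <= N - r)%N = true /\ (n < N - r)%N = true by lia.
  by rewrite /pexp u1 u3 e0 a1 a2 a3 a4 !heightE; clear; lia.
by rewrite /gup -exprnP (_ : q - q^-1 * q ^+ 2 = 0) ?mul0r //; field.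
Qed.

(** The same cancellation between two lower corners, at difference -2, the zero of [glo]. *)
Lemma blocked_up p r : adm p -> lower_corner p r -> ~~ vup p r -> cdiag q p r = 0.
Proof.
move=> ap L nv; have hr := lower_lt L.
have vs : vup p (N - r) by have [h|//] := lower_vup ap L; rewrite h in nv.
have /andP[L' _] := vs; have U' : upper_corner p (N - r) = false.
  by apply/negP => /upper_lower; rewrite L'.
move: nv; rewrite /vup L /= negb_or -ltnNge -ltNge => /andP[rn le].
have /and3P[_ /eqP u1 _] := L; have /and3P[_ /eqP u3 _] := L'.
have [[px _ _ _] _] := ap.
have p1 : ((N - r)%N%:Z - p`_(N - r) == 1 %[mod 2])%Z by apply: (px _ _).2; lia.
have p2 : (r%:Z - p`_r == 1 %[mod 2])%Z by apply: (px _ _).2; lia.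
have l1 := @adm_le _ _ _ p (N - r) r ap ltac:(lia) ltac:(lia).
have e0 : p`_(N - r) = p`_r.
  by move: p1 p2 l1 le; rewrite !heightE; clear -hr; lia.
rewrite /cdiag /cfac U' L' (_ : r == n = false); last by lia.
have -> : pexp p (N - r) - pexp p r = - 2.
  have [a1 a2] : (n <= r)%N = true /\ (n < r)%N = true by lia.
  have [a3 a4] : (n <= N - r)%N = false /\ (n < N - r)%N = false by lia.
  by rewrite /pexp u1 u3 e0 a1 a2 a3 a4 !heightE; clear; lia.
by rewrite /glo -exprnN (_ : q^-1 - q * q ^- 2 = 0) ?mul0r //; field.
Qed.

Variable V : lmodType C.
Implicit Types (phi : pathT n -> V).

Definition Dn j (m : int) phi p : V :=
  \sum_(r < N | (bar r == j) && vdn p r)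
    (cdn q p r * pole p r ^ m) *: phi (pshift p r 2).
Definition Up i (m : int) phi p : V :=
  \sum_(r < N | (bar r == i) && vup p r)
    (cup q p r * pole p r ^ m) *: phi (pshift p r (-2)).

Lemma Dn_Up i j m l phi p : adm p ->
  Dn j m (Up i l phi) p - Up i l (Dn j m phi) p =
  if i == j then
    ((qsub q i - (qsub q i)^-1)^-1 * lpsi q (path_mon q p) i (m + l)) *: phi p
  else 0.
Proof.
move=> ap.
pose c1 (r s : 'I_N) := [&& bar r == j, vdn p r, bar s == i & vup (pshift p r 2) s].
pose T1 (r s : 'I_N) := if c1 r s then
  (cdn q p r * pole p r ^ m * (cup q (pshift p r 2) s * pole (pshift p r 2) s ^ l)) *:
    phi (pshift (pshift p r 2) s (-2)) else 0.
pose c2 (r s : 'I_N) := [&& bar s == i, vup p s, bar r == j & vdn (pshift p s (-2)) r].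
pose T2 (r s : 'I_N) := if c2 r s then
  (cup q p s * pole p s ^ l * (cdn q (pshift p s (-2)) r * pole (pshift p s (-2)) r ^ m)) *:
    phi (pshift (pshift p s (-2)) r 2) else 0.
have -> : Dn j m (Up i l phi) p = \sum_r \sum_s T1 r s.
  rewrite /Dn big_mkcond; apply: eq_bigr => r _; rewrite /T1 /c1.
  case: (bar r == j) (vdn p r) => [] [] /=; try by rewrite big1.
  by rewrite /Up scaler_sumr big_mkcond; apply: eq_bigr => s _; case: ifP; rewrite ?scalerA.
have -> : Up i l (Dn j m phi) p = \sum_r \sum_s T2 r s.
  rewrite exchange_big /= /Up big_mkcond; apply: eq_bigr => s _; rewrite /T2 /c2.
  case: (bar s == i) (vup p s) => [] [] /=; try by rewrite big1.
  by rewrite /Dn scaler_sumr big_mkcond; apply: eq_bigr => r _; case: ifP; rewrite ?scalerA.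
rewrite -sumrB; under eq_bigr => r _ do rewrite -sumrB.
have T12 (r s : 'I_N) : s != r -> T1 r s - T2 r s = 0.
  move=> ne; have ne' : (r : nat) != s by rewrite eq_sym.
  have ler : (r <= N)%N := ltnW (ltn_ord r); have les : (s <= N)%N := ltnW (ltn_ord s).
  have c12 : c1 r s = c2 r s.
    rewrite /c1 /c2; case: (bar r == j); case: (bar s == i);
      by rewrite /= ?andbF ?andbT ?square_valid.
  rewrite /T1 /T2 c12; case: ifP => [c|_]; last by rewrite subrr.
  have /and4P[_ h1 _ h2] : c1 r s by rewrite c12.
  have fr := square_far_dn ne' h1 h2; have fr' : far s r by rewrite farC.
  rewrite [X in phi X]pshiftC // [pole (pshift p r 2) s]/pole pexp_far //.
  rewrite [pole (pshift p s (-2)) r]/pole pexp_far // -!/(pole _ _).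
  rewrite mulrACA (square_coef q0 hq ap ne' h1 h2) [X in _ * X]mulrC mulrACA.
  exact: subrr.
under eq_bigr => r _.
  rewrite (bigD1 r) //= big1 ?addr0 => [|s ne]; last exact: T12.
  over.
rewrite /T1 /T2 /c1 /c2 /= {T1 T2 c1 c2 T12}.
(* A round trip along one move gives the residue at r. A blocked corner has no round trip and, by
   [blocked_dn] and [blocked_up], no residue. *)
have E (r : 'I_N) :
  (if [&& bar r == j, vdn p r, bar r == i & vup (pshift p r 2) r] then
     (cdn q p r * pole p r ^ m * (cup q (pshift p r 2) r * pole (pshift p r 2) r ^ l)) *:
     phi (pshift (pshift p r 2) r (-2)) else 0) -
  (if [&& bar r == i, vup p r, bar r == j & vdn (pshift p r (-2)) r] then
     (cup q p r * pole p r ^ l * (cdn q (pshift p r (-2)) r * pole (pshift p r (-2)) r ^ m)) *: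
     phi (pshift (pshift p r (-2)) r 2) else 0) =
  (if (bar r == i) && (i == j) then
     csign p r * cdiag q p r * pole p r ^ (m + l) else 0) *: phi p.
  have [rN ler] : (r < N)%N /\ (r <= N)%N by rewrite ltn_ord ltnW.
  have -> : [&& bar r == j, vdn p r, bar r == i & vup (pshift p r 2) r] =
      ((bar r == i) && (i == j)) && vdn p r.
    case: eqP => [rj|nrj]; case: eqP => [ri|nri]; rewrite ?andbF ?andbT //=.
      rewrite -ri rj eqxx; case: (boolP (vdn p r)) => // /(vup_dn ap) -> //.
    by case: eqP => // ij; case: nrj; rewrite ri ij.
  have -> : [&& bar r == i, vup p r, bar r == j & vdn (pshift p r (-2)) r] =
      ((bar r == i) && (i == j)) && vup p r.
    case: (eqVneq (bar r) i) => [ri|nri] //=; rewrite -ri.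
    case: eqP => rj; rewrite ?andbF //=.
    by case: (boolP (vup p r)) => // /(vdn_up ap) ->.
  case: ((bar r == i) && (i == j)); last by rewrite !subr0 scale0r.
  rewrite /= !pshiftK // /csign.
  have r0 : (0 < r)%N -> (r : nat) != r.-1 by lia.
  have X d : (0 < r)%N -> pole (pshift p r d) r = pole p r.
    by move=> /r0 ne; rewrite /pole pexp_shift.
  have P0 := pole_neq0 p r.
  have [hU|nU] := boolP (upper_corner p r).
    have hr := upper_lt hU; have hL := upper_lower hU.
    rewrite hL (_ : vup p r = false) /=; last by rewrite /vup hL.
    rewrite !subr0 mul1r; case: ifP => [hv|/negbT nv]; last by rewrite blocked_dn // mul0r scale0r.
    have [<- _] := cdiagE q0 p hr; rewrite X; last by lia.
    by rewrite mulrACA expfzDr.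
  rewrite (_ : vdn p r = false) /=; last by rewrite /vdn (negPf nU).
  have [hL|nL] := boolP (lower_corner p r); last first.
    by rewrite /vup (negPf nL) /= !subr0 !mul0r scale0r.
  have hr := lower_lt hL.
  rewrite !sub0r mulN1r mulNr scaleNr; congr (- _).
  case: ifP => [hv|/negbT nv]; last by rewrite blocked_up // mul0r scale0r.
  have [_ <-] := cdiagE q0 p hr; rewrite X; last by lia.
  by rewrite mulrACA expfzDr // [pole p r ^ l * _]mulrC.
under eq_bigr => r _ do rewrite E.
rewrite -scaler_suml; case: eqP => ij; last first.
  by rewrite big1 ?scale0r // => r _; rewrite andbF.
congr (_ *: _); under eq_bigr => r _ do rewrite andbT.
rewrite -big_mkcond (sum_poss (G := fun r => csign p r * cdiag q p r * pole p r ^ (m + l))).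
  by rewrite lpsi_path // mulrA mulVf ?mul1r // qdiff_neq0.
by rewrite /csign /upper_corner /lower_corner subrr !mul0r.
Qed.

End PathOperators.

(** * Cartan operators on a module *)

Section Operators.
Variables (C : numFieldType) (q : C) (n : nat).
Hypotheses (q0 : q != 0) (hq : forall m : nat, (0 < m)%N -> q ^+ m != 1).
Variables (V : vectType C) (M : Uq_module q n V).
Hypothesis C1 : forall b, Cop M b = 1.
Implicit Types (f g : endo V) (u w : V) (i j : 'I_n) (b : bool).

Lemma endoM f g u : (f * g) u = f (g u). Proof. exact: comp_lfunE. Qed.
Lemma endoD f g u : (f + g) u = f u + g u. Proof. exact: add_lfunE. Qed.
Lemma endoN f u : (- f) u = - f u. Proof. exact: opp_lfunE. Qed.
Lemma endoB f g u : (f - g) u = f u - g u. Proof. by rewrite endoD endoN. Qed.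
Lemma endoZ c f u : (c *: f) u = c *: f u. Proof. exact: scale_lfunE. Qed.
Lemma endo0 u : (0 : endo V) u = 0. Proof. exact: zero_lfunE. Qed.
Lemma endo1 u : (1 : endo V) u = u. Proof. exact: id_lfunE. Qed.
Lemma endo_sum (I : Type) (r : seq I) (P : pred I) (F : I -> endo V) u :
  (\sum_(x <- r | P x) F x) u = \sum_(x <- r | P x) F x u.
Proof. exact: sum_lfunE. Qed.

Lemma Cpow1 m : Cpow M m = 1.
Proof. by rewrite /Cpow C1 expr1n. Qed.

Lemma X_XpXm i j r s u :
  Xop M true i r (Xop M false j s u) = Xop M false j s (Xop M true i r u) +
  if i == j then (qsub q i - (qsub q i)^-1)^-1 *:
    (psi q M true i (r + s) u - psi q M false i (r + s) u) else 0.
Proof.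
have := congr1 (fun f : endo V => f u) (rel_XpXm (Uq_actP M) i j r s).
rewrite /= endoB !endoM => /eqP; rewrite subr_eq addrC => /eqP ->; congr (_ + _).
by case: ifP => _; rewrite ?endo0 // endoZ endoB !endoM !Cpow1 !endo1.
Qed.

Lemma H_X b i j r s u : r != 0 ->
  Hop M i r (Xop M b j s u) = Xop M b j s (Hop M i r u) +
  ((-1) ^+ (~~ b) * (r%:~R^-1 * qint (qsub q i) (r * cartan i j))) *:
    Xop M b j (r + s) u.
Proof.
move=> r0; have := congr1 (fun f : endo V => f u) (rel_HX (Uq_actP M) b i j s r0).
rewrite /= endoB !endoM => /eqP; rewrite subr_eq addrC => /eqP ->; congr (_ + _).
by rewrite endoZ endoM Cpow1 endo1.
Qed.

Lemma K_K b i u : Kop M b i (Kop M (~~ b) i u) = u.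
Proof. by rewrite -endoM (rel_K (Uq_actP M)) endo1. Qed.

Lemma K_X b i j r u : Kop M true i (Xop M b j r u) =
  qsub q i ^ signed b (cartan i j) *: Xop M b j r (Kop M true i u).
Proof.
have := congr1 (fun f : endo V => f (Kop M true i u)) (rel_KX (Uq_actP M) b i j r).
by rewrite /= endoZ !endoM (K_K false).
Qed.

Lemma K'_X b i j r u : Kop M false i (Xop M b j r u) =
  qsub q i ^ (- signed b (cartan i j)) *: Xop M b j r (Kop M false i u).
Proof.
have x0 := qsub_neq0 q0 i.
rewrite -[in LHS](K_K true i u) -[Xop M b j r _](scalerK (expfz_neq0 (signed b (cartan i j)) x0)).
by rewrite -K_X linearZ /= (K_K false) -invr_expz.
Qed.

Lemma signedK b (m : int) : signed b (signed b m) = m.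
Proof. by case: b => //=; rewrite opprK. Qed.

Definition psi_log b i (s : nat) : endo V :=
  ((-1) ^+ (~~ b) * (qsub q i - (qsub q i)^-1)) *: Hop M i (signed b s%:Z).

Lemma psi_nat b i (r : nat) :
  psi q M b i (signed b r%:Z) = Kop M b i * exp_coef (psi_log b i) r.
Proof. by rewrite /psi signedK. Qed.

Lemma psi_neg b i (r : nat) : psi q M b i (signed b (Negz r)) = 0.
Proof. by rewrite /psi signedK. Qed.

Lemma psi_cases b i t (P : endo V -> C -> Prop) (F : nat -> C) :
  (forall r, P (psi q M b i (signed b r%:Z)) (F r)) -> P 0 0 ->
  P (psi q M b i t) (ext F (signed b t)).
Proof.
move=> H H0; rewrite -[in psi q M b i t](signedK b t).
by case: (signed b t) => r /=; [exact: H|rewrite psi_neg].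
Qed.

(* The truncation r <= N is what allows to recover a from exp_coef a. *)
Lemma ser_pow_eigen (a : nat -> endo V) (al : nat -> C) u N k r :
  (forall s, (0 < s <= N)%N -> a s u = al s *: u) -> (r <= N)%N ->
  ser_pow a k r u = spow al k r *: u.
Proof.
move=> H; elim: k r => [|k IH] r le /=; first by case: eqP; rewrite ?endo1 ?endo0 ?scale1r ?scale0r.
rewrite endo_sum scaler_suml; apply: eq_big_nat => s hs.
by rewrite endoM IH ?linearZ /= ?H ?scalerA ?[_ * al s]mulrC //; lia.
Qed.

Lemma exp_coef_eigen (a : nat -> endo V) (al : nat -> C) u r :
  (forall s, (0 < s)%N -> a s u = al s *: u) ->
  exp_coef a r u = expc al r *: u.
Proof.
move=> H; rewrite /exp_coef /expc endo_sum scaler_suml; apply: eq_bigr => k _.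
by rewrite endoZ (@ser_pow_eigen a al u r) ?scalerA // => s /andP[/H].
Qed.

(** In degree N.+1 the linear term of the exponential is the new coefficient; the higher powers
    involve only coefficients whose action on [u] is known by induction. *)
Lemma exp_coef_eigen_inv (a : nat -> endo V) (al : nat -> C) u :
  (forall r, exp_coef a r u = expc al r *: u) ->
  forall s, (0 < s)%N -> a s u = al s *: u.
Proof.
move=> H; elim/ltn_ind => -[//|N] IH _.
have {}IH s : (0 < s <= N)%N -> a s u = al s *: u by case/andP=> s0 sN; exact: IH.
have := H N.+1; rewrite /exp_coef /expc endo_sum scaler_suml.
have E1 (b : nat -> C) : spow b 1 N.+1 = b N.+1.
  rewrite /= big_nat_recr //= subnn mulr1 big_nat_cond big1 ?add0r // => s hs.
  by rewrite (_ : N.+1 - s == 0 = false)%N ?mulr0 //; lia.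
have E2 : ser_pow a 1 N.+1 u = a N.+1 u.
  rewrite /= big_nat_recr //= subnn mulr1 big_nat_cond big1 ?add0r // => s hs.
  by rewrite (_ : N.+1 - s == 0 = false)%N ?mulr0 //; lia.
pose o : 'I_N.+2 := Ordinal (isT : (1 < N.+2)%N); have eo : nat_of_ord o = 1%N by [].
rewrite (bigD1 o) // [RHS](bigD1 o) // eo endoZ E2 E1 invr1 scale1r mul1r.
move/eqP; rewrite (eq_bigr (fun k : 'I_N.+2 => ((k`!%:R)^-1 * spow al k N.+1) *: u)).
  by rewrite (inj_eq (addIr _)) => /eqP.
move=> k k1; rewrite endoZ -scalerA; congr (_ *: _).
case: k k1 => -[|[|k]] hk //= _; first by rewrite endo0 scale0r.
rewrite endo_sum scaler_suml; apply: eq_big_nat => s hs.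
rewrite endoM (@ser_pow_eigen a al u N k.+1 _ IH); last by lia.
(* For s = N.+1 a positive power remains in degree 0, and this vanishes. *)
have [sN|sN] := eqVneq s N.+1.
  by rewrite sN subnn /= big_geq // mulr0 !scale0r linear0.
by rewrite linearZ /= IH ?scalerA ?[_ * al s]mulrC //; lia.
Qed.

(* u is a joint eigenvector of the Cartan operators with l-weight monomial m. *)
Definition leigen (m : lmon C n) u : Prop :=
  (forall i s, s != 0 -> Hop M i s u = lheig q i s m *: u) /\
  (forall i b, Kop M b i u = qsub q i ^ signed b (ldeg i m) *: u).

Lemma psi_log_leigen m u b i s : leigen m u -> (0 < s)%N ->
  psi_log b i s u = lser q m i b s *: u.
Proof.
move=> [Hu _] s0; rewrite /psi_log endoZ Hu ?scalerA //.
by case: b => /=; rewrite ?oppr_eq0; lia.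
Qed.

Lemma psi_leigen_nat m u b i (r : nat) : leigen m u ->
  psi q M b i (signed b r%:Z) u = lweight_of q m i b r *: u.
Proof.
move=> Hu; rewrite psi_nat endoM (@exp_coef_eigen _ (lser q m i b)).
  by rewrite linearZ /= Hu.2 scalerA mulrC.
by move=> s s0; exact: psi_log_leigen.
Qed.

Lemma psi_leigen m u b i t : leigen m u ->
  psi q M b i t u = ext (lweight_of q m i b) (signed b t) *: u.
Proof.
move=> Hu; apply: (@psi_cases b i t (fun f c => f u = c *: u) (lweight_of q m i b)).
  by move=> r; exact: psi_leigen_nat.
by rewrite endo0 scale0r.
Qed.

(** [is_L] prescribes the eigenvalues of psi; those of h are recovered by a logarithm. *)
Lemma leigen_psi m u :
  (forall i b r, psi q M b i (signed b r%:Z) u = lweight_of q m i b r *: u) ->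
  leigen m u.
Proof.
move=> H; have Ku i b : Kop M b i u = qsub q i ^ signed b (ldeg i m) *: u.
  have := H i b 0%N; rewrite psi_nat /lweight_of expc0 mulr1 => <-.
  by rewrite endoM /exp_coef big_ord1 endoZ /= endo1 invr1 scale1r.
split=> // i s s0.
have Hb b : exp_coef (psi_log b i) ^~ u =1 fun r => expc (lser q m i b) r *: u.
  move=> r; have := H i b r; rewrite psi_nat endoM /lweight_of => /(congr1 (Kop M (~~ b) i)).
  have KK w : Kop M (~~ b) i (Kop M b i w) = w by have := K_K (~~ b) i w; rewrite negbK.
  rewrite KK linearZ /= Ku scalerA => ->; congr (_ *: _).
  rewrite mulrAC -expfzDr ?qsub_neq0 // (_ : signed b _ + _ = 0) ?expr0z ?mul1r //.
  by clear KK; case: b => /=; lia.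
pose b := 0 < s.
have eb : signed b (absz s)%:Z = s by rewrite /b; case: ltrP => /=; lia.
have := exp_coef_eigen_inv (Hb b) (s := absz s); rewrite /psi_log /lser eb endoZ.
move=> /(_ ltac:(lia)) E.
apply: (@scalerI _ _ ((-1) ^+ (~~ b) * (qsub q i - (qsub q i)^-1))).
  by rewrite mulf_neq0 ?signr_eq0 // qdiff_neq0.
by rewrite E scalerA.
Qed.

End Operators.

(** * Vectors below the highest weight *)

Section RhoWeights.
Variable n : nat.
Implicit Types i j : 'I_n.

(* The coefficients of 2 rho in the simple roots, doubled to stay integral at
   the long root. *)
Definition rho_coef i : nat :=
  if i.+1 == n then (n * n.+1)%N else (2 * (i.+1 * (2 * n - i)))%N.

Lemma sum_delta (G : int -> int) (a : int) : 0 <= a ->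
  \sum_(i < n) G i%:Z * (i%:Z == a)%:Z = if a < n%:Z then G a else 0.
Proof.
case: a => // a _; case: ifP => h.
  have ha : (a < n)%N by lia.
  rewrite (bigD1 (Ordinal ha)) //= eqxx mulr1 big1 ?addr0 // => i ne.
  rewrite (_ : (i%:Z == a%:Z) = false) ?mulr0 //; apply: contraNF ne => /eqP e.
  by apply/eqP/val_inj => /=; lia.
rewrite big1 // => i _; rewrite (_ : (i%:Z == a%:Z) = false) ?mulr0 //.
by apply/eqP; have := ltn_ord i; lia.
Qed.

Lemma cartan_delta i j : cartan i j =
  2 * (i%:Z == j%:Z)%:Z - (1 + (j.+1 == n)%N%:Z) * (i%:Z == j%:Z - 1)%:Z
  - (i%:Z == j%:Z + 1)%:Z.
Proof.
rewrite /cartan -val_eqE /=.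
have [e|ne] := eqVneq (i : nat) j.
  by rewrite e; have -> : (j%:Z == j%:Z - 1) = false; lia.
have -> : (i%:Z == j%:Z) = false by lia.
have -> : (i%:Z == j%:Z - 1) = (i.+1 == j) by lia.
have -> : (i%:Z == j%:Z + 1) = (j.+1 == i) by lia.
have [c1|c1] := eqVneq i.+1 j.
  have -> : (j.+1 == i :> nat) = false by lia.
  have -> : (i.+2 == n) = (j.+1 == n) by rewrite c1.
  by case: (j.+1 == n).
have [c2|c2] := eqVneq j.+1 i => //=.
  have -> : (j.+1 == n) = false by have := ltn_ord i; lia.
  by rewrite andbF.
by case: (j.+1 == n).
Qed.

Lemma rho_coefE i : (symd i * rho_coef i)%N%:Z = 2 * (i%:Z + 1) * (2 * n%:Z - i%:Z).
Proof.
rewrite /symd /rho_coef; case: eqP => [e|_]; have li := ltn_ord i; last first.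
  rewrite mul1n !PoszM -subzn; last by lia.
  by rewrite PoszM -natz; ring.
have -> : (i : nat)%:Z = n%:Z - 1 by lia.
by rewrite !PoszM (_ : n.+1%:Z = n%:Z + 1); [ring|lia].
Qed.

(** The doubled 2 rho pairs with the simple root at j to 4 d_j, positive at every node. *)
Lemma rho_cartan j :
  \sum_i (symd i * rho_coef i)%N%:Z * cartan i j = if j.+1 == n then 8 else 4.
Proof.
(* One polynomial for all nodes; its zero at -1 takes care of the missing neighbour of the first
   node. *)
pose G (a : int) : int := 2 * (a + 1) * (2 * n%:Z - a).
have lj := ltn_ord j.
transitivity (2 * (\sum_(i < n) G i%:Z * (i%:Z == j%:Z)%:Z)
  - (1 + (j.+1 == n)%N%:Z) * (\sum_(i < n) G i%:Z * (i%:Z == j%:Z - 1)%:Z)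
  - (\sum_(i < n) G i%:Z * (i%:Z == j%:Z + 1)%:Z)).
  rewrite !mulr_sumr -!sumrB; apply: eq_bigr => i _.
  by rewrite rho_coefE cartan_delta /G; ring.
have -> : \sum_(i < n) G i%:Z * (i%:Z == j%:Z - 1)%:Z = G (j%:Z - 1).
  have [j0|j0] := posnP j; last by rewrite sum_delta ?ifT //; lia.
  rewrite j0 big1 /G => [|[a ha] _ /=]; first by ring.
  by rewrite mulr0.
rewrite !sum_delta //; have -> : j%:Z < n%:Z by lia.
case: eqP => e; last by rewrite ifT; [rewrite /G /=; ring|lia].
have -> : (j%:Z + 1 < n%:Z) = false by lia.
by rewrite /G (_ : n%:Z = j%:Z + 1) /=; [ring|lia].
Qed.

End RhoWeights.

Section HighestWeight.
Variables (C : numFieldType) (q : C) (n : nat).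
Hypotheses (q0 : q != 0) (hq : forall m : nat, (0 < m)%N -> q ^+ m != 1).
Variables (V : vectType C) (M : Uq_module q n V).
Hypothesis C1 : forall b, Cop M b = 1.
Implicit Types (f g : endo V) (u w : V) (i j : 'I_n) (b : bool).

Lemma endo_scale (f : endo V) a u : f (a *: u) = a *: f u.
Proof. exact: linearZ. Qed.

Lemma endo_sub (f : endo V) u w : f (u - w) = f u - f w.
Proof. exact: linearB. Qed.

(** A grading operator: every x^- multiplies its eigenvalue by a negative power of q. The list
    argument is there for induction. *)
Definition Krho_of (l : seq 'I_n) : endo V :=
  \prod_(i <- l) Kop M true i ^+ rho_coef i.
Definition Krho : endo V := Krho_of (index_enum _).

Lemma Kexp_X i j c r u : (Kop M true i ^+ c) (Xop M false j r u) =
  q ^ (- ((symd i * c)%N%:Z * cartan i j)) *: Xop M false j r ((Kop M true i ^+ c) u).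
Proof.
elim: c u => [|c IH] u; first by rewrite muln0 mul0r oppr0 expr0z scale1r !expr0 !endo1.
rewrite exprSr !endoM K_X linearZ /= IH scalerA /=; congr (_ *: _).
rewrite qsubE // -expfzDr //; congr (q ^ _).
by rewrite !PoszM (_ : c.+1%:Z = c%:Z + 1); [ring|lia].
Qed.

Lemma Krho_X j r u : Krho (Xop M false j r u) =
  q ^ (- (if j.+1 == n then 8 else 4)) *: Xop M false j r (Krho u).
Proof.
rewrite -(rho_cartan j) /Krho /Krho_of; elim: (index_enum _) u => [|i l IH] u.
  by rewrite !big_nil oppr0 expr0z scale1r !endo1.
rewrite !big_cons !endoM IH linearZ /= Kexp_X scalerA; congr (_ *: _).
by rewrite -expfzDr // opprD addrC.
Qed.

Lemma Krho_comm (f : endo V) : (forall i, Kop M true i * f = f * Kop M true i) ->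
  forall u, Krho (f u) = f (Krho u).
Proof.
move=> H; rewrite /Krho /Krho_of; elim: (index_enum _) => [|i l IH] u.
  by rewrite !big_nil !endo1.
have Hc c w : (Kop M true i ^+ c) (f w) = f ((Kop M true i ^+ c) w).
  elim: c w => [|c IHc] w; first by rewrite !expr0 !endo1.
  by rewrite !exprSr !endoM -[Kop M true i (f w)]endoM H endoM IHc.
by rewrite !big_cons !endoM IH Hc.
Qed.

Lemma Krho_K b i u : Krho (Kop M b i u) = Kop M b i (Krho u).
Proof. by apply: Krho_comm => j; exact: rel_KK (Uq_actP M) _ _ _ _. Qed.

Lemma Krho_H i s u : s != 0 -> Krho (Hop M i s u) = Hop M i s (Krho u).
Proof. by move=> s0; apply: Krho_comm => j; exact: rel_KH (Uq_actP M) _ _ _ _ s0. Qed.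

Variables (v : V) (m0 : lmon C n).
Hypotheses (v0 : v != 0) (vX : forall i r, Xop M true i r v = 0).
Hypothesis vm : leigen M m0 v.

Lemma Krho_v : exists2 c, c != 0 & Krho v = c *: v.
Proof.
rewrite /Krho /Krho_of; elim: (index_enum _) => [|i l [c c0 IH]].
  by exists 1; rewrite ?oner_neq0 // big_nil endo1 scale1r.
have [d d0 Kd] : exists2 d, d != 0 & (Kop M true i ^+ rho_coef i) v = d *: v.
  elim: (rho_coef i) => [|a [d d0 IHa]]; first by exists 1; rewrite ?oner_neq0 // expr0 endo1 scale1r.
  exists (d * qsub q i ^ ldeg i m0); first by rewrite mulf_neq0 // expfz_neq0 // qsub_neq0.
  by rewrite exprSr endoM vm.2 linearZ /= IHa scalerA mulrC.
exists (c * d); first by rewrite mulf_neq0.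
by rewrite big_cons endoM IH linearZ /= Kd scalerA.
Qed.

Section Below.
Variable c : C.
Hypotheses (c0 : c != 0) (Kv : Krho v = c *: v).

(** The product of the operators Krho - c q^-a over [s]. Annihilation by such a product replaces a
    decomposition into weight spaces, and closure under sums becomes concatenation of lists. *)
Definition shrink (s : seq nat) u : V :=
  foldr (fun (a : nat) w => Krho w - (c * q ^- a) *: w) u s.

Lemma shrink_lin s a u w : shrink s (a *: u + w) = a *: shrink s u + shrink s w.
Proof.
elim: s => //= x s ->; rewrite linearP /= scalerBr scalerDr !scalerA opprD.
by rewrite [_ * a]mulrC addrACA.
Qed.

Lemma shrink0 s : shrink s 0 = 0.
Proof. by elim: s => //= x s ->; rewrite linear0 scaler0 subrr. Qed.

Lemma shrink_comm s (f : endo V) u : (forall w, Krho (f w) = f (Krho w)) ->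
  shrink s (f u) = f (shrink s u).
Proof. by move=> H; elim: s => //= x s ->; rewrite H endo_sub endo_scale. Qed.

Lemma shrink_cat s t u : shrink (s ++ t) u = shrink s (shrink t u).
Proof. by rewrite /shrink foldr_cat. Qed.

Lemma shrinkC s t u : shrink s (shrink t u) = shrink t (shrink s u).
Proof.
elim: t => //= x t <-.
rewrite addrC -scaleNr shrink_lin scaleNr addrC; congr (_ - _).
exact: (@shrink_comm s Krho).
Qed.

(* u is a sum of vectors of weights strictly below the weight of v. *)
Definition below u := exists2 s : seq nat, all (leq 1) s & shrink s u = 0.

Lemma below_lin a u w : below u -> below w -> below (a *: u + w).
Proof.
move=> [s s1 su] [t t1 tw]; exists (s ++ t); first by rewrite all_cat s1.
by rewrite shrink_lin !shrink_cat tw shrink0 shrinkC su shrink0 scaler0 addr0.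
Qed.

Lemma below_comm f u : (forall w, Krho (f w) = f (Krho w)) -> below u -> below (f u).
Proof. by move=> H [s s1 su]; exists s => //; rewrite shrink_comm // su linear0. Qed.

Lemma below_X j r u : below u -> below (Xop M false j r u).
Proof.
move=> [s s1 su]; pose d : nat := if j.+1 == n then 8 else 4.
exists [seq (a + d)%N | a <- s]; first by rewrite all_map; apply: sub_all s1 => a h; exact: leq_trans h (leq_addr _ _).
suff -> : shrink [seq (a + d)%N | a <- s] (Xop M false j r u) =
    q ^- (size s * d) *: Xop M false j r (shrink s u) by rewrite su linear0 scaler0.
elim: s {s1 su} => [|a s IH] /=; first by rewrite mul0n expr0 invr1 scale1r.
rewrite IH linearZ /= Krho_X linearB linearZ /= !scalerA scalerBr.
have -> : q ^ (- (if j.+1 == n then 8 else 4)) = q ^- d.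
  by rewrite /d; case: ifP.
rewrite endo_scale !scalerA mulSn !exprD !invfM [q ^- d * _]mulrC.
by congr (_ - _ *: _); ring.
Qed.

Lemma below_Xv j r : below (Xop M false j r v).
Proof.
pose d : nat := if j.+1 == n then 8 else 4; exists [:: d].
  by rewrite /= /d; case: ifP.
rewrite /= Krho_X Kv linearZ /= scalerA.
have -> : q ^ (- (if j.+1 == n then 8 else 4)) = q ^- d by rewrite /d; case: ifP.
by rewrite mulrC subrr.
Qed.

(** On [v] the product has the factors c (1 - q^-a), nonzero since a >= 1 and q is not a root of
    unity. *)
Lemma not_below_v : ~ below v.
Proof.
move=> [s s1]; suff [a a0 ->] : exists2 a, a != 0 & shrink s v = a *: v.
  by move/eqP; rewrite scaler_eq0 (negPf a0) (negPf v0).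
elim: s s1 => [|x s IH] /=; first by exists 1; rewrite ?oner_neq0 ?scale1r.
case/andP=> x1 /IH[a a0 ->]; exists (a * (c - c * q ^- x)).
  rewrite mulf_neq0 // -[X in X - _]mulr1 -mulrBr mulf_neq0 // subr_eq0 eq_sym.
  by rewrite invr_eq1; exact: hq.
by rewrite linearZ /= Kv !scalerA -scalerBl mulrBr [a * c]mulrC; congr (_ *: _); ring.
Qed.

Definition singular u := below u /\ forall i r, Xop M true i r u = 0.

Lemma singular_K b i u : singular u -> singular (Kop M b i u).
Proof.
move=> [bu xu]; split; first by apply: below_comm => // w; exact: Krho_K.
move=> j r; have x0 := qsub_neq0 q0 i.
case: b; apply: (@scalerI _ _ (qsub q i ^ cartan i j)); rewrite ?expfz_neq0 // scaler0.
  by rewrite -(K_X M true) xu linear0.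
have := K'_X q0 M true i j r u; rewrite xu linear0 => /esym/eqP.
by rewrite scaler_eq0 expfz_eq0 (negPf x0) andbF /= => /eqP ->; rewrite scaler0.
Qed.

Lemma singular_H i s u : s != 0 -> singular u -> singular (Hop M i s u).
Proof.
move=> s0 [bu xu]; split; first by apply: below_comm => // w; exact: Krho_H.
move=> j r; have := H_X C1 true i j r u s0.
by rewrite !xu linear0 scaler0 addr0 => <-.
Qed.

(** Combinations of words in the x^- applied to singular vectors. They stay below [v], and commuting
    the Cartan operators and x^+ through the words shows that they form a submodule. *)
Inductive descendant : V -> Prop :=
| desc_singular u of singular u : descendant u
| desc_lin a u w of descendant u & descendant w : descendant (a *: u + w)
| desc_X j r u of descendant u : descendant (Xop M false j r u).

Lemma below0 : below 0. Proof. by exists [::]. Qed.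

Lemma singular0 : singular 0.
Proof. by split; [exact: below0|move=> i r; rewrite linear0]. Qed.

Lemma desc0 : descendant 0. Proof. exact/desc_singular/singular0. Qed.

Lemma descZ a u : descendant u -> descendant (a *: u).
Proof. by move=> du; rewrite -[_ *: u]addr0; apply: desc_lin => //; exact: desc0. Qed.

Lemma descD u w : descendant u -> descendant w -> descendant (u + w).
Proof. by move=> du dw; rewrite -[u]scale1r; exact: desc_lin. Qed.

Lemma desc_below u : descendant u -> below u.
Proof.
elim=> [w [] //|a w w' _ bw _ bw'|j r w _ bw]; first exact: below_lin.
exact: below_X.
Qed.

Lemma desc_K b i u : descendant u -> descendant (Kop M b i u).
Proof.
elim=> [w sw|a w w' _ dw _ dw'|j r w _ dw]; first exact/desc_singular/singular_K.
  by rewrite linearP; exact: desc_lin.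
by case: b dw => dw; rewrite ?K_X ?K'_X //; apply: descZ; exact: desc_X.
Qed.

Lemma desc_H i s u : s != 0 -> descendant u -> descendant (Hop M i s u).
Proof.
move=> s0; elim=> [w sw|a w w' _ dw _ dw'|j r w dw' dw].
- exact/desc_singular/singular_H.
- by rewrite linearP; exact: desc_lin.
by rewrite H_X //; apply: descD; [|apply: descZ]; exact: desc_X.
Qed.

Lemma desc_sum (I : Type) (r : seq I) (P : pred I) (F : I -> V) :
  (forall x, P x -> descendant (F x)) -> descendant (\sum_(x <- r | P x) F x).
Proof. by move=> H; elim/big_rec: _ => [|x w Px dw]; [exact: desc0|apply: descD => //; exact: H]. Qed.

Lemma desc_psi b i t u : descendant u -> descendant (psi q M b i t u).
Proof.
move=> du; apply: (@psi_cases _ _ _ _ M b i t (fun f _ => descendant (f u)) (fun=> 0)).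
  move=> r; rewrite psi_nat endoM; apply: desc_K.
  rewrite /exp_coef endo_sum; apply: desc_sum => k _; rewrite endoZ; apply: descZ.
  suff H k' t' : descendant (ser_pow (psi_log M b i) k' t' u) by exact: H.
  elim: k' t' => [|k' IH] t' /=.
    by case: eqP; rewrite ?endo1 ?endo0 //; move=> _; exact: desc0.
  rewrite endo_sum big_nat_cond; apply: desc_sum => s /andP[hs _].
  rewrite endoM /psi_log endoZ; apply: descZ; apply: desc_H => //.
  by clear IH; case: b => /=; rewrite ?oppr_eq0; lia.
by rewrite endo0; exact: desc0.
Qed.

Lemma desc_Xp i r u : descendant u -> descendant (Xop M true i r u).
Proof.
elim=> [w [_ ->]|a w w' _ dw _ dw'|j s w dw' dw]; first exact: desc0.
  by rewrite linearP; exact: desc_lin.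
rewrite X_XpXm //; apply: descD; first exact: desc_X.
case: ifP => _; last exact: desc0.
apply: descZ; apply: descD; first exact: desc_psi.
by rewrite -scaleN1r; apply: descZ; exact: desc_psi.
Qed.

End Below.

Hypothesis Msimple : simple_module M.

(* A vector below v killed by all x^+ generates a proper submodule. *)
Lemma singular_eq0 c u : c != 0 -> Krho v = c *: v -> singular c u -> u = 0.
Proof.
move=> c0 Kv su.
have UP := @vspace_ofP _ V (descendant c) (desc0 c) (fun a u w => @desc_lin c a u w).
set U := vspace_of (descendant c) in UP.
have subU : submodule M U.
  move=> w /UP dw; split=> [b i r|b i|i r r0|b]; apply/UP.
  - by case: b; [exact: desc_Xp|exact: desc_X].
  - exact: desc_K.
  - exact: desc_H.
  - by rewrite C1 endo1.
have [_ /(_ U subU) [U0|Uf]] := Msimple.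
  by apply/eqP; rewrite -memv0 -U0; apply/UP/desc_singular.
case: (not_below_v c0 Kv); apply: desc_below => //; apply/UP.
by rewrite Uf memvf.
Qed.

End HighestWeight.

(** * Vectors attached to paths *)

Section PathVectors.
Variables (C : numFieldType) (q : C) (n : nat).
Local Notation N := (2 * n)%N.
Hypotheses (q0 : q != 0) (hq : forall m : nat, (0 < m)%N -> q ^+ m != 1).
Variables (i0 : 'I_n) (k : int).
Local Notation adm := (admissible n i0.+1 k).
Implicit Types (p : pathT n) (r s : nat) (i j : 'I_n).

Lemma bar_mirror (r s : 'I_N) : (0 < r)%N -> (0 < s)%N -> bar r = bar s ->
  r != s -> (s : nat) = (N - r)%N /\ (r : nat) != n.
Proof.
case: r => r hr; case: s => s hs /= r0 s0 /(congr1 val) /=.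
by rewrite /fold_pos -val_eqE /=; case: leqP => h1; case: leqP => h2; lia.
Qed.

(* The pole of the other move from p at the same node, if there is one. *)
Definition mate p r : C := if (r != n) && vdn p (N - r) then pole q p (N - r) else 0.

(** Two available poles differ by [vdn_pole_neq], and the default mate 0 is never a pole. *)
Lemma pole_sub_mate p r : adm p -> vdn p r -> pole q p r - mate p r != 0.
Proof.
move=> ap hv; rewrite subr_eq0 /mate; case: ifP => [/andP[rn hv']|_]; last exact: pole_neq0.
rewrite /pole (inj_eq (expq_inj q0 hq)); apply: (vdn_pole_neq ap) => //.
by rewrite subnKC // (vdn_le hv).
Qed.

Section Moves.
Variable V : lmodType C.
Implicit Types phi : pathT n -> V.

Lemma Dn_extract phi p (r : 'I_N) (m : int) : vdn p r ->
  Dn q (bar r) (m + 1) phi p - mate p r *: Dn q (bar r) m phi p =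
  (cdn q p r * pole q p r ^ m * (pole q p r - mate p r)) *: phi (pshift p r 2).
Proof.
move=> hv; rewrite /Dn scaler_sumr -sumrB (bigD1 r) ?eqxx //= big1 ?addr0 => [|s].
  rewrite scalerA -scalerBl expfzDr ?pole_neq0 // expr1z.
  by congr (_ *: _); ring.
case/andP=> /andP[/eqP rs hs] ne.
have r0 : (0 < r)%N by case/andP: hv => /upper_lt/andP[].
have s0 : (0 < s)%N by case/andP: hs => /upper_lt/andP[].
have [es rn] := bar_mirror r0 s0 (esym rs) ltac:(by rewrite eq_sym).
rewrite scalerA -scalerBl expfzDr ?pole_neq0 // expr1z /mate rn -es hs.
by rewrite (_ : _ - _ = 0) ?scale0r //=; ring.
Qed.

End Moves.

Lemma lpow_path i (s : int) p : lpow i s (path_mon q p) =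
  \sum_(r <- poss i) local_term (fun e : int => (q ^ e) ^ s) p r.
Proof.
rewrite path_monE // lpow_lmon_of /pupper /plower !big_map !big_filter.
by rewrite big_mkcond [X in _ - X]big_mkcond -sumrB.
Qed.

Lemma lpow_path_sub i (s : int) p p' :
  lpow i s (path_mon q p') - lpow i s (path_mon q p) =
  \sum_(r <- poss i) (local_term (fun e : int => (q ^ e) ^ s) p' r -
                      local_term (fun e : int => (q ^ e) ^ s) p r).
Proof.
rewrite sumrB.
exact: (f_equal2 (fun x y => x - y) (lpow_path i s p') (lpow_path i s p)).
Qed.

Lemma ldeg_path i p : ldeg i (path_mon q p) =
  \sum_(r <- poss i) local_term (fun=> 1 : int) p r.
Proof.
rewrite path_monE // ldeg_lmon_of /pupper /plower !size_map !size_filter.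
rewrite -!sum1_count !(big_morph _ PoszD (erefl 0%:Z)).
by rewrite big_mkcond [X in _ - X]big_mkcond -sumrB.
Qed.

Lemma ldeg_path_sub i p p' :
  ldeg i (path_mon q p') - ldeg i (path_mon q p) =
  \sum_(r <- poss i) (local_term (fun=> 1 : int) p' r - local_term (fun=> 1 : int) p r).
Proof.
rewrite sumrB; exact: (f_equal2 (fun x y => x - y) (ldeg_path i p') (ldeg_path i p)).
Qed.

Lemma cartan_neq i j : i != j ->
  [\/ cartan i j = -1, cartan i j = -2 /\ symd i = 1%N | cartan i j = 0].
Proof.
rewrite /cartan /symd => /negPf ->; case: ifP => _; last by constructor 3.
case: ifP => [/andP[/eqP i2 _]|_]; last by constructor 1.
by constructor 2; split=> //; case: eqP => //; lia.
Qed.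

Lemma lpow_move i (s : int) p (r : 'I_N) : adm p -> vdn p r ->
  lpow i s (path_mon q (pshift p r 2)) - lpow i s (path_mon q p) =
  if i == bar r then - (q ^ (pexp p r + (symd (bar r))%:Z)) ^ s
                     - (q ^ (pexp p r - (symd (bar r))%:Z)) ^ s
  else if cartan i (bar r) == -1 then (q ^ pexp p r) ^ s
  else if cartan i (bar r) == -2
    then (q ^ (pexp p r - 1)) ^ s + (q ^ (pexp p r + 1)) ^ s
  else 0.
Proof.
move=> ap hv; pose h (e : int) := (q ^ e) ^ s; rewrite -/(h _).
rewrite lpow_path_sub (local_increment h i ap hv (j := bar r)) //.
by apply: bar_poss; case/andP: hv => /upper_lt/andP[].
Qed.

Lemma qintN (x : C) (m : int) : qint x (- m) = - qint x m.
Proof. by rewrite /qint opprK -mulNr opprB. Qed.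

Lemma qint_double (x : C) (s : int) : x != 0 ->
  qint x (s * 2) = qint x s * (x ^ s + x ^ (- s)).
Proof.
move=> x0; rewrite /qint mulrAC; congr (_ / _).
rewrite mulr_natr mulr2n opprD !expfzDr //.
set a := x ^ s; set b := x ^ (- s); by ring.
Qed.

(** [2s] = [s] (q_i^s + q_i^-s) turns the increment of the power sum into [s a_ij]. When a_ij = -2,
    node i is short, so q_i = q matches the offsets by 1. *)
Lemma lheig_move i (s : int) p (r : 'I_N) : adm p -> vdn p r -> s != 0 ->
  lheig q i s (path_mon q (pshift p r 2)) = lheig q i s (path_mon q p) -
    s%:~R^-1 * qint (qsub q i) (s * cartan i (bar r)) * pole q p r ^ s.
Proof.
move=> ap hv s0; apply/eqP; rewrite addrC -subr_eq; apply/eqP.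
rewrite /lheig -mulrBr lpow_move // -[LHS]mulrA -[X in _ = - X]mulrA -[RHS]mulrN; congr (_ * _).
have P0 := pole_neq0 q0 p r; set A := pole q p r in P0 *.
have x0 := qsub_neq0 q0 i.
have hD (e d : int) : (q ^ (e + d)) ^ s = (q ^ e) ^ s * (q ^ d) ^ s.
  by rewrite expfzDr // expfzMl.
rewrite -/A; have [ij|ne] := eqVneq i (bar r).
  have -> : cartan i (bar r) = 2 by rewrite /cartan ij eqxx.
  rewrite qint_double // -ij !hD -/(pole q p r) -/A -invr_expz -/(qsub q i) exprz_inv.
  by ring.
have [c|[c sy]|c] := cartan_neq ne; rewrite c /=.
- by rewrite mulrN1 qintN -/(pole q p r) -/A; ring.
- rewrite mulrN qintN qint_double // !hD -/(pole q p r) -/A -invr_expz.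
  rewrite (_ : qsub q i = q) ?expr1z ?exprz_inv; last by rewrite /qsub sy expr1.
  by rewrite expr1 -invr_expz; ring.
- by rewrite !mulr0 /qint oppr0 subrr !mul0r oppr0.
Qed.

Lemma ldeg_move i p (r : 'I_N) : adm p -> vdn p r ->
  ldeg i (path_mon q (pshift p r 2)) = ldeg i (path_mon q p) - cartan i (bar r).
Proof.
move=> ap hv; apply/eqP; rewrite addrC -subr_eq; apply/eqP.
rewrite ldeg_path_sub (local_increment (fun=> 1 : int) i ap hv (j := bar r)); last first.
  by apply: bar_poss; case/andP: hv => /upper_lt/andP[].
have [ij|ne] := eqVneq i (bar r); first by rewrite /cartan ij eqxx.
by have [c|[c _]|c] := cartan_neq ne; rewrite c.
Qed.

Variables (V : vectType C) (M : Uq_module q n V).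
Hypothesis C1 : forall b, Cop M b = 1.
Hypothesis Msimple : simple_module M.
Variable v : V.
Hypotheses (v0 : v != 0) (vX : forall i (m : int), Xop M true i m v = 0).
Hypothesis vm : leigen M (Yvar i0 (q ^ k)) v.

(** Any upward move may be picked. The scalar inverts the coefficient of [Dn_extract] at m = 0. *)
Fixpoint phi_rec (d : nat) p : V :=
  if d is d'.+1 then
    if [pick r : 'I_N | vup p r] is Some r then
      let p' := pshift p r (-2) in let u := phi_rec d' p' in
      (cdn q p' r * (pole q p' r - mate p' r))^-1 *:
        (Xop M false (bar r) 1 u - mate p' r *: Xop M false (bar r) 0 u)
    else v
  else v.

Definition phi p : V := phi_rec (pdepth i0 k p) p.

Lemma phi_top : phi (top_path i0 k) = v.
Proof. by rewrite /phi pdepth_top. Qed.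

Lemma phi_step p d : adm p -> pdepth i0 k p = d.+1 ->
  exists (r : 'I_N) (p' : pathT n),
  [/\ adm p', vdn p' r, p = pshift p' r 2, pdepth i0 k p' = d &
  phi p = (cdn q p' r * (pole q p' r - mate p' r))^-1 *:
    (Xop M false (bar r) 1 (phi p') - mate p' r *: Xop M false (bar r) 0 (phi p'))].
Proof.
move=> ap dp; rewrite /phi dp /=; case: pickP => [r hv|nv]; last first.
  have ne : p <> top_path i0 k by move=> e; rewrite e pdepth_top in dp.
  by have [r hr hv] := adm_ex_vup ap ne; have := nv (Ordinal hr); rewrite hv.
have dE : pdepth i0 k (pshift p r (-2)) = d.
  by have := pdepth_up ap hv; rewrite dp => -[].
exists r, (pshift p r (-2)); split=> //.
- exact: adm_up.
- exact: vdn_up ap hv.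
- by rewrite pshiftK // (vup_le hv).
by rewrite dE.
Qed.

Lemma Up_top i m (f : pathT n -> V) : Up q i m f (top_path i0 k) = 0.
Proof. by rewrite /Up big1 // => r; rewrite /vup top_lower andbF. Qed.

(** Proved jointly, with x^- one level behind: identifying x^- on depth d uses the action of x^+ on
    the vectors of depth d.+1. *)
Definition phi_ok (d : nat) : Prop :=
  [/\ forall p, adm p -> (pdepth i0 k p <= d)%N ->
        (forall i m, Xop M true i m (phi p) = Up q i m phi p) /\
        leigen M (path_mon q p) (phi p),
      forall c, Krho M v = c *: v -> forall p, adm p ->
        (0 < pdepth i0 k p <= d)%N -> below M c (phi p)
    & forall p, adm p -> (pdepth i0 k p < d)%N ->
        forall j m, Xop M false j m (phi p) = Dn q j m phi p].

(** Commuting x^+ past x^- leaves x^- on vectors of smaller depth, where it is known to be [Dn];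
    then [Dn_Up] rearranges the sum. *)
Lemma XpXm_phi d p i j m l : phi_ok d -> adm p -> (pdepth i0 k p <= d)%N ->
  Xop M true i l (Xop M false j m (phi p)) = Dn q j m (Up q i l phi) p.
Proof.
move=> [ok1 _ ok3] ap dp; have [oka okb] := ok1 p ap dp.
rewrite X_XpXm // oka !(psi_leigen q0 _ _ _ okb).
apply/eqP; rewrite eq_sym -subr_eq0; apply/eqP.
have -> : Xop M false j m (Up q i l phi p) = Up q i l (Dn q j m phi) p.
  rewrite /Up linear_sum; apply: eq_bigr => r /andP[_ hv].
  rewrite linearZ /= ok3 //; first exact: adm_up.
  by have := pdepth_up ap hv; lia.
have := Dn_Up q0 hq i j m l phi ap.
rewrite opprD addrA => ->; case: ifP => _; last by rewrite subrr.
rewrite -scalerBl scalerA -/(lpsi q (path_mon q p) i (l + m)).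
by rewrite [l + m]addrC subrr.
Qed.

Lemma phi_ok0 : phi_ok 0.
Proof.
have T p : adm p -> (pdepth i0 k p <= 0)%N -> p = top_path i0 k.
  by move=> ap; rewrite leqn0 => /eqP; exact: pdepth0.
split=> [p ap dp|c _ p _|//]; last by lia.
rewrite (T p ap dp) phi_top; split; last by rewrite path_mon_top.
by move=> i m; rewrite vX Up_top.
Qed.

Lemma phi_okS d : phi_ok d -> phi_ok d.+1.
Proof.
move=> ok; have [ok1 ok2 ok3] := ok.
have [c c0 Kv] := Krho_v q0 vm.
have inv p r : adm p -> vdn p r -> cdn q p r * (pole q p r - mate p r) != 0.
  by move=> ap hv; rewrite mulf_neq0 ?pole_sub_mate ?(cdn_neq0 q0 hq ap hv).
have A p : adm p -> (pdepth i0 k p <= d.+1)%N ->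
    forall i l, Xop M true i l (phi p) = Up q i l phi p.
  move=> ap; rewrite leq_eqVlt => /orP[/eqP dp|]; last by move=> /(ok1 p ap)[].
  move=> i l; have [r [p' [ap' hv pE dp' ->]]] := phi_step ap dp.
  rewrite endo_scale endo_sub endo_scale !(XpXm_phi _ _ _ _ ok ap') ?dp' //.
  rewrite -[1]add0r Dn_extract // expr0z mulr1 scalerA mulVf ?inv // scale1r.
  by rewrite pE.
have G c' : Krho M v = c' *: v -> forall p, adm p ->
    (0 < pdepth i0 k p <= d.+1)%N -> below M c' (phi p).
  move=> Kv' p ap /andP[d0 le]; have [le'|gt] := leqP (pdepth i0 k p) d.
    by apply: ok2 => //; rewrite d0.
  have dp : pdepth i0 k p = d.+1 by apply/eqP; rewrite eqn_leq le gt.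
  have [r [p' [ap' hv pE dp' ->]]] := phi_step ap dp.
  have bX m : below M c' (Xop M false (bar r) m (phi p')).
    have [z|nz] := posnP d; last by apply: below_X => //; apply: ok2 => //; lia.
    by rewrite (pdepth0 ap' (etrans dp' z)) phi_top; exact: below_Xv.
  have b0 := below0 M c'; rewrite -[_ *: _]addr0; apply: below_lin => //.
  by rewrite addrC -scaleNr; apply: below_lin.
have X p : adm p -> (pdepth i0 k p < d.+1)%N ->
    forall j m, Xop M false j m (phi p) = Dn q j m phi p.
  move=> ap; rewrite ltnS => dp j m.
  apply/eqP; rewrite -subr_eq0; apply/eqP.
  apply: (singular_eq0 q0 hq C1 v0 Msimple c0 Kv); split.
    have b0 := below0 M c.
    rewrite addrC -scaleN1r; apply: below_lin; last first.
      have [z|nz] := posnP (pdepth i0 k p); last by apply: below_X => //; apply: ok2 => //; lia.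
      by rewrite (pdepth0 ap z) phi_top; exact: below_Xv.
    rewrite /Dn; elim/big_rec: _ => [//|r u /andP[_ hv] bu].
    apply: below_lin => //; apply: G => //; first exact: adm_dn.
    by rewrite (pdepth_dn ap hv) /=.
  move=> i l; rewrite endo_sub (XpXm_phi _ _ _ _ ok ap dp) /Dn linear_sum.
  apply/eqP; rewrite subr_eq0; apply/eqP; apply: eq_bigr => r /andP[_ hv].
  rewrite linearZ /= A //; first exact: adm_dn.
  by rewrite (pdepth_dn ap hv).
split=> // p ap dp; split; first exact: A.
move: dp; rewrite leq_eqVlt => /orP[/eqP dp|]; last by move=> /(ok1 p ap)[].
have [r [p' [ap' hv pE dp' pphi]]] := phi_step ap dp.
have [_ [Hp Kp]] := ok1 p' ap' ltac:(by rewrite dp').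
have Xp m : Xop M false (bar r) m (phi p') = Dn q (bar r) m phi p'.
  by apply: X => //; rewrite dp'.
set D := (cdn q p' r * _)^-1 in pphi; set t := mate p' r in pphi.
(* [phi p] combines two modes of x^- on [phi p'], and k_i scales all modes alike. *)
have eigK (f : endo V) c' : (forall m, f (Xop M false (bar r) m (phi p')) =
    c' *: Xop M false (bar r) m (phi p')) -> f (phi p) = c' *: phi p.
  move=> H; rewrite pphi endo_scale endo_sub endo_scale !H !scalerBr !scalerA.
  by congr (_ *: _ - _ *: _); ring.
have lE i : ldeg i (path_mon q p) = ldeg i (path_mon q p') - cartan i (bar r).
  by rewrite pE; exact: (ldeg_move i ap' hv).
split=> [i s s0|i b]; last first.
  apply: eigK => m; rewrite lE.
  case: b; rewrite ?K_X ?K'_X // Kp endo_scale scalerA -expfzDr ?qsub_neq0 //;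
    congr (_ ^ _ *: _) => /=; ring.
have -> : lheig q i s (path_mon q p) = lheig q i s (path_mon q p') -
    s%:~R^-1 * qint (qsub q i) (s * cartan i (bar r)) * pole q p' r ^ s.
  by rewrite pE; exact: (lheig_move i ap' hv).
set eta := lheig q i s _; set kap := s%:~R^-1 * _.
have HX m : Hop M i s (Xop M false (bar r) m (phi p')) =
    eta *: Xop M false (bar r) m (phi p') - kap *: Xop M false (bar r) (s + m) (phi p').
  by rewrite H_X // Hp // endo_scale mulN1r scaleNr.
(* h_{i,s} shifts the mode of x^- by s; extracting the move from the shifted modes yields the s-th
   power of its pole. *)
have E : D *: (Xop M false (bar r) (s + 1) (phi p') - t *: Xop M false (bar r) s (phi p')) =
    pole q p' r ^ s *: phi p.
  rewrite !Xp Dn_extract // scalerA -pE; congr (_ *: _).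
  have nz := inv _ _ ap' hv; rewrite -/t in nz.
  rewrite -/t (_ : cdn q p' r * pole q p' r ^ s * (pole q p' r - t) =
    cdn q p' r * (pole q p' r - t) * pole q p' r ^ s); last by ring.
  by rewrite mulrA mulVf // mul1r.
rewrite {1}pphi endo_scale endo_sub endo_scale !HX addr0.
rewrite scalerBl -[(kap * _) *: _]scalerA -E [in RHS]pphi.
rewrite !scalerBr !scalerA opprB.
set x1 := Xop M false (bar r) 1 _; set x0 := Xop M false (bar r) 0 _.
set y1 := Xop M false (bar r) (s + 1) _; set y0 := Xop M false (bar r) s _.
have -> : (D * t * eta = eta * D * t) by ring.
have -> : (D * eta = eta * D) by ring.
have -> : (D * kap = kap * D) by ring.
have -> : (D * t * kap = kap * D * t) by ring.
by rewrite opprB addrACA [RHS]addrACA; congr (_ + _); exact: addrC.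
Qed.

Lemma phi_ok_all d : phi_ok d.
Proof. by elim: d => [|d]; [exact: phi_ok0|exact: phi_okS]. Qed.

Lemma phi_leigen p : adm p -> leigen M (path_mon q p) (phi p).
Proof. by move=> ap; have [/(_ p ap (leqnn _))[]] := phi_ok_all (pdepth i0 k p). Qed.

Lemma phi_Xp p i m : adm p -> Xop M true i m (phi p) = Up q i m phi p.
Proof. by move=> ap; have [/(_ p ap (leqnn _))[]] := phi_ok_all (pdepth i0 k p). Qed.

Lemma phi_Xm p j m : adm p -> Xop M false j m (phi p) = Dn q j m phi p.
Proof. by move=> ap; have [_ _ /(_ p ap (leqnn _))] := phi_ok_all (pdepth i0 k p).+1. Qed.

(* A combination of x^+ operators which, among the phi p' with p' not deeper
   than p, sees only phi p. *)
Lemma dual_operator p : adm p -> exists T : endo V,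
  forall p', adm p' -> (pdepth i0 k p' <= pdepth i0 k p)%N ->
    T (phi p') = (p' == p)%:R *: v.
Proof.
move: {2}(pdepth i0 k p) (erefl (pdepth i0 k p)) => d.
elim: d p => [|d IH] p dp ap.
  exists 1 => p' ap'; rewrite dp leqn0 => /eqP dp'.
  by rewrite (pdepth0 ap dp) (pdepth0 ap' dp') eqxx phi_top endo1 scale1r.
have [r [p1 [ap1 hv pE dp1 _]]] := phi_step ap dp.
have [T HT] := IH p1 dp1 ap1; set t := mate p1 r.
have hu : vup p r by rewrite pE; exact: vup_dn ap1 hv.
have ler := vdn_le hv.
have r0 : (0 < r)%N by case/andP: hv => /upper_lt/andP[].
have p1E : p1 = pshift p r (-2) by rewrite pE pshiftK.
have poleE : pole q p r = pole q p1 r.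
  by rewrite pE /pole pexp_shift //; clear -r0; lia.
set c := cup q p r * (pole q p r - t).
have c0 : c != 0 by rewrite mulf_neq0 ?(cup_neq0 q0 hq ap hu) // poleE pole_sub_mate.
exists (c^-1 *: (T * (Xop M true (bar r) 1 - t *: Xop M true (bar r) 0))) => p' ap' dp'.
rewrite endoZ endoM endoB endoZ !phi_Xp // /Up scaler_sumr -sumrB linear_sum scaler_sumr /=.
have E (s : 'I_N) : (bar s == bar r) && vup p' s ->
    c^-1 *: T ((cup q p' s * pole q p' s ^ 1) *: phi (pshift p' s (-2)) -
      t *: ((cup q p' s * pole q p' s ^ 0) *: phi (pshift p' s (-2)))) =
    if s == r then (p' == p)%:R *: v else 0.
  case/andP=> /eqP sr hs; have les := vup_le hs.
  have ap's := adm_up ap' hs; have dp's := pdepth_up ap' hs.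
  rewrite scalerA -scalerBl endo_scale HT //; last first.
    by move: dp' dp's; rewrite dp dp1 => h1 h2; clear -h1 h2; lia.
  have s0 : (0 < s)%N by case/andP: hs => /lower_lt/andP[].
  have [es|ns] := eqVneq s r.
    rewrite es; have -> : (pshift p' r (-2) == p1) = (p' == p).
      apply/eqP/eqP => [e|->]; last by rewrite p1E.
      by rewrite pE -e pshiftK.
    case: eqP => [->|_]; last by rewrite !scale0r !scaler0.
    rewrite !scale1r scalerA expr1z expr0z mulr1 -[X in c^-1 * X]/(_ * _ - t * _).
    by rewrite [t * _]mulrC -mulrBr -/c mulVf // scale1r.
  (* Another path may reach [p1] from the mirror position; its pole is then [t], and the combination
     of modes kills it. *)
  case: eqP => [e|_]; last by rewrite scale0r !scaler0.
  have hvs : vdn p1 s by rewrite -e; exact: vdn_up ap' hs.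
  have [es rn] := bar_mirror r0 s0 (esym sr) ltac:(by rewrite eq_sym).
  have poleS : pole q p' s = t.
    rewrite /t /mate rn -es hvs /= -e /pole pexp_shift //; clear -s0; lia.
  by rewrite poleS expr1z expr0z mulr1 [t * _]mulrC subrr scale0r scaler0.
rewrite (eq_bigr _ E) -big_mkcondr /=; have [->|ne] := eqVneq p' p.
  by rewrite (big_pred1 r) // => s /=; have [->|_] := eqVneq s r; rewrite ?andbF // eqxx hu.
by rewrite scale0r big1 // => s _; rewrite scale0r.
Qed.

End PathVectors.

(** * The path vectors form a basis *)

Section Basis.
Variables (C : numFieldType) (q : C) (n : nat).
Hypotheses (q0 : q != 0) (hq : forall m : nat, (0 < m)%N -> q ^+ m != 1).
Variables (i0 : 'I_n) (k : int).
Hypothesis hik : (i0.+1%:Z - k == 1 %[mod 2])%Z.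
Local Notation adm := (admissible n i0.+1 k).
Variables (V : vectType C) (M : Uq_module q n V).
Hypothesis C1 : forall b, Cop M b = 1.
Hypothesis Msimple : simple_module M.
Variable v : V.
Hypotheses (v0 : v != 0) (vX : forall i (m : int), Xop M true i m v = 0).
Hypothesis vm : leigen M (Yvar i0 (q ^ k)) v.
Implicit Types (p : pathT n) (u : V) (c : pathT n -> C).

Local Notation phi := (phi i0 k M v).

Definition adm_seq : seq (pathT n) := fset_set adm.

Lemma mem_adm_seq p : (p \in adm_seq) = (p \in adm).
Proof. by rewrite /adm_seq in_fset_set //; exact: adm_finite. Qed.

Lemma adm_seqP p : reflect (adm p) (p \in adm_seq).
Proof. by rewrite mem_adm_seq; apply: (iffP idP) => [/set_mem|/mem_set]. Qed.

Definition combination c : V := \sum_(p <- adm_seq) c p *: phi p.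

Definition spanned u := exists c, u = combination c.

Lemma spanned0 : spanned 0.
Proof. by exists (fun=> 0); rewrite /combination big1 // => p _; rewrite scale0r. Qed.

Lemma spanned_lin a u w : spanned u -> spanned w -> spanned (a *: u + w).
Proof.
move=> [c ->] [d ->]; exists (fun p => a * c p + d p).
rewrite /combination scaler_sumr -big_split; apply: eq_bigr => p _.
by rewrite scalerA scalerDl.
Qed.

Lemma spannedZ a u : spanned u -> spanned (a *: u).
Proof. by move=> su; rewrite -[_ *: u]addr0; apply: spanned_lin => //; exact: spanned0. Qed.

Lemma spanned_phi p : adm p -> spanned (phi p).
Proof.
move=> ap; exists (fun p' => (p' == p)%:R).
rewrite /combination (bigD1_seq p) /= ?fset_uniq //; last exact/adm_seqP.
by rewrite eqxx scale1r big1 ?addr0 // => p' /negPf ->; rewrite scale0r.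
Qed.

Lemma spanned_sum (I : eqType) (r : seq I) (P : pred I) (F : I -> V) :
  (forall x, x \in r -> P x -> spanned (F x)) -> spanned (\sum_(x <- r | P x) F x).
Proof.
move=> H; rewrite big_seq_cond; elim/big_rec: _ => [|x u /andP[xr Px] su]; first exact: spanned0.
by rewrite -[F x]scale1r; apply: spanned_lin => //; exact: H.
Qed.

Lemma spanned_endo (f : endo V) u :
  (forall p, adm p -> spanned (f (phi p))) -> spanned u -> spanned (f u).
Proof.
move=> H [c ->]; rewrite /combination linear_sum; apply: spanned_sum => p /adm_seqP ap _.
by rewrite linearZ; apply/spannedZ/H.
Qed.

Lemma spanned_all u : spanned u.
Proof.
have UP := @vspace_ofP _ V spanned spanned0 (fun a u w => @spanned_lin a u w).
set U := vspace_of spanned in UP.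
have subU : submodule M U.
  move=> w /UP sw; split=> [b i r|b i|i r r0|b]; apply/UP.
  - apply: spanned_endo => // p ap; case: b.
      rewrite (phi_Xp q0 hq C1 Msimple v0 vX vm) //; apply: spanned_sum => s _ /andP[_ hs].
      by apply/spannedZ/spanned_phi; exact: adm_up.
    rewrite (phi_Xm q0 hq C1 Msimple v0 vX vm) //; apply: spanned_sum => s _ /andP[_ hs].
    by apply/spannedZ/spanned_phi; exact: adm_dn.
  - apply: spanned_endo => // p ap.
    by rewrite (phi_leigen q0 hq C1 Msimple v0 vX vm ap).2; apply/spannedZ/spanned_phi.
  - apply: spanned_endo => // p ap.
    by rewrite (phi_leigen q0 hq C1 Msimple v0 vX vm ap).1 //; apply/spannedZ/spanned_phi.
  - by rewrite C1 endo1.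
have vU : v \in U.
  by apply/UP; rewrite -[v](@phi_top _ _ _ i0 k _ M); exact/spanned_phi/adm_top_path.
apply/UP; have [_ /(_ U subU) [U0|->]] := Msimple; last exact: memvf.
by rewrite U0 memv0 (negPf v0) in vU.
Qed.

(** Downward induction on depth: [dual_operator] isolates the coefficient of p once those of deeper
    paths vanish. *)
Lemma combination_inj c : combination c = 0 -> forall p, adm p -> c p = 0.
Proof.
move=> c0; pose m := \max_(p <- adm_seq) pdepth i0 k p.
suff H d p : adm p -> (m < pdepth i0 k p + d)%N -> c p = 0.
  by move=> p ap; apply: (H m.+1 p ap); rewrite addnS ltnS leq_addl.
elim: d p => [|d IH] p ap lt.
  have : (pdepth i0 k p <= m)%N by apply: leq_bigmax_seq => //; exact/adm_seqP.
  by rewrite leqNgt -[pdepth _ _ _]addn0 lt.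
have [T HT] := dual_operator q0 hq C1 Msimple v0 vX vm ap.
have /(congr1 T) := c0; rewrite linear0 /combination linear_sum /=.
rewrite (bigD1_seq p) /= ?fset_uniq //; last exact/adm_seqP.
rewrite linearZ /= HT // eqxx scale1r big_seq_cond big1 ?addr0 => [/eqP|p' /andP[/adm_seqP ap' ne]].
  by rewrite scaler_eq0 (negPf v0) orbF => /eqP.
rewrite linearZ /=; have [le|gt] := leqP (pdepth i0 k p') (pdepth i0 k p).
  by rewrite HT // (negPf ne) scale0r scaler0.
by rewrite IH ?scale0r //; move: lt gt => h1 h2; clear -h1 h2; lia.
Qed.

Lemma phi_free : free [seq phi p | p <- adm_seq].
Proof.
set X := map_tuple phi (in_tuple adm_seq); apply/(freeP (X := X)) => a a0 j.
(* Moves the coefficients from tuple indices to paths; the sum has one term because [adm_seq] has no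
   repetition. *)
pose c p := \sum_(i < size adm_seq | tnth (in_tuple adm_seq) i == p) a i.
have cE i : c (tnth (in_tuple adm_seq) i) = a i.
  rewrite /c (big_pred1 i) // => i' /=.
  by rewrite (inj_eq (tuple_uniqP (in_tuple adm_seq) _)) // fset_uniq.
rewrite -cE; apply: combination_inj; last by apply/adm_seqP; exact: mem_tnth.
rewrite /combination big_tnth -[RHS]a0; apply: eq_bigr => i _.
by rewrite cE -tnth_nth tnth_map.
Qed.

Definition path_weight p : lweight C n := lweight_of q (path_mon q p).

(** On [phi p] each psi - Phi is a scalar; if one of these is nonzero, its nilpotency on [u] forces
    the coefficient of p to vanish. *)
Lemma lspace_span (Phi : lweight C n) : lspace M Phi =
  <<[seq phi p | p <- [seq p <- adm_seq | path_weight p == Phi]]>>%VS.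
Proof.
have psiE p i b r : adm p ->
    psi q M b i (signed b r%:Z) (phi p) = path_weight p i b r *: phi p.
  by move=> ap; apply: psi_leigen_nat => //; exact: (phi_leigen q0 hq C1 Msimple v0 vX vm).
apply/eqP; rewrite eqEsubv; apply/andP; split; last first.
  apply/span_subvP => u /mapP[p]; rewrite mem_filter => /andP[/eqP pw /adm_seqP ap] ->.
  apply/mem_lspace => i b r; exists 1%N.
  by rewrite /= psiE // pw subrr.
apply/subvP => u /mem_lspace uPhi; have [c uc] := spanned_all u.
have c0 p : adm p -> path_weight p != Phi -> c p = 0.
  move=> ap /eqP ne.
  have [i [b [r ner]]] : exists i b r, path_weight p i b r != Phi i b r.
    apply: contrapT => nex; apply: ne; apply/funext => i; apply/funext => b.
    by apply/funext => r; apply: contrapT => /eqP ner; apply: nex; exists i, b, r.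
  have [m um] := uPhi i b r.
  have itE : iter m (fun w => psi q M b i (signed b r%:Z) w - Phi i b r *: w) u =
      combination (fun p => c p * (path_weight p i b r - Phi i b r) ^+ m).
    elim: (m) => [|m' IH] /=.
      by rewrite uc; apply: eq_bigr => p' _; rewrite expr0 mulr1.
    rewrite IH /combination linear_sum scaler_sumr -sumrB.
    rewrite big_seq [RHS]big_seq; apply: eq_bigr => p' /adm_seqP ap'.
    rewrite linearZ /= psiE // !scalerA -scalerBl; congr (_ *: _).
    by rewrite exprSr; ring.
  have := combination_inj (etrans (esym itE) um) ap.
  by move/eqP; rewrite mulf_eq0 expf_eq0 subr_eq0 (negPf ner) andbF orbF => /eqP.
rewrite uc /combination big_seq; apply: memv_suml => p /adm_seqP ap.
have /orP[pw|ne] := orbN (path_weight p == Phi); last by rewrite c0 // scale0r mem0v.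
apply: memvZ; apply: memv_span; apply: map_f; rewrite mem_filter.
by apply/andP; split; [|exact/adm_seqP].
Qed.

Lemma dim_lspace (Phi : lweight C n) : \dim (lspace M Phi) =
  count (fun p => path_weight p == Phi) adm_seq.
Proof.
pose a p := path_weight p == Phi.
have : free [seq phi p | p <- [seq p <- adm_seq | a p]].
  have := phi_free; rewrite -(perm_free (perm_map phi (permEl (perm_filterC a adm_seq)))).
  by rewrite map_cat => /catl_free.
by rewrite lspace_span => /eqP ->; rewrite size_map size_filter.
Qed.

Lemma lweight_mon_path p : lweight_mon q (path_weight p) = path_mon q p.
Proof.
by rewrite /path_weight path_monE lweight_monK // => i a; exact: pupper_lower_neq0.
Qed.

(** Grouping the paths by l-weight turns each dimension into a number of equal terms. *)
Lemma qchar_paths : qchar M = \sum_(p \in adm) (<< path_mon q p >> : laurent C n).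
Proof.
pose F (Phi : lweight C n) : laurent C n := << lweight_mon q Phi >>.
have -> : \sum_(p \in adm) (<< path_mon q p >> : laurent C n) =
    \sum_(Phi <- map path_weight adm_seq) F Phi.
  rewrite fsbig_finite; last exact: adm_finite.
  by rewrite big_map; apply: eq_bigr => p _; rewrite /F lweight_mon_path.
rewrite -big_undup_iterop_count /qchar (fsbigE (undup (map path_weight adm_seq))); first last.
- move=> Phi _; rewrite mem_undup => nPhi; rewrite dim_lspace (_ : count _ _ = 0%N) ?monalgU0 //.
  apply/eqP; rewrite -leqn0 leqNgt -has_count; apply: contra nPhi => /hasP[p ps /eqP <-].
  exact: map_f.
- by [].
- exact: undup_uniq.
apply: eq_big => [Phi|Phi _]; first exact: mem_set.
rewrite dim_lspace count_map -[RHS]/(F Phi *+ _).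
rewrite (eq_count (a2 := fun p => path_weight p == Phi)) //.
by elim: (count _ _) => [|m IH]; rewrite ?monalgU0 // mulrS -IH -monalgUD.
Qed.

End Basis.

Theorem theorem1p1 (R : realType) (q : R[i]) (hq0 : q != 0)
    (hq : forall m : nat, (0 < m)%N -> q ^+ m != 1)
    (n : nat) (hn : (1 <= n)%N) (i : 'I_n) (k : nat)
    (hik : (i.+1%:Z - k%:Z == 1 %[mod 2])%Z)
    (V : vectType R[i]) (M : Uq_module q n V)
    (hM : is_L M (Yvar i (q ^ k%:Z))) :
  qchar M =
  \sum_(p \in admissible n i.+1 k%:Z) (<< path_mon q p >> : laurent R[i] n).
Proof.
have [[C1 _] Msimple [Phi [v [[PhiE v0] vX vPhi _]]]] := hM.
have [PhiE' _] := (is_lmonP hq0 hq Phi _).1 PhiE.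
apply: (qchar_paths hq0 hq hik C1 Msimple v0 vX).
by apply: leigen_psi => // j b r; rewrite vPhi PhiE'.
Qed.
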